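(* Consider the lost-sales inventory model with sales logs, caps $\lambda_t\in[0,\bar D]$, carry-safe caps $a_t=\min_{s=t,\ldots,T}\lambda_s$, $q_t=p_t/(h_t+p_t)$, and conditional noninformative censoring (see context), without assuming the coverage condition $F_t^-(a_t)>q_t$. Fix $0<\delta<1$, $\epsilon>0$ and $x_1\in[0,a_1]$. Let $\mathcal J_t=\{j\in[N_t]:b_t^j\ge a_t\}$, $m_t=|\mathcal J_t|\ge1$, and $W_t^j=\min\{Z_t^j,a_t\}$ for $j\in\mathcal J_t$. The coverage test with failure budget $\delta/2$ passes if, for every $t\in[T]$, $$\frac1{m_t}\sum_{j\in\mathcal J_t}\mathbf 1\{Z_t^j<a_t\}-\sqrt{\frac{\log(4T/\delta)}{2m_t}}>q_t .$$ There are universal constants $C,C'>0$ such that the following holds. Suppose $n$ is a positive integer with $n\ge C\,C_c^2\bar D^2T^2\epsilon^{-2}(1+\log(2/\delta))$ and $m_t\ge n$ for all $t$; select $n$ indices from each $\mathcal J_t$ using only the boundaries, and let $\widehat\pi^\times$ be Product ERM (see context), from $x_1$ with $S_1\ge x_1$, under the empirical marginals of the selected $W_t^j$ (the same qualified observations being used for the test and for fitting). Return the fitted policy only if the test passes. Then, conditional on the boundaries, $$\mathbb P\!\left(\text{test passes and }V_1^{\widehat\pi^\times}(x_1)-V_1^*(x_1)>\epsilon\right)\le\delta.$$ If moreover $F_t^-(a_t)\ge q_t+\gamma_t$ with $\gamma_t>0$ for all $t$, then the per-period requirements $$m_t\ge C'\max\!\left\{\frac{C_c^2\bar D^2T^2}{\epsilon^2}\left(1+\log\frac2\delta\right),\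 \gamma_t^{-2}\log\frac{4T}\delta\right\},\qquad t\in[T],$$ are sufficient for passing and returning an $\epsilon$-optimal policy simultaneously with probability at least $1-\delta$. For $T\ge2$, $0<\epsilon\le T$, constant confidence ($\delta$ fixed) and $C_c=\bar D=1$, usable fraction at least $r\in(0,1]$ (that is, $m_t\ge rN_t$ for all $t$) gives a sufficient raw total $\sum_tN_t=O\!\left(r^{-1}\sum_{t=1}^T\max\{T^2\epsilon^{-2},\gamma_t^{-2}\log T\}\right)$ with period-specific counts.
   Context: Lost-sales inventory model. Horizon $T$; $[n]=\{1,\ldots,n\}$, $u^+=\max\{u,0\}$. Demands $D_1,\ldots,D_T$ are independent with laws $P_t$ supported on $[0,\bar D]$, $\bar D>0$; $F_t^-(u)=\mathbb P(D_t<u)$. Holding and shortage coefficients $h_t,p_t>0$ are known, $C_c=\max_{t\in[T]}\max\{h_t,p_t\}$; fixed and per-unit ordering costs, lead time, and terminal salvage value are zero. Starting period $t$ with inventory $x_t\ge0$, the retailer chooses a post-order level $y_t\ge x_t$ before demand and incurs $c_t(y_t,D_t)$ with $c_t(y,d)=h_t(y-d)^++p_t(d-y)^+$. The next state is $(y_t-D_t)^+$; only sales $\min\{D_t,y_t\}$ are observed. Feasible policies use the information then available and may randomize; $V_t^\pi(x)$ is the expected total cost (under the original demands, on a fresh trajectory independent of the offline data) from period $t$ and state $x$, and $V_t^*(x)=\inf_\pi V_t^\pi(x)$. A policy $\pi$ is $\epsilon$-optimal (at $x_1$) if $V_1^\pi(x_1)-V_1^*(x_1)\le\epsilon$. Sales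 logs and caps. Offline data are logs $((Z_t^j,b_t^j):t\in[T],j\in[N_t])$ with known boundary $b_t^j\ge0$ and $Z_t^j=\min\{D_t^j,b_t^j\}$, where $D_t^j$ is a latent fitting demand. Conditional noninformative censoring: conditional on the complete boundary array $\mathcal B=(b_t^j)$, all latent $D_t^j$ are mutually independent and $D_t^j$ has law $P_t$; each boundary is fixed or determined before its own demand. The numbers $\lambda_t$ are chosen before observing fitting demands, or using only $\mathcal B$; an independent pilot is also allowed if, conditional on the pilot, design information, and complete boundaries, fitting demands remain independent with laws $P_t$. All probabilities are conditional on the complete boundary array. The raw total counts all logs. Product ERM. Given empirical marginals $\widehat P_t$ (here, the uniform distribution on the $n$ selected values $W_t^j$), let $\widehat P^\times=\bigotimes_{t=1}^T\widehat P_t$. For $S\in[0,\bar D]^T$ let $\pi^S$ be the base-stock policy $\pi_t^S(x)=\max\{x,S_t\}$, and let $\ell_{x_1}(\pi;d_{1:T})$ be the realized total holding and shortage cost of $\pi$ along demands $d_{1:T}$ from initial stock $x_1$. Product ERM selects a minimizer of $\mathbb E_{\widehat P^\times}[\ell_{x_1}(\pi^S;D_{1:T})]$ over $S\in[0,\bar D]^T$ (here with $S_1\ge x_1$); equivalently empirical DP, which replaces each demand law in the Bellman recursion $V_{T+1}=0$, $V_t(x)=\min_{y\ge\max\{x,0\}}\{\mathbb E[c_t(y,D_t)]+\mathbb E[V_{t+1}((y-D_t)^+)]\}$ by $\widehat P_t$. *)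

(* Defs.v *)
From HB Require Import structures.
From mathcomp Require Import all_boot all_order all_algebra.
From mathcomp Require Import all_classical all_reals all_analysis measurable_realfun.

Set Implicit Arguments.
Unset Strict Implicit.
Unset Printing Implicit Defensive.

Import Order.TTheory GRing.Theory Num.Theory.
Import numFieldNormedType.Exports.

Local Open Scope classical_set_scope.
Local Open Scope ring_scope.

(* Periods 1, ..., T are encoded as 0, ..., T-1, that is, as 'I_T. *)
Definition period1 (T : nat) (hT : (0 < T)%N) : 'I_T := Ordinal hT.

Record lost_sales (R : realType) (T : nat) := LostSales {
  dbar : R ;
  dbar_gt0 : 0 < dbar ;
  law : 'I_T -> probability R R ;
  law_supp : forall t, law t `[0, dbar]%classic = 1%E ;
  hold : 'I_T -> R ;
  hold_gt0 : forall t, 0 < hold t ;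
  short : 'I_T -> R ;
  short_gt0 : forall t, 0 < short t }.

Section Model.
Context (R : realType) (T : nat) (M : lost_sales R T).

(* The default value 0 is inert, the coefficients being positive. *)
Definition cost_coef : R :=
  \big[Num.max/0]_(t < T) Num.max (hold M t) (short M t).

Definition crit_ratio (t : 'I_T) : R := short M t / (hold M t + short M t).

Definition cost (t : 'I_T) (y d : R) : R :=
  hold M t * Num.max (y - d) 0 + short M t * Num.max (d - y) 0.

Definition Fminus (t : 'I_T) (u : R) : R := fine (law M t [set d | d < u]).

End Model.

(* What the retailer has observed: entry s is the triple (x_s, y_s, sales_s) of
   period s. Entries of periods not yet played are (0, 0, 0), so that a decision
   that reads the whole tuple depends on the past only. *)
Definition history (R : realType) (T : nat) := T.-tuple (R * R * R)%type.

Definition history0 (R : realType) (T : nat) : history R T :=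
  nseq_tuple T (0, 0, 0).

Definition history_set (R : realType) (T : nat) (r : history R T) (t : 'I_T)
  (e : R * R * R) : history R T := [tuple if s == t then e else tnth r s | s < T].

(* Randomized history-dependent policies: in period t, with current stock x and
   history r, the post-order level is drawn from the law [decide t (x, r)],
   which is carried by [x, +oo[. Unsatisfied demand is never observed. *)
Record policy (R : realType) (T : nat) := Policy {
  decide : 'I_T -> R.-pker (R * T.-tuple (R * R * R))%type ~> R ;
  decide_feasible : forall t x r, 0 <= x -> decide t (x, r) [set y | x <= y] = 1%E
}.

Section Value.
Context (R : realType) (T : nat) (M : lost_sales R T).
Local Open Scope ereal_scope.

(* Expected cost over the periods listed in ts, demands being drawn
   independently of each other and of the randomized decisions. *)
Fixpoint cost_to_go (pi : policy R T) (ts : seq 'I_T) (x : R) (r : history R T)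
    : \bar R :=
  if ts is t :: ts' then
    \int[decide pi t (x, r)]_y \int[law M t]_d
      ((cost M t y d)%:E
       + cost_to_go pi ts' (Num.max (y - d) 0)%R
           (history_set r t (x, y, Num.min d y)))
  else 0.

Definition value (pi : policy R T) (x : R) : \bar R :=
  cost_to_go pi (enum 'I_T) x (history0 R T).

Definition opt_value (x : R) : \bar R :=
  ereal_inf [set value pi x | pi in [set: policy R T]].

Definition regret (pi : policy R T) (x : R) : \bar R := value pi x - opt_value x.

End Value.

Section BaseStock.
Context (R : realType) (T : nat) (S : 'I_T -> R).

Definition base_stock_level (t : 'I_T) (xr : R * T.-tuple (R * R * R)) : R :=
  Num.max xr.1 (S t).

Lemma measurable_base_stock_level (t : 'I_T) :
  measurable_fun [set: R * T.-tuple (R * R * R)] (base_stock_level t).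
Proof. exact: measurable_maxr measurable_fst (measurable_cst _). Qed.

Definition base_stock_decide (t : 'I_T) :
    R.-pker (R * T.-tuple (R * R * R))%type ~> R :=
  kdirac (measurable_base_stock_level t).

Lemma base_stock_feasible t x r : 0 <= x ->
  base_stock_decide t (x, r) [set y | x <= y] = 1%E.
Proof.
move=> _; rewrite /base_stock_decide /= /kdirac diracE mem_set//=.
by rewrite /base_stock_level /= le_max lexx.
Qed.

Definition base_stock : policy R T := Policy base_stock_feasible.

End BaseStock.

Section Loss.
Context (R : realType) (T : nat) (M : lost_sales R T).

Fixpoint loss_to_go (S d : 'I_T -> R) (ts : seq 'I_T) (x : R) : R :=
  if ts is t :: ts' then
    let y := Num.max x (S t) in
    cost M t y (d t) + loss_to_go S d ts' (Num.max (y - d t) 0)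
  else 0.

Definition loss (S : 'I_T -> R) (x1 : R) (d : 'I_T -> R) : R :=
  loss_to_go S d (enum 'I_T) x1.

(* Expectation of the loss under the product over t of the uniform
   distributions on the n values w t 0, ..., w t (n-1), with multiplicities. *)
Definition empirical_loss (n : nat) (w : 'I_T -> 'I_n -> R) (x1 : R)
    (S : 'I_T -> R) : R :=
  (\sum_(f : {ffun 'I_T -> 'I_n}) loss S x1 (fun t => w t (f t)))
    / #|{ffun 'I_T -> 'I_n}|%:R.

Definition erm_feasible (hT : (0 < T)%N) (x1 : R) (S : 'I_T -> R) : Prop :=
  (forall t, 0 <= S t <= dbar M) /\ x1 <= S (period1 hT).

Definition product_erm (hT : (0 < T)%N) (n : nat) (w : 'I_T -> 'I_n -> R)
    (x1 : R) (S : 'I_T -> R) : Prop :=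
  erm_feasible hT x1 S /\
  forall S', erm_feasible hT x1 S' ->
    empirical_loss w x1 S <= empirical_loss w x1 S'.

End Loss.

Definition mutually_independent (R : realType) (d : measure_display)
    (Omega : measurableType d) (Pr : probability Omega R) (I : finType)
    (X : I -> Omega -> R) : Prop :=
  forall (J : {set I}) (A : I -> set R), (forall i, measurable (A i)) ->
    Pr (\bigcap_(i in [set` J]) X i @^-1` A i)
      = (\prod_(i in J) Pr (X i @^-1` A i))%E.

(* Pr is the conditional law given the complete boundary array (and, if there
   is one, the pilot and the design information). Under Pr, everything that is
   a function of these data, in particular boundaries, caps and selected
   indices, is a constant, and conditional noninformative censoring says that
   the latent demands are mutually independent with their original laws. *)
Record sales_logs (R : realType) (T : nat) (M : lost_sales R T)
    (d : measure_display) (Omega : measurableType d) (Pr : probability Omega R)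
  := SalesLogs {
  nlogs : 'I_T -> nat ;
  boundary : forall t, 'I_(nlogs t) -> R ;
  boundary_ge0 : forall t (j : 'I_(nlogs t)), 0 <= boundary j ;
  latent : forall t, 'I_(nlogs t) -> {RV Pr >-> R} ;
  latent_law : forall t (j : 'I_(nlogs t)) A, measurable A ->
    distribution Pr (latent j) A = law M t A ;
  latent_indep : mutually_independent Pr
    (fun tj : {t : 'I_T & 'I_(nlogs t)} =>
       latent (tagged tj) : Omega -> R) }.

(* a_t = min of lam_s over s >= t; the default value lam t is in the range. *)
Definition cap (R : realType) (T : nat) (lam : 'I_T -> R) (t : 'I_T) : R :=
  \big[Num.min/lam t]_(s < T | (t <= s)%N) lam s.

Section Logs.
Context (R : realType) (T : nat) (M : lost_sales R T)
  (d : measure_display) (Omega : measurableType d) (Pr : probability Omega R)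
  (L : sales_logs M Pr) (lam : 'I_T -> R).

Definition sales (t : 'I_T) (j : 'I_(nlogs L t)) (w : Omega) : R :=
  Num.min (latent j w) (boundary j).

Definition qualified (t : 'I_T) : {set 'I_(nlogs L t)} :=
  [set j | cap lam t <= boundary j].

Definition nqualified (t : 'I_T) : nat := #|qualified t|.

Definition capped_sales (t : 'I_T) (j : 'I_(nlogs L t)) (w : Omega) : R :=
  Num.min (sales j w) (cap lam t).

Definition test_passes (delta : R) (w : Omega) : Prop :=
  forall t : 'I_T,
    (\sum_(j in qualified t) (sales j w < cap lam t)%R%:R) / (nqualified t)%:R
      - Num.sqrt (ln (4 * T%:R / delta) / (2 * (nqualified t)%:R))
    > crit_ratio M t.

(* n qualified indices per period and a measurable choice of a product ERM
   minimizer for the corresponding capped sales. *)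
Record fitted (hT : (0 < T)%N) (x1 : R) (n : nat) := Fitted {
  sel : forall t, 'I_n -> 'I_(nlogs L t) ;
  sel_inj : forall t, injective (@sel t) ;
  sel_qualified : forall t i, @sel t i \in qualified t ;
  levels : Omega -> 'I_T -> R ;
  measurable_levels : forall t, measurable_fun [set: Omega] (levels ^~ t) ;
  levels_erm : forall w,
    product_erm M hT (fun t i => capped_sales (@sel t i) w) x1 (levels w) }.

Definition returns_bad (delta eps x1 : R) (S : Omega -> 'I_T -> R) : set Omega :=
  [set w | test_passes delta w
           /\ (regret M (base_stock (S w)) x1 > eps%:E)%E].

Definition returns_good (delta eps x1 : R) (S : Omega -> 'I_T -> R) : set Omega :=
  [set w | test_passes delta w
           /\ (regret M (base_stock (S w)) x1 <= eps%:E)%E].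

End Logs.

Definition sample_scale (R : realType) (T : nat) (M : lost_sales R T)
    (delta eps : R) : R :=
  cost_coef M ^+ 2 * dbar M ^+ 2 * T%:R ^+ 2 / eps ^+ 2 * (1 + ln (2 / delta)).

Section Guarantee.
Context (R : realType) (T : nat) (M : lost_sales R T)
  (d : measure_display) (Omega : measurableType d) (Pr : probability Omega R)
  (L : sales_logs M Pr) (lam : 'I_T -> R).

Definition admissible (C delta eps : R) (n : nat) : Prop :=
  [/\ (0 < n)%N, C * sample_scale M delta eps <= n%:R
    & forall t, (n <= nqualified L lam t)%N].

(* There are enough qualified logs to choose a number n of fitting
   observations, and any such choice succeeds with probability 1 - delta. *)
Definition passes_and_eps_optimal (hT : (0 < T)%N) (C delta eps x1 : R) : Prop :=
  (exists n, admissible C delta eps n) /\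
  forall n, admissible C delta eps n ->
  forall F : fitted L lam hT x1 n,
    ((1 - delta)%:E <= Pr (returns_good L lam delta eps x1 (levels F)))%E.

End Guarantee.

(* Main.v *)
(* For fixed base-stock levels S the level reached in period t is
   max_{s <= t} (S_s - (D_s + ... + D_{t-1})).  At resolution D/N such a function
   is determined by N + 1 indices into a monotone chain of partial sums, and the
   chain itself has polynomially many L2-distinguishable members, whatever T is;
   the entropy at scale D/N is thus of order N log N, which is summable in a
   chaining argument.  Every period hence contributes O(C_c D / sqrt n) to the
   uniform deviation and there is no log T.  The product empirical mean is an
   average of means over n independent trajectories (cyclic shifts), so Jensen's
   inequality and symmetrization apply; all suprema over S are replaced by
   arbitrary data-dependent selectors S, and demands are rounded to a finite grid,
   so that only finite sums occur.

   Capping demands at a_t changes the loss of a base-stock policy below the caps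
   by a constant.  By convexity of the Bellman recursion an optimal policy lies
   below the caps under coverage, and any product ERM minimizer does so because
   the capped sales never exceed a_t.  If coverage fails in some period, the test
   itself passes with probability at most delta/(4T) by Hoeffding's inequality. *)

Require Import Defs.
From HB Require Import structures.
From mathcomp Require Import all_boot all_order all_algebra.
From mathcomp Require Import all_classical all_reals all_analysis measurable_realfun.
From mathcomp Require Import ring lra zify.

Set Implicit Arguments.
Unset Strict Implicit.
Unset Printing Implicit Defensive.

Import Order.TTheory GRing.Theory Num.Theory.
Import numFieldNormedType.Exports.

Local Open Scope classical_set_scope.
Local Open Scope ring_scope.

(** * Exponential moments *)

(** Probabilistic bounds are kept as exponential moments with a selector inside, of the form exp(60
    + 4300 mu^2 n B^2). This form survives each averaging step by Jensen's inequality (over the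
    scales of the chain, over the [T] periods, over cyclic shifts, over the ghost sample), so a
    single Chernoff step at the end yields the tail, with neither expected suprema nor bounded
    differences. Splitting the loss into periods in this way costs the factor T^2 in B^2 and nothing
    else. The obstacle in the net is that the chain of partial sums may be arbitrarily long. It is
    met by ordering: in a monotone chain the L1 distance of two rows is the difference of their
    sums, so one bucketed scalar locates a row, and truncation at [D] turns an L1 error into a
    squared error. The grid that discretizes demands may be as fine as desired, since no probability
    bound depends on its size. *)

Lemma ge0_derive_le (R : realType) (f df : R -> R) (l : R) :
  (forall u : R, 0 <= u -> is_derive u (1 : R) f (df u)) ->
  (forall u : R, 0 <= u -> 0 <= df u) -> 0 <= l -> f 0 <= f l.
Proof.
move=> fE df0 l0.
have dr (u : R) : u \in `[0, l]%R -> derivable f u 1.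
  by rewrite in_itv/= => /andP[u0 _]; apply: (@ex_derive _ _ _ _ _ _ _ (fE u u0)).
apply: (@ger0_derive1_ndecr R f 0 l) => //.
- move=> u ul; apply: dr; apply: subset_itv_oo_cc ul.
- move=> u; rewrite in_itv/= => /andP[/ltW u0 _].
  by rewrite derive1E (@derive_val _ _ _ _ _ _ _ (fE u u0)) df0.
- exact: derivable_within_continuous.
Qed.

(** Hoeffding's lemma for a Bernoulli variable, by integrating twice: the difference of the
    exponents vanishes at 0 together with its derivative [s], and s' = 1/4 - m (1 - m) >= 0, where m
    = p e^u / D(u) is the tilted mean. *)
Lemma bernoulli_mgf_ge0 (R : realType) (p l : R) : 0 <= p <= 1 -> 0 <= l ->
  1 - p + p * expR l <= expR (p * l + l ^+ 2 / 8).
Proof.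
move=> /andP[p0 p1] l0.
pose D (u : R) := 1 - p + p * expR u.
have D0 (u : R) : 0 <= u -> 0 < D u.
  move=> u0; have -> : D u = 1 + p * (expR u - 1) by rewrite /D; ring.
  by rewrite ltr_wpDr// mulr_ge0// subr_ge0 (le_trans _ (expR_ge1Dx u))// lerDl.
have dD (u : R) : is_derive u (1:R) D (p * expR u).
  rewrite /D; apply: is_derive_eq; rewrite /GRing.scale/=. ring.
pose s (u : R) := p + u / 4 - p * expR u / D u.
have ds (u : R) : 0 <= u ->
    is_derive u (1:R) s (4^-1 - (p * expR u / D u) * (1 - p * expR u / D u)).
  move=> u0; have Dn0 := lt0r_neq0 (D0 _ u0); rewrite /s.
  have dDi : is_derive u (1:R) (fun x => (D x)^-1) (- (D u) ^- 2 *: (p * expR u)).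
    exact: is_deriveV.
  apply: is_derive_eq.
  rewrite !scaler0 !scaler1 /GRing.scale/=; field. 
  exact: Dn0.
have s0 (u : R) : 0 <= u -> 0 <= s u.
  move=> u0; have s00 : s 0 = 0 by rewrite /s /D expR0; field; rewrite subrK oner_neq0.
  rewrite -s00; apply: (ge0_derive_le ds) => // v _; have := sqr_ge0 (p * expR v / D v - 2^-1); lra.
have dG (u : R) : 0 <= u ->
    is_derive u (1:R) (fun u => p * u + u ^+ 2 / 8 - ln (D u)) (s u).
  move=> u0; have Du := D0 _ u0.
  have dl : is_derive u (1:R) (fun u => ln (D u)) ((p * expR u) * (D u)^-1).
    rewrite mulrC; exact: (is_derive1_comp (is_derive1_ln Du) (dD u)).
  apply: is_derive_eq.
  rewrite /s !scaler0 !scaler1 /GRing.scale/=; field.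
  exact: lt0r_neq0.
have /= := ge0_derive_le dG s0 l0.
rewrite mulr0 expr0n/= mul0r /D expR0 !addr0 mulr1 subrK ln1 subr0.
rewrite subr_ge0 -ler_expR lnK//.
exact: D0.
Qed.

(** Negative [l] reduces to positive by exchanging success and failure, which replaces [p] by
    [1 - p] and [l] by [- l]. *)
Lemma bernoulli_mgf (R : realType) (p l : R) : 0 <= p <= 1 ->
  1 - p + p * expR l <= expR (p * l + l ^+ 2 / 8).
Proof.
move=> p01; have [l0|l0] := leP 0 l; first exact: bernoulli_mgf_ge0.
have q01 : 0 <= 1 - p <= 1 by lra.
have nl : 0 <= - l by lra.
have := bernoulli_mgf_ge0 q01 nl.
rewrite -(ler_pM2l (expR_gt0 l)) mulrDr mulrCA -!expRD subrr expR0 mulr1.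
have -> : l + ((1 - p) * - l + (- l) ^+ 2 / 8) = p * l + l ^+ 2 / 8 by field.
by apply: le_trans; lra.
Qed.

Lemma coshR_le (R : realType) (b : R) :
  (expR b + expR (- b)) / 2 <= expR (b ^+ 2 / 2).
Proof.
have p01 : 0 <= (2^-1 : R) <= 1 by lra.
have := bernoulli_mgf (2 * b) p01.
rewrite -(ler_pM2l (expR_gt0 (- b))) mulrDr mulrCA -!expRD.
have -> : - b + 2 * b = b by ring.
have -> : - b + (2^-1 * (2 * b) + (2 * b) ^+ 2 / 8) = b ^+ 2 / 2 by field.
by apply: le_trans; lra.
Qed.

(** The missing mass sits at the value 0, where exp is 1; the proof averages the tangent line of exp
    at the mean. Chaining needs this form because its weights are only known to sum to at most 1. *)
Lemma jensen_expR_sub (R : realType) (I : finType) (w z : I -> R) :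
  (forall i, 0 <= w i) -> \sum_i w i <= 1 ->
  expR (\sum_i w i * z i) <= \sum_i w i * expR (z i) + (1 - \sum_i w i).
Proof.
move=> w0 w1; set m := \sum_i _.
have tangent x : expR m * (1 + (x - m)) <= expR x.
  have -> : expR x = expR m * expR (x - m) by rewrite -expRD subrKC.
  by rewrite ler_pM2l ?expR_gt0// expR_ge1Dx.
have le1 : \sum_i w i * (expR m * (1 + (z i - m))) <= \sum_i w i * expR (z i).
  by apply: ler_sum => i _; rewrite ler_wpM2l.
have := tangent 0; rewrite expR0 sub0r => le2.
have w1' : 0 <= 1 - \sum_i w i by rewrite subr_ge0.
rewrite -[X in _ + X]mulr1.
apply: le_trans (lerD le1 (ler_wpM2l w1' le2)).
have -> : \sum_i w i * (expR m * (1 + (z i - m))) =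
    expR m * (\sum_i w i * (1 - m) + \sum_i w i * z i).
  rewrite -big_split/= mulr_sumr.
  by apply: eq_bigr => i _; ring.
rewrite -/m -mulr_suml.
set W := \sum_i w i.
by have -> : expR m * (W * (1 - m) + m) + (1 - W) * (expR m * (1 - m)) = expR m by ring.
Qed.

Lemma jensen_expR (R : realType) (I : finType) (w z : I -> R) :
  (forall i, 0 <= w i) -> \sum_i w i = 1 ->
  expR (\sum_i w i * z i) <= \sum_i w i * expR (z i).
Proof.
move=> w0 w1; have := @jensen_expR_sub _ _ w z w0; rewrite w1 lexx => /(_ isT).
by rewrite subrr addr0.
Qed.

Lemma rademacher_mgf (R : realType) (n : nat) (b : 'I_n -> R) :
  \sum_(s : {ffun 'I_n -> bool}) expR (\sum_j (-1) ^+ s j * b j)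
  <= 2 ^+ n * expR ((\sum_j b j ^+ 2) / 2).
Proof.
under eq_bigr do rewrite expR_sum.
rewrite -(bigA_distr_bigA (fun j (c : bool) => expR ((-1) ^+ c * b j)))/=.
rewrite mulr_suml expR_sum -[X in 2 ^+ X]card_ord -prodr_const -big_split/=.
apply: ler_prod => j _; rewrite big_bool/= expr0 expr1 mul1r mulN1r.
by rewrite addr_ge0 ?expR_ge0//=; have := coshR_le (b j); lra.
Qed.

(** A finite maximal inequality in exponential form: the term picked by the selector is dominated by
    the sum over all members, and each member is a fixed sum with independent signs. [P] keeps the
    members for which the variance bound is available. *)
Lemma massart (R : realType) (n : nat) (G : finType) (P : pred G)
    (b : G -> 'I_n -> R) (v : R) (s : {ffun 'I_n -> bool} -> G) :
  (forall g, P g -> \sum_j b g j ^+ 2 <= v) -> (forall e, P (s e)) ->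
  \sum_(e : {ffun 'I_n -> bool}) expR (\sum_j (-1) ^+ e j * b (s e) j)
  <= 2 ^+ n * (#|G|%:R * expR (v / 2)).
Proof.
move=> bv Ps.
apply: (@le_trans _ _ (\sum_(e : {ffun 'I_n -> bool}) \sum_(g | P g)
    expR (\sum_j (-1) ^+ e j * b g j))).
  apply: ler_sum => e _; rewrite (bigD1 (s e))//= lerDl.
  by apply: sumr_ge0 => g _; exact: expR_ge0.
rewrite exchange_big/=.
apply: (@le_trans _ _ (\sum_(g | P g) 2 ^+ n * expR (v / 2))).
  apply: ler_sum => g Pg; apply: le_trans (rademacher_mgf _) _.
  by rewrite ler_pM2l ?exprn_gt0// ler_expR ler_pM2r ?invr_gt0// bv.
rewrite sumr_const mulrCA -[leLHS]mulr_natl.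
by rewrite ler_wpM2r ?mulr_ge0 ?expR_ge0 ?exprn_ge0// ler_nat max_card.

Qed.

(** * Chaining *)

Lemma sum_half_pow_le (R : realType) (K : nat) :
  \sum_(k < K) (2^-1 : R) ^+ k <= 2.
Proof.
have -> : \sum_(k < K) (2^-1 : R) ^+ k = 2 - 2 * 2^-1 ^+ K.
  elim: K => [|K IH]; first by rewrite big_ord0 expr0 mulr1 subrr.
  by rewrite big_ord_recr/= IH exprS; field.
by rewrite gerBl mulr_ge0// exprn_ge0// invr_ge0.
Qed.

Section Chaining.
Context (R : realType) (n : nat) (I : Type) (f : I -> 'I_n -> R).
Context (G : nat -> finType) (g : forall k, G k -> 'I_n -> R)
  (p : forall k, I -> G k) (B : R).
Hypothesis n0 : (0 < n)%N.
Hypothesis fB : forall i j, f i j ^+ 2 <= B ^+ 2.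
Hypothesis gB : forall i k,
  \sum_j (f i j - g (p k i) j) ^+ 2 <= 4 * (n%:R * B ^+ 2) / 256 ^+ k.
Hypothesis cardG : forall k, #|G k|%:R <= expR (28 * 32 ^+ k : R).

(** At level 0 the increment is the approximation itself, so that the increments up to level [L]
    telescope to [g] at level [L]. *)
Let incr k (q : G k * G k.-1) (j : 'I_n) : R :=
  if k is 0%N then g q.1 j else g q.1 j - g q.2 j.

(** Only approximations of one and the same [i] at neighbouring levels are close to each other. *)
Let good k (q : G k * G k.-1) : bool := `[< exists i, q = (p k i, p k.-1 i) >].

(** Both neighbours are compared with [f]. Relative to 256^-k the coarser error carries an extra
    factor 256, and 2100 exceeds 2 * 4 * 256 + 2 * 4. *)
Let incr_le k q : @good k q ->
  \sum_j incr q j ^+ 2 <= 2100 * (n%:R * B ^+ 2) * 256^-1 ^+ k.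
Proof.
move=> /asboolP[i ->] {q}.
have sq2 (x y : R) : (x - y) ^+ 2 <= 2 * x ^+ 2 + 2 * y ^+ 2.
  by have := sqr_ge0 (x + y); lra.
have nB0 : 0 <= n%:R * B ^+ 2 by rewrite mulr_ge0// sqr_ge0.
case: k => [|k] /=.
  apply: (@le_trans _ _ (\sum_j (2 * f i j ^+ 2 + 2 * (f i j - g (p 0 i) j) ^+ 2))).
    apply: ler_sum => j _; have := sq2 (f i j) (f i j - g (p 0 i) j).
    by rewrite subKr.
  rewrite big_split/= -!mulr_sumr; have := gB i 0; rewrite !expr0 divr1 mulr1.
  have : \sum_j f i j ^+ 2 <= n%:R * B ^+ 2.
    rewrite mulr_natl -[in leRHS](card_ord n) -sumr_const.
    by apply: ler_sum => j _; exact: fB.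
  by lra.
apply: (@le_trans _ _ (\sum_j (2 * (f i j - g (p k i) j) ^+ 2
                              + 2 * (f i j - g (p k.+1 i) j) ^+ 2))).
  apply: ler_sum => j _.
  have := sq2 (f i j - g (p k i) j) (f i j - g (p k.+1 i) j).
  by rewrite opprB addrC addrA subrK.
rewrite big_split/= -!mulr_sumr; have := gB i k; have := gB i k.+1.
rewrite -!exprVn [256^-1 ^+ k.+1]exprS.
have : 0 <= (256^-1 : R) ^+ k by apply: exprn_ge0; rewrite invr_ge0 ler0n.
move: (256^-1 ^+ k) => c c0.
have : 0 <= n%:R * B ^+ 2 * c by rewrite mulr_ge0.
move: (n%:R * B ^+ 2) nB0 => N N0.
by have := mulr_ge0 N0 c0; lra.
Qed.

Let card_pair k : #|{: G k * G k.-1}|%:R <= expR (56 * 32 ^+ k : R).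
Proof.
rewrite card_prod natrM.
have -> : 56 * 32 ^+ k = 28 * 32 ^+ k + 28 * 32 ^+ k :> R by ring.
rewrite expRD ler_pM// (le_trans (cardG _))// ler_expR ler_pM2l//.
by rewrite ler_eXn2l ?leq_pred// ltr1n.
Qed.

(** Level [k] stands for resolution B / 16^k: squared errors are of order 256^-k, and an entropy N
    log N at N = 16^k is at most of order 32^k. The function splits into telescoping increments,
    each handled by [massart], and a deterministic remainder. *)
Lemma chaining (s : {ffun 'I_n -> bool} -> I) (mu : R) :
  \sum_(e : {ffun 'I_n -> bool}) expR (mu * \sum_j (-1) ^+ e j * f (s e) j)
  <= 2 ^+ n * expR (60 + 4300 * (mu ^+ 2 * (n%:R * B ^+ 2))).
Proof.
set N := n%:R * B ^+ 2.
have N0 : 0 <= N by rewrite mulr_ge0// sqr_ge0.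
have nR : 0 < n%:R :> R by rewrite ltr0n.
(* At such a level the squared errors sum to at most 4 B^2, so the remainder is bounded without any
   use of the signs. *)
have [K nK] : exists K, n%:R <= 256 ^+ K :> R.
  by exists n; rewrite -natrX ler_nat ltnW// ltn_expl.
(* Entropies grow like 32^k and squared increments decay like 256^-k; with
   weights of order 64^-k in Jensen's inequality both sums converge. *)
pose w (k : 'I_K.+1) : R := 64^-1 ^+ k / 2.
have w0 k : 0 < w k by rewrite divr_gt0// exprn_gt0// invr_gt0.
(* The logarithm of the bound of [massart] for the level-[k] increment rescaled by mu / w k: the
   entropy of two levels (28 + 28) plus half the variance. *)
pose b (k : 'I_K.+1) : R := 56 * 32 ^+ k
  + (mu / w k) ^+ 2 * (2100 * N * 256^-1 ^+ k) / 2.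
pose X (k : 'I_K.+1) (e : {ffun 'I_n -> bool}) :=
  \sum_j (-1) ^+ e j * (mu / w k * incr (p k (s e), p k.-1 (s e)) j).
have EX k : \sum_e expR (X k e - b k) <= 2 ^+ n.
  under eq_bigr do rewrite expRD.
  rewrite -mulr_suml expRN ler_pdivrMr ?expR_gt0//.
  apply: le_trans (@massart R n _ (@good k)
    (fun q j => mu / w k * incr q j)
    ((mu / w k) ^+ 2 * (2100 * N * 256^-1 ^+ k))
    (fun e => (p k (s e), p k.-1 (s e))) _ _) _.
  - move=> q /incr_le; under [X in _ -> X <= _]eq_bigr do rewrite exprMn.
    by rewrite -mulr_sumr; apply: ler_wpM2l; exact: sqr_ge0.
  - by move=> e; apply/asboolP; exists (s e).
  - rewrite ler_pM2l ?exprn_gt0// expRD ler_wpM2r ?expR_ge0//.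
have sumw : \sum_k w k <= 1.
  apply: (@le_trans _ _ (\sum_(k < K.+1) 2^-1 ^+ k / 2)).
    apply: ler_sum => k _; rewrite ler_pM2r ?invr_gt0//.
    by rewrite lerXn2r ?nnegrE ?invr_ge0// lef_pV2 ?posrE// ler_nat.
  by rewrite -mulr_suml ler_pdivrMr// mul1r sum_half_pow_le.
have sumwb : \sum_k w k * b k <= 56 + 4200 * (mu ^+ 2 * N).
  apply: (@le_trans _ _ (\sum_(k < K.+1) (28 + 2100 * (mu ^+ 2 * N)) * 2^-1 ^+ k)).
    apply: ler_sum => k _; rewrite /b /w.
    have : 64^-1 ^+ k * 32 ^+ k = 2^-1 ^+ k :> R.
      by rewrite -exprMn; congr (_ ^+ _); field.
    have : 256^-1 ^+ k = 64^-1 ^+ k * 4^-1 ^+ k :> R.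
      by rewrite -exprMn; congr (_ ^+ _); field.
    have : 4^-1 ^+ k <= 2^-1 ^+ k :> R.
      by rewrite lerXn2r ?nnegrE ?invr_ge0// lef_pV2 ?posrE// ler_nat.
    have : (64^-1 : R) ^+ k != 0 by rewrite expf_neq0// invr_neq0.
    move: (64^-1 ^+ k) (32 ^+ k) (2^-1 ^+ k) (4^-1 ^+ k) (256^-1 ^+ k) => a c h q d.
    move=> an0 qh -> ach.
    have -> : a / 2 * (56 * c + (mu / (a / 2)) ^+ 2 * (2100 * N * (a * q)) / 2)
        = 28 * h + 2100 * (mu ^+ 2 * N) * q.
      by rewrite -ach; field.
    have A0 : 0 <= mu ^+ 2 * N by rewrite mulr_ge0// sqr_ge0.
    by have := ler_wpM2l A0 qh; lra.
  rewrite -mulr_sumr.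
  have := sum_half_pow_le R K.+1.
  have : 0 <= mu ^+ 2 * N by rewrite mulr_ge0// sqr_ge0.
  move: (mu ^+ 2 * N) (\sum_(k < _) _) => a c a0 c2.
  by have := ler_wpM2l a0 c2; lra.
pose r (e : {ffun 'I_n -> bool}) :=
  \sum_j (-1) ^+ e j * (mu * (f (s e) j - g (p K (s e)) j)).
(* Termwise c mu x <= 1 / (2n) + n mu^2 x^2 / 2 for a sign c, by completing the square. *)
have rle (e : {ffun 'I_n -> bool}) : r e <= 1 / 2 + 2 * (mu ^+ 2 * N).
  apply: (@le_trans _ _ (\sum_(j < n) (n%:R^-1 / 2
      + n%:R * mu ^+ 2 / 2 * (f (s e) j - g (p K (s e)) j) ^+ 2))).
    apply: ler_sum => j _.
    set x := f _ _ - _; set c : R := (-1) ^+ e j.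
    have c2 : c ^+ 2 = 1 by rewrite /c sqrr_sign.
    have -> : n%:R^-1 / 2 + n%:R * mu ^+ 2 / 2 * x ^+ 2
        = c * (mu * x) + n%:R / 2 * (c * n%:R^-1 - mu * x) ^+ 2.
      have -> : n%:R / 2 * (c * n%:R^-1 - mu * x) ^+ 2 =
        n%:R / 2 * (c ^+ 2 * n%:R^-1 ^+ 2 - 2 * (c * n%:R^-1) * (mu * x) + mu ^+ 2 * x ^+ 2) by ring.
      by rewrite c2; field; rewrite gt_eqF.
    by rewrite lerDl mulr_ge0 ?sqr_ge0// divr_ge0// ltW.
  rewrite big_split/= sumr_const card_ord -mulr_sumr lerD//.
    by rewrite -[leLHS]mulr_natl mulrA divff ?gt_eqF.
  apply: (@le_trans _ _ (n%:R * mu ^+ 2 / 2 * (4 * N / n%:R))).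
    apply: ler_wpM2l; first by rewrite divr_ge0// mulr_ge0// sqr_ge0.
    apply: le_trans (gB _ _) _; apply: ler_wpM2l; first by rewrite mulr_ge0.
    by rewrite lef_pV2 ?posrE ?exprn_gt0.
  by rewrite le_eqVlt; apply/orP; left; apply/eqP; field; rewrite gt_eqF.
have tele (e : {ffun 'I_n -> bool}) : mu * \sum_j (-1) ^+ e j * f (s e) j = \sum_k w k * X k e + r e.
  have telK (i : I) j L : \sum_(k < L.+1) @incr k (p k i, p k.-1 i) j = g (p L i) j.
    elim: L => [|L IH]; first by rewrite big_ord_recl big_ord0/= addr0.
    by rewrite big_ord_recr/= IH addrC subrK.
  have -> : \sum_k w k * X k e = \sum_j (-1) ^+ e j * (mu * g (p K (s e)) j).
    under eq_bigr do rewrite /X mulr_sumr.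
    rewrite exchange_big/=; apply: eq_bigr => j _.
    rewrite -(telK (s e) j K) !mulr_sumr; apply: eq_bigr => k _.
    by field; rewrite gt_eqF.
  by rewrite -big_split/= mulr_sumr; apply: eq_bigr => j _; ring.
apply: (@le_trans _ _ (\sum_(e : {ffun 'I_n -> bool})
   expR (\sum_k w k * (X k e - b k)) * expR (57 + 4202 * (mu ^+ 2 * N)))).
  apply: ler_sum => e _; rewrite -expRD ler_expR tele.
  under [X in _ <= X + _]eq_bigr do rewrite mulrBr.
  rewrite sumrB; have := rle e; lra.
rewrite -mulr_suml.
apply: ler_pM; rewrite ?expR_ge0//.
- by apply: sumr_ge0 => e _; exact: expR_ge0.
- apply: (@le_trans _ _ (\sum_(e : {ffun 'I_n -> bool})
      (\sum_k w k * expR (X k e - b k) + (1 - \sum_k w k)))).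
    by apply: ler_sum => e _; apply: jensen_expR_sub => // k; exact: ltW.
  rewrite big_split/= exchange_big/= sumr_const card_ffun card_bool card_ord.
  have : \sum_k \sum_(e : {ffun 'I_n -> bool}) w k * expR (X k e - b k)
      <= (\sum_k w k) * 2 ^+ n.
    rewrite mulr_suml; apply: ler_sum => k _; rewrite -mulr_sumr.
    by rewrite ler_wpM2l// ltW.
  rewrite -[X in _ + X <= _]mulr_natl natrX; lra.
- rewrite ler_expR; have : 0 <= mu ^+ 2 * N by rewrite mulr_ge0// sqr_ge0.
  lra.
Qed.

End Chaining.

(** * Staircase nets for monotone chains *)

(** The error [c], which is controlled in L1 only, enters linearly instead of squared thanks to the
    bound [D]. L1 control of the chain is therefore enough for an L2 net. *)
Lemma sqr_le_trunc (R : realFieldType) (x d c D : R) :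
  0 <= x -> 0 <= d -> 0 <= c -> x <= d + c -> x <= D ->
  x ^+ 2 <= 2 * d ^+ 2 + 2 * D * c.
Proof.
move=> x0 d0 c0 xdc xD.
have D0 : 0 <= D := le_trans x0 xD.
have [cD|Dc] := leP c D.
  have h1 : x ^+ 2 <= (d + c) ^+ 2 by rewrite lerXn2r ?nnegrE ?addr_ge0.
  have h2 := sqr_ge0 (d - c).
  have h3 : c * c <= D * c by rewrite ler_wpM2r.
  lra.
have h1 : x ^+ 2 <= D ^+ 2 by rewrite lerXn2r ?nnegrE.
have h2 : D * D <= D * c by rewrite ler_wpM2l// ltW.
have h3 : 0 <= D * c by rewrite mulr_ge0.
by have := sqr_ge0 d; lra.
Qed.

Section Staircase.
Context (R : realType) (n m : nat) (A : 'I_m.+1 -> 'I_n -> R) (D : R).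
Hypothesis n0 : (0 < n)%N.
Hypothesis A0 : forall s j, 0 <= A s j.
Hypothesis A_dec : forall (s s' : 'I_m.+1) j, (s <= s')%N -> A s' j <= A s j.
Hypothesis D0 : 0 < D.

(** In the application [A s j] is the demand of trajectory [j] accumulated from period [s] up to the
    current one. Levels are at most [D], so a sum above [D] yields a nonpositive value in any case,
    and truncation bounds [mass] by n D. *)
Let Amin s j := Num.min (A s j) D.
Let mass s := \sum_j Amin s j.

Let Amin_ge0 s j : 0 <= Amin s j.
Proof. by rewrite le_min A0 ltW. Qed.

Let Amin_leD s j : Amin s j <= D.
Proof. by rewrite ge_min lexx orbT. Qed.

Let Amin_dec (s s' : 'I_m.+1) j : (s <= s')%N -> Amin s' j <= Amin s j.
Proof. by move=> ss'; rewrite le_min2// A_dec. Qed.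

(** The rows are ordered, so all differences have the same sign and their absolute values add up. *)
Let dist_Amin s s' : \sum_j `|Amin s j - Amin s' j| = `|mass s - mass s'|.
Proof.
rewrite /mass -sumrB; wlog ss' : s s' / (s <= s')%N => [H|].
  have [/H//|/ltnW/H] := leqP s s'.
  under eq_bigr do rewrite distrC.
  by move=> ->; rewrite -normrN -sumrN; under eq_bigr do rewrite opprB.
rewrite ger0_norm ?sumr_ge0// => [|j _]; last by rewrite subr_ge0 Amin_dec.
by apply: eq_bigr => j _; rewrite ger0_norm// subr_ge0 Amin_dec.
Qed.

Context (N : nat).
Hypothesis N0 : (0 < N)%N.
(** There are N + 1 levels with L1 error n D / M each, in total n D / N^2, which matches the n
    squared grid steps up to the factor [D]. *)
Let M := (N ^ 2 * N.+1)%N.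

Let bucket s : 'I_M.+1 := inord (Num.truncn (mass s * M%:R / (n%:R * D))).

Let bucket_close s s' : bucket s = bucket s' ->
  `|mass s - mass s'| <= n%:R * D / M%:R.
Proof.
have nD0 : 0 < n%:R * D by rewrite mulr_gt0// ltr0n.
have M0 : 0 < M%:R :> R by rewrite ltr0n muln_gt0 expn_gt0 N0.
have x0 t : 0 <= mass t * M%:R / (n%:R * D).
  apply: divr_ge0; last exact: ltW.
  by apply: mulr_ge0; [exact: sumr_ge0|exact: ltW].
have bE t : bucket t = Num.truncn (mass t * M%:R / (n%:R * D)) :> nat.
  rewrite /bucket inordK// ltnS -(ler_nat R).
  have /andP[lt _] := truncn_itv (x0 t); apply: le_trans lt _.
  rewrite ler_pdivrMr// mulrC ler_pM2l// mulr_natl -[in leRHS](card_ord n).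
  by rewrite -sumr_const; apply: ler_sum => j _.
move=> /(congr1 val)/=; rewrite !bE => tE.
have /andP[l1 r1] := truncn_itv (x0 s).
have /andP[l2 r2] := truncn_itv (x0 s').
rewrite -tE in l2 r2.
have : `|mass s * M%:R / (n%:R * D) - mass s' * M%:R / (n%:R * D)| <= 1.
  rewrite ler_norml; move: r1 r2; rewrite -natr1; lra.
rewrite -!mulrBl -mulrA normrM (gtr0_norm (divr_gt0 M0 nD0)).
rewrite -ler_pdivlMr ?divr_gt0// => /le_trans; apply.
by rewrite mul1r invf_div.
Qed.

(** The default is reached only for an empty bucket, and [stair_code] names nonempty ones. *)
Let rep b : 'I_m.+1 := odflt ord0 [pick s | bucket s == b].

Let bucket_rep s : bucket (rep (bucket s)) = bucket s.
Proof. by rewrite /rep; case: pickP => [t /eqP//|/(_ s)]; rewrite eqxx. Qed.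

Let lev (i : 'I_N.+1) : R := i%:R * (D / N%:R).

Definition stair (rho : {ffun 'I_N.+1 -> option 'I_M.+1}) (j : 'I_n) : R :=
  \big[Num.max/0]_i (if rho i is Some b then lev i - Amin (rep b) j else 0).

(** Among the indices whose level reaches [lev i], the last one subtracts the least, for all [j] at
    once, because rows decrease. Hence one index per height describes the maximum over the whole
    chain. *)
Let tau (sg : 'I_m.+1 -> R) (i : 'I_N.+1) : option 'I_m.+1 :=
  [pick s | (lev i <= sg s) && [forall s', (lev i <= sg s') ==> (s' <= s)%N]].

Definition stair_code sg : {ffun 'I_N.+1 -> option 'I_M.+1} :=
  [ffun i => omap bucket (tau sg i)].

Let NR : 0 < N%:R :> R. Proof. by rewrite ltr0n. Qed.

Lemma stair_itv rho j : 0 <= stair rho j <= D.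
Proof.
apply/andP; split; first exact: bigmax_ge_id.
apply/bigmax_leP; split=> [|i _]; first exact: ltW.
case: (rho i) => [b|]; last exact: ltW.
apply: (@le_trans _ _ (lev i)); first by rewrite gerBl.
rewrite /lev mulrA ler_pdivrMr// mulrC ler_pM2l// ler_nat -ltnS//.
Qed.

(** The staircase exceeds [y] by bucket errors only and falls short of it by these and one grid
    step. In [sqr_le_trunc] the grid step and the bucket errors contribute 2 n D^2 / N^2 each. *)
Lemma stair_dist (sg : 'I_m.+1 -> R) (y : 'I_n -> R) :
  (forall s, 0 <= sg s <= D) ->
  (forall j, 0 <= y j <= D) ->
  (forall s j, sg s - A s j <= y j) ->
  (forall j, exists s, y j = sg s - A s j) ->
  \sum_j (y j - stair (stair_code sg) j) ^+ 2 <= 4 * (n%:R * D ^+ 2) / N%:R ^+ 2.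
Proof.
move=> sgD yD sgy ysg.
pose err i j := if tau sg i is Some s
  then `|Amin s j - Amin (rep (bucket s)) j| else 0.
pose e j := \sum_i err i j.
have err0 i j : 0 <= err i j by rewrite /err; case: (tau sg i).
have err_e i j : err i j <= e j.
  by rewrite /e (bigD1 i)//= lerDl sumr_ge0.
have e0 j : 0 <= e j by rewrite sumr_ge0.
have tauP i s : tau sg i = Some s -> lev i <= sg s.
  by rewrite /tau; case: pickP => // t /andP[? _] [<-].
have tau_max i s : lev i <= sg s -> exists2 s', tau sg i = Some s' & (s <= s')%N.
  move=> ls; rewrite /tau; case: pickP => [t /andP[_ /forallP/(_ s)]|].
    by rewrite ls => ?; exists t.
  case: (@arg_maxnP _ s (fun s => lev i <= sg s) val ls) => t lt tmax /(_ t).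
  rewrite lt /= => /negP[]; apply/forallP => s'; apply/implyP; exact: tmax.
have le1 j : stair (stair_code sg) j <= y j + e j.
  have /andP[y0 _] := yD j.
  apply/bigmax_leP; split=> [|i _]; first by rewrite addr_ge0.
  have := err_e i j; rewrite /stair_code ffunE /err.
  case tE : (tau sg i) => [s|] /=; last by rewrite addr_ge0.
  move=> le_e; have := ler_norm (Amin s j - Amin (rep (bucket s)) j).
  suff : lev i - Amin s j <= y j by lra.
  rewrite /Amin; case: (leP (A s j) D) => _.
    by apply: le_trans (sgy s j); rewrite lerB// tauP.
  (* Here [A s j] exceeds [D], so the truncated term is at most 0, hence below [y j]. *)
  apply: le_trans y0; rewrite subr_le0; apply: le_trans (tauP _ _ tE) _.
  by have /andP[] := sgD s.
have le2 j : y j <= stair (stair_code sg) j + D / N%:R + e j.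
  have [s yE] := ysg j; have /andP[s0 sD] := sgD s.
  have DN : 0 < D / N%:R by rewrite divr_gt0.
  have x0 : 0 <= sg s / (D / N%:R) by rewrite divr_ge0// ltW.
  have iN : (Num.truncn (sg s / (D / N%:R)) < N.+1)%N.
    have /andP[lt _] := truncn_itv x0.
    rewrite ltnS -(ler_nat R) (le_trans lt)//.
    by rewrite ler_pdivrMr// mulrC divfK ?gt_eqF.
  (* The level of the attaining index [s], rounded down to the grid. The index recorded at this
     height is at least [s], so it subtracts no more. *)
  pose i := Ordinal iN.
  have /andP[il ir] := truncn_itv x0.
  have li : lev i <= sg s by rewrite /lev -ler_pdivlMr.
  have ri : sg s <= lev i + D / N%:R.
    by rewrite /lev -{2}[D / N%:R]mul1r -mulrDl -ler_pdivrMr// natr1 ltW.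
  have [s' tE ss'] := tau_max _ _ li.
  have : lev i - Amin (rep (bucket s')) j <= stair (stair_code sg) j.
    rewrite /stair (bigD1 i)//= /stair_code ffunE tE /= le_max lexx//.
  have := err_e i j; rewrite /err tE => le_e.
  have := ler_norm (Amin (rep (bucket s')) j - Amin s' j); rewrite distrC.
  have : Amin s' j <= A s j by rewrite ge_min A_dec.
  by rewrite yE; lra.
have sq j : (y j - stair (stair_code sg) j) ^+ 2
    <= 2 * (D / N%:R) ^+ 2 + 2 * D * e j.
  have /andP[g0 gD] := stair_itv (stair_code sg) j.
  have /andP[y0 yD'] := yD j.
  have := le1 j; have := le2 j.
  move: (stair _ _) g0 gD => g g0 gD.
  have DN : 0 < D / N%:R by rewrite divr_gt0.
  move: (D / N%:R) DN => d d0 h2 h1.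
  rewrite -(real_normK (num_real (y j - g))).
  have : `|y j - g| <= D by rewrite ler_norml; lra.
  have : `|y j - g| <= d + e j by rewrite ler_norml; lra.
  move: (`|_|) (normr_ge0 (y j - g)) (e j : R) (e0 j) => x x0 c c0 h3 h4.
  exact: sqr_le_trunc (ltW d0) _ _ _.
have M0 : 0 < M%:R :> R by rewrite ltr0n muln_gt0 expn_gt0 N0.
have sume : \sum_j e j <= n%:R * D / N%:R ^+ 2.
  rewrite exchange_big/=.
  apply: (@le_trans _ _ (\sum_(i < N.+1) n%:R * D / M%:R)).
    apply: ler_sum => i _; rewrite /err; case: (tau sg i) => [s|].
      by rewrite dist_Amin bucket_close// bucket_rep.
    by rewrite big1// divr_ge0// mulr_ge0// ltW.
  rewrite sumr_const card_ord -[leLHS]mulr_natl /M natrM natrX.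
  by rewrite le_eqVlt; apply/orP; left; apply/eqP; field; rewrite !gt_eqF//= ltr0n.
apply: le_trans (ler_sum _ (fun j _ => sq j)) _.
rewrite big_split/= sumr_const card_ord -mulr_sumr -[X in X + _]mulr_natl.
have := ler_wpM2l (ltW (mulr_gt0 (ltr0Sn R 1) D0)) sume.
rewrite expr_div_n; lra.
Qed.

End Staircase.

(** With N = 16^k there are N + 1 <= 2 N heights and at most 4 N^3 = 2^(2 + 12 k) values at each.
    Then 2 <= e and 2 + 12 k <= 14 * 2^k give the exponent 2 * 16^k * 14 * 2^k. *)
Lemma card_stair_code (R : realType) (k : nat) :
  #|{ffun 'I_(16 ^ k).+1 -> option 'I_((16 ^ k) ^ 2 * (16 ^ k).+1).+1}|%:R
  <= expR (28 * 32 ^+ k : R).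
Proof.
set N := (16 ^ k)%N.
have N0 : (0 < N)%N by rewrite expn_gt0.
rewrite card_ffun card_option !card_ord natrX.
have e2 : 2 <= expR 1 :> R by have := expR_ge1Dx (1 : R).
apply: (@le_trans _ _ ((expR (2 + 12 * k%:R : R)) ^+ N.+1)).
  rewrite lerXn2r ?nnegrE ?ler0n ?expR_ge0//.
  apply: (@le_trans _ _ (2 ^+ (2 + 12 * k)%N)).
    rewrite -natrX ler_nat expnD (_ : 2 ^ (12 * k) = N ^ 3)%N; last first.
      by rewrite /N -expnM (_ : 16 = 2 ^ 4)%N// -expnM; congr (_ ^ _)%N; lia.
    rewrite !expnS expn0 !muln1; nia.
  have -> : 2 + 12 * k%:R = (2 + 12 * k)%:R * 1 :> R by rewrite natrD natrM mulr1.
  by rewrite expRM_natl lerXn2r ?nnegrE ?expR_ge0.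
rewrite -expRM_natl ler_expR.
have k2 : k%:R <= 2 ^+ k :> R by rewrite -natrX ler_nat ltnW// ltn_expl.
have p1 : 1 <= 2 ^+ k :> R by rewrite exprn_ege1// ler1n.
apply: (@le_trans _ _ (2 * N%:R * (14 * 2 ^+ k))).
  have N1 : 1 <= N%:R :> R by rewrite ler1n.
  have k0 : 0 <= k%:R :> R by rewrite ler0n.
  apply: ler_pM; [by rewrite ler0n|lra|rewrite -natr1; lra|lra].
rewrite /N natrX (_ : (32 : R) = 16 * 2) ?exprMn; last by rewrite -natrM.
by rewrite le_eqVlt; apply/orP; left; apply/eqP; ring.
Qed.

(** The bound depends neither on the length [m] of the chain nor on the size of the class, which is
    what keeps log T out. Lipschitz images inherit the net, with [D] replaced by [c * D]. *)
Lemma staircase_mgf (R : realType) (n m : nat) (A : 'I_m.+1 -> 'I_n -> R)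
    (D c : R) (phi : 'I_n -> R -> R) (I : Type) (sg : I -> 'I_m.+1 -> R)
    (y : I -> 'I_n -> R) (s : {ffun 'I_n -> bool} -> I) (mu : R) :
  (0 < n)%N -> (forall s j, 0 <= A s j) ->
  (forall (s s' : 'I_m.+1) j, (s <= s')%N -> A s' j <= A s j) ->
  0 < D -> 0 <= c ->
  (forall j u v, 0 <= u <= D -> 0 <= v <= D ->
     `|phi j u - phi j v| <= c * `|u - v|) ->
  (forall j u, 0 <= u <= D -> `|phi j u| <= c * D) ->
  (forall i s, 0 <= sg i s <= D) -> (forall i j, 0 <= y i j <= D) ->
  (forall i s j, sg i s - A s j <= y i j) ->
  (forall i j, exists s, y i j = sg i s - A s j) ->
  \sum_(e : {ffun 'I_n -> bool})
     expR (mu * \sum_j (-1) ^+ e j * phi j (y (s e) j))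
  <= 2 ^+ n * expR (60 + 4300 * (mu ^+ 2 * (n%:R * (c * D) ^+ 2))).
Proof.
move=> n0 A0 Adec D0 c0 phiL phiB sgD yD ysg sgy.
have cD0 : 0 <= c * D by rewrite mulr_ge0// ltW.
apply: (@chaining R n I (fun i j => phi j (y i j))
  (fun k => {ffun 'I_(16 ^ k).+1 -> option 'I_((16 ^ k) ^ 2 * (16 ^ k).+1).+1})
  (fun k rho j => phi j (@stair R n m A D (16 ^ k) rho j))
  (fun k i => @stair_code R n m A D (16 ^ k) (sg i))) => //.
- move=> i j; rewrite -(real_normK (num_real (phi _ _))).
  by rewrite lerXn2r ?nnegrE// phiB.
- move=> i k.
  have N0 : (0 < 16 ^ k)%N by rewrite expn_gt0.
  apply: (@le_trans _ _ (\sum_(j < n) c ^+ 2 *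
      (y i j - @stair R n m A D (16 ^ k) (stair_code A D (16 ^ k) (sg i)) j) ^+ 2)).
    apply: ler_sum => j _; rewrite -exprMn.
    rewrite -(real_normK (num_real (phi _ _ - _))) -(real_normK (num_real (c * _))).
    rewrite lerXn2r ?nnegrE// normrM (ger0_norm c0) phiL// .
    exact: stair_itv.
  rewrite -mulr_sumr.
  have := @stair_dist R n m A D n0 A0 Adec D0 _ N0 (sg i) (y i) (sgD i) (yD i) (ysg i) (sgy i).
  move=> /(ler_wpM2l (sqr_ge0 c)) /le_trans; apply.
  rewrite natrX -exprM mulnC exprM (_ : 16 ^+ 2 = 256) -?natrX//.
  by rewrite le_eqVlt; apply/orP; left; apply/eqP; ring.
- by move=> k; exact: card_stair_code.
Qed.

(** * Symmetrization and the product empirical law *)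

Lemma expRD_le (R : realType) (a b : R) :
  expR (a + b) <= (expR (2 * a) + expR (2 * b)) / 2.
Proof.
have -> : 2 * a = a + a by ring.
have -> : 2 * b = b + b by ring.
by rewrite !expRD; have := sqr_ge0 (expR a - expR b); lra.
Qed.

Section ProductWeights.
Context (R : realType) (J V : finType) (p : J -> V -> R).
Hypothesis p0 : forall j x, 0 <= p j x.
Hypothesis p1 : forall j, \sum_x p j x = 1.

Definition prodw (u : {ffun J -> V}) : R := \prod_j p j (u j).

Lemma prodw_ge0 u : 0 <= prodw u.
Proof. by rewrite prodr_ge0. Qed.

Lemma sum_prodw : \sum_u prodw u = 1.
Proof.
by rewrite -(bigA_distr_bigA (fun j x => p j x)) big1.
Qed.

Definition updf (u : {ffun J -> V}) (j : J) (x : V) : {ffun J -> V} :=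
  [ffun k => if k == j then x else u k].

(** Integrates out one coordinate. Exchanging the coordinate [j] of [u] with a spare independent
    value [x] is an involution that preserves the joint weight. *)
Lemma sum_prodw_upd (j : J) (F : {ffun J -> V} -> R) :
  \sum_u prodw u * F u = \sum_x p j x * \sum_u prodw u * F (updf u j x).
Proof.
pose h (q : {ffun J -> V} * V) := (updf q.1 j q.2, q.1 j).
have hK : involutive h.
  move=> [u x]; rewrite /h/= ffunE eqxx; congr pair.
  by apply/ffunP => k; rewrite !ffunE; case: eqP => [->|].
have hw u x : prodw (updf u j x) * p j (u j) = prodw u * p j x.
  rewrite /prodw (bigD1 j)//= [in RHS](bigD1 j)//= ffunE eqxx.
  rewrite (eq_bigr (fun k => p k (u k))); first by ring.
  by move=> k /negPf kj; rewrite ffunE kj.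
transitivity (\sum_u \sum_x prodw u * p j x * F u).
  by apply: eq_bigr => u _; rewrite -mulr_suml -mulr_sumr p1 mulr1.
rewrite pair_big/= (reindex h) /=; last by exists h => q _; exact: hK.
under eq_bigr do rewrite hw.
rewrite -(pair_big predT predT
  (fun (u : {ffun J -> V}) x => prodw u * p j x * F (updf u j x)))/=.
rewrite exchange_big/=; apply: eq_bigr => x _; rewrite mulr_sumr.
by apply: eq_bigr => u _; ring.
Qed.

Lemma sum_prodw1 (j : J) (F : V -> R) :
  \sum_u prodw u * F (u j) = \sum_x p j x * F x.
Proof.
rewrite (sum_prodw_upd j); apply: eq_bigr => x _; congr (_ * _).
under eq_bigr do rewrite ffunE eqxx.
by rewrite -mulr_suml sum_prodw mul1r.
Qed.

End ProductWeights.

Section Symmetrization.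
Context (R : realType) (U : finType) (P : U -> R) (n : nat)
  (I : Type) (f : I -> U -> R) (K : R -> R).
Hypothesis P0 : forall x, 0 <= P x.
Hypothesis P1 : \sum_x P x = 1.
Hypothesis rad : forall (u : 'I_n -> U) (s : {ffun 'I_n -> bool} -> I) mu,
  \sum_(e : {ffun 'I_n -> bool}) expR (mu * \sum_j (-1) ^+ e j * f (s e) (u j))
  <= 2 ^+ n * K mu.
Hypothesis K_even : forall mu, K (- mu) = K mu.

Let w := prodw (fun _ : 'I_n => P).

(* The class index is allowed to depend on the sample, which replaces the
   supremum over the class. *)
Lemma symmetrization (s : {ffun 'I_n -> U} -> I) (l : R) :
  \sum_u w u * expR (l * \sum_j (\sum_x P x * f (s u) x - f (s u) (u j)))
  <= K (2 * l).
Proof.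
have w0 u : 0 <= w u by exact: prodw_ge0.
have w1 : \sum_u w u = 1 by exact: sum_prodw.
pose Phi i (u u' : {ffun 'I_n -> U}) (e : {ffun 'I_n -> bool}) :=
  expR (l * \sum_j (-1) ^+ e j * (f i (u' j) - f i (u j))).
pose e0 : {ffun 'I_n -> bool} := [ffun=> false].
(* The mean under [P] is written as an average over a ghost sample [u'], which Jensen's inequality
   takes out of the exponential. [e0] is the vector of positive signs. *)
have ghost u : expR (l * \sum_j (\sum_x P x * f (s u) x - f (s u) (u j)))
    <= \sum_u' w u' * Phi (s u) u u' e0.
  have -> : l * (\sum_j (\sum_x P x * f (s u) x - f (s u) (u j))) =
    \sum_u' w u' * (l * \sum_j (-1) ^+ e0 j * (f (s u) (u' j) - f (s u) (u j))).
    under [RHS]eq_bigr do rewrite mulrCA mulr_sumr.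
    rewrite -mulr_sumr exchange_big/=; congr (_ * _); apply: eq_bigr => j _.
    rewrite ffunE expr0; under [RHS]eq_bigr do rewrite mul1r mulrBr.
    by rewrite sumrB -mulr_suml w1 mul1r /w sum_prodw1.
  exact: jensen_expR.
pose sw (e : {ffun 'I_n -> bool}) (u u' : {ffun 'I_n -> U}) : {ffun 'I_n -> U} :=
  [ffun j => if e j then u' j else u j].
(* Swapping [u] and [u'] where [e] is set preserves the weights and produces the signs. The
   selector, read at the mixed sample, becomes a function of [e] once both samples are fixed, which
   is the form [rad] accepts. *)
have swapE e : \sum_u w u * \sum_u' w u' * Phi (s u) u u' e0 =
    \sum_u \sum_u' w u * w u' * Phi (s (sw e u u')) u u' e.
  transitivity (\sum_u \sum_u' w u * w u' * Phi (s u) u u' e0).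
    by apply: eq_bigr => u _; rewrite mulr_sumr; apply: eq_bigr => u' _; rewrite mulrA.
  pose h (q : {ffun 'I_n -> U} * {ffun 'I_n -> U}) := (sw e q.1 q.2, sw e q.2 q.1).
  have hK : involutive h.
    by move=> [u u']; congr pair; apply/ffunP => j; rewrite !ffunE; case: (e j).
  rewrite !pair_big/= (reindex h) /=; last by exists h => q _; exact: hK.
  apply: eq_bigr => -[u u'] _ /=; congr (_ * _).
    rewrite /w /prodw -!big_split/=; apply: eq_bigr => j _; rewrite !ffunE.
    by case: (e j); rewrite 1?mulrC.
  congr (expR (_ * _)); apply: eq_bigr => j _; rewrite !ffunE.
  by case: (e j); rewrite ?expr0 ?expr1; ring.
apply: (@le_trans _ _ (\sum_u w u * \sum_u' w u' * Phi (s u) u u' e0)).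
  by apply: ler_sum => u _; rewrite ler_wpM2l.
set S := (X in X <= _).
have two0 : 0 < 2 ^+ n :> R by rewrite exprn_gt0.
rewrite -(ler_pM2l two0).
have -> : 2 ^+ n * S = \sum_u \sum_u' w u * w u' *
    \sum_e Phi (s (sw e u u')) u u' e.
  have -> : 2 ^+ n * S = \sum_(e : {ffun 'I_n -> bool}) S.
    by rewrite sumr_const card_ffun card_bool card_ord -[RHS]mulr_natl natrX.
  rewrite (eq_bigr _ (fun e _ => swapE e)) exchange_big/=.
  apply: eq_bigr => u _; rewrite exchange_big/=; apply: eq_bigr => u' _.
  by rewrite mulr_sumr.
apply: (@le_trans _ _ (\sum_u \sum_u' w u * w u' * (2 ^+ n * K (2 * l)))).
  apply: ler_sum => u _; apply: ler_sum => u' _.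
  rewrite ler_wpM2l ?mulr_ge0//.
  pose a (v : {ffun 'I_n -> U}) (e : {ffun 'I_n -> bool}) :=
    \sum_j (-1) ^+ e j * f (s (sw e u u')) (v j).
  (* The two samples share the selector and cannot be separated by independence; convexity separates
     them at the price of doubling [l]. *)
  apply: (@le_trans _ _ (\sum_e (expR (2 * l * a u' e) + expR (- (2 * l) * a u e)) / 2)).
    apply: ler_sum => e _.
    have -> : Phi (s (sw e u u')) u u' e = expR (l * a u' e + (- l) * a u e).
      congr expR; rewrite mulNr -mulrBr; congr (_ * _).
      by rewrite -sumrB; apply: eq_bigr => j _; rewrite mulrBr.
    by apply: le_trans (expRD_le _ _) _; rewrite !mulrA mulrN.
  rewrite -mulr_suml big_split/=.
  have := rad u' (fun e => s (sw e u u')) (2 * l).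
  have := rad u (fun e => s (sw e u u')) (- (2 * l)).
  by rewrite K_even -/(a _ _) /a; lra.
under eq_bigr do rewrite -mulr_suml -mulr_sumr w1 mulr1.
by rewrite -mulr_suml w1 mul1r.
Qed.

End Symmetrization.

Section ProductEmpirical.
Context (R : realType) (J V : finType) (p : J -> V -> R) (n : nat)
  (I : Type) (f : I -> {ffun J -> V} -> R) (K : R -> R).
Hypothesis p0 : forall j x, 0 <= p j x.
Hypothesis p1 : forall j, \sum_x p j x = 1.
Hypothesis n0 : (0 < n)%N.
Hypothesis rad : forall (u : 'I_n -> {ffun J -> V}) (s : {ffun 'I_n -> bool} -> I) mu,
  \sum_(e : {ffun 'I_n -> bool}) expR (mu * \sum_j (-1) ^+ e j * f (s e) (u j))
  <= 2 ^+ n * K mu.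
Hypothesis K_even : forall mu, K (- mu) = K mu.

(* Hoeffding's U-statistic device: the product empirical mean is the average,
   over cyclic shifts of the coordinates, of means over n independent
   trajectories. *)
Lemma product_empirical_mgf (s : {ffun J * 'I_n -> V} -> I) (l : R) :
  \sum_v prodw (fun q => p q.1) v *
    expR (l * (n%:R * (\sum_x prodw p x * f (s v) x
      - (\sum_(g : {ffun J -> 'I_n}) f (s v) [ffun t => v (t, g t)])
          / #|{ffun J -> 'I_n}|%:R)))
  <= K (2 * l).
Proof.
case: n n0 rad s => // m _ rad' s.
set N := #|{ffun J -> 'I_m.+1}|; have N0 : 0 < N%:R :> R.
  by rewrite ltr0n /N card_ffun expn_gt0 card_ord.
pose W := prodw (fun q : J * 'I_m.+1 => p q.1).
have W0 v : 0 <= W v by apply: prodw_ge0.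
pose sh (c : {ffun J -> 'I_m.+1}) (v : {ffun J * 'I_m.+1 -> V}) : {ffun J * 'I_m.+1 -> V} :=
  [ffun q => v (q.1, q.2 + c q.1)].
pose tr (v : {ffun J * 'I_m.+1 -> V}) : {ffun 'I_m.+1 -> {ffun J -> V}} :=
  [ffun j => [ffun t => v (t, j)]].
pose Pf i := \sum_x prodw p x * f i x.
(* For fixed [j], adding [j] permutes the index maps [c], so every product term occurs equally
   often. Addition is modulo [m.+1], whence the earlier passage to a successor. *)
have avgE i (v : {ffun J * 'I_m.+1 -> V}) : m.+1%:R * (Pf i - (\sum_(g : {ffun J -> 'I_m.+1})
      f i [ffun t => v (t, g t)]) / N%:R) =
    \sum_(c : {ffun J -> 'I_m.+1}) N%:R^-1 * \sum_j (Pf i - f i (tr (sh c v) j)).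
  rewrite -mulr_sumr exchange_big/=.
  have -> : \sum_(j < m.+1) \sum_(c : {ffun J -> 'I_m.+1})
      (Pf i - f i (tr (sh c v) j)) = \sum_(j < m.+1)
      (N%:R * Pf i - \sum_(g : {ffun J -> 'I_m.+1}) f i [ffun t => v (t, g t)]).
    apply: eq_bigr => j _; rewrite sumrB sumr_const -[X in X - _]mulr_natl.
    congr (_ - _); rewrite [RHS](reindex (fun c : {ffun J -> 'I_m.+1} => [ffun t => j + c t])) /=.
      apply: eq_bigr => c _; congr (f i _); apply/ffunP => t.
      by rewrite !ffunE.
    exists (fun c : {ffun J -> 'I_m.+1} => [ffun t => c t - j]) => c _;
      apply/ffunP => t; rewrite !ffunE; [by rewrite addrC addKr|by rewrite addrC subrK].
  rewrite sumr_const card_ord -[X in _ = _ * X]mulr_natl.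
  by field; rewrite gt_eqF.
apply: (@le_trans _ _ (\sum_v W v * \sum_(c : {ffun J -> 'I_m.+1}) N%:R^-1 *
    expR (l * \sum_j (Pf (s v) - f (s v) (tr (sh c v) j))))).
  apply: ler_sum => v _; rewrite ler_wpM2l// avgE mulr_sumr.
  under eq_bigr do rewrite mulrCA.
  apply: jensen_expR => [c|]; first by rewrite invr_ge0 ltW.
  by rewrite sumr_const -[LHS]mulr_natl divff// gt_eqF.
under eq_bigr do rewrite mulr_sumr.
rewrite exchange_big/=.
apply: (@le_trans _ _ (\sum_(c : {ffun J -> 'I_m.+1}) N%:R^-1 * K (2 * l))); last first.
  by rewrite sumr_const -[leLHS]mulr_natl mulrA divff ?mul1r// gt_eqF.
apply: ler_sum => c _.
under eq_bigr do rewrite mulrCA.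
rewrite -mulr_sumr; apply: ler_wpM2l; first by rewrite invr_ge0 ltW.
(* Inverts the shift followed by transposition. It preserves weights, so the rows of the shifted
   array are independent trajectories. *)
pose unc (u : {ffun 'I_m.+1 -> {ffun J -> V}}) : {ffun J * 'I_m.+1 -> V} :=
  [ffun q => u (q.2 - c q.1) q.1].
have shunc (u : {ffun 'I_m.+1 -> {ffun J -> V}}) : tr (sh c (unc u)) = u.
  apply/ffunP => j; apply/ffunP => t.
  by rewrite !ffunE/= addrK.
have uncsh (v : {ffun J * 'I_m.+1 -> V}) : unc (tr (sh c v)) = v.
  by apply/ffunP => -[t j]; rewrite !ffunE/= subrK.
have Wunc (u : {ffun 'I_m.+1 -> {ffun J -> V}}) : W (unc u) = prodw (fun _ : 'I_m.+1 => prodw p) u.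
  rewrite /W /prodw exchange_big/= pair_big/=.
  rewrite [RHS](reindex (fun q : J * 'I_m.+1 => (q.1, q.2 - c q.1)))/=.
    by apply: eq_bigr => -[t j] _; rewrite ffunE.
  by exists (fun q : J * 'I_m.+1 => (q.1, q.2 + c q.1)) => -[t j] _ /=;
    rewrite ?addrK ?subrK.
rewrite (reindex unc)/=; last first.
  by exists (fun v => tr (sh c v)) => v _; [exact: shunc|exact: uncsh].
under eq_bigr do rewrite Wunc shunc.
have := @symmetrization R {ffun J -> V} (prodw p) m.+1 I f K
  (prodw_ge0 p0) (sum_prodw p1) rad' K_even (fun u => s (unc u)) l.
exact.
Qed.

End ProductEmpirical.

(** * Costs and trajectories *)

Section Cost.
Context (R : realType) (T : nat) (M : lost_sales R T).

Lemma hold_le_coef t : hold M t <= cost_coef M.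
Proof.
apply: le_trans (le_bigmax _ _ t) => /=.
by rewrite le_max lexx.
Qed.

Lemma short_le_coef t : short M t <= cost_coef M.
Proof.
apply: le_trans (le_bigmax _ _ t) => /=.
by rewrite le_max lexx orbT.
Qed.

Lemma cost_coef_ge0 : 0 <= cost_coef M.
Proof. exact: bigmax_ge_id. Qed.

Lemma cost_coef_gt0 : (0 < T)%N -> 0 < cost_coef M.
Proof.
by move=> T0; exact: lt_le_trans (hold_gt0 M (period1 T0)) (hold_le_coef _).
Qed.

Lemma cost_ge0 t y d : 0 <= cost M t y d.
Proof.
by rewrite addr_ge0// mulr_ge0 ?le_max ?lexx ?orbT// ltW ?hold_gt0 ?short_gt0.
Qed.

(** The cost depends on [y - d] alone, so one estimate serves for changes of level, of demand, and
    of both together. *)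
Lemma cost_lip t y d y' d' :
  `|cost M t y d - cost M t y' d'| <= cost_coef M * `|(y - d) - (y' - d')|.
Proof.
rewrite /cost -(opprB y d) -(opprB y' d').
move: (y - d) (y' - d') (hold_gt0 M t) (short_gt0 M t) (hold_le_coef t)
  (short_le_coef t) => {y d y' d'} z z'.
move: (hold M t) (short M t) (cost_coef M) => h p C h0 p0 hC pC.
wlog zz' : z z' / z' <= z => [H|].
  by have [/H//|/ltW/H] := leP z' z; rewrite distrC [X in _ <= C * X]distrC.
have d0 : 0 <= z - z' by rewrite subr_ge0.
rewrite (ger0_norm d0).
have m1 := ler_wpM2r d0 hC; have m2 := ler_wpM2r d0 pC.
have m3 := mulr_ge0 (ltW h0) d0; have m4 := mulr_ge0 (ltW p0) d0.
have pos (a : R) : [/\ 0 <= a, Num.max a 0 = a & Num.max (- a) 0 = 0] \/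
    [/\ a <= 0, Num.max a 0 = 0 & Num.max (- a) 0 = - a].
  case/orP: (le_total 0 a) => a0; [left|right]; split=> //.
  - exact: max_l.
  - by apply: max_r; rewrite oppr_le0.
  - exact: max_r.
  - by apply: max_l; rewrite oppr_ge0.
rewrite ler_norml.
case: (pos z) => -[z0 -> ->]; case: (pos z') => -[z'0 -> ->]; try lra.
  have nz' : 0 <= - z' by lra.
  have := mulr_ge0 (ltW h0) z0; have := mulr_ge0 (ltW p0) nz'.
  have := mulr_ge0 (ltW h0) nz'; have := mulr_ge0 (ltW p0) z0.
  lra.
have -> : z = 0 by lra.
have -> : z' = 0 by lra.
by rewrite oppr0 !mulr0; lra.
Qed.

Lemma cost_le t y d : 0 <= y <= dbar M -> 0 <= d <= dbar M ->
  cost M t y d <= cost_coef M * dbar M.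
Proof.
move=> /andP[y0 yD] /andP[d0 dD].
have := cost_lip t y d 0 0.
have -> : cost M t 0 0 = 0 by rewrite /cost subrr maxxx !mulr0 addr0.
rewrite !subr0 ger0_norm ?cost_ge0// => /le_trans; apply.
by rewrite ler_wpM2l ?cost_coef_ge0// ler_norml; lra.
Qed.

End Cost.

Section Trajectory.
Context (R : realType) (m : nat) (M : lost_sales R m.+1).
Variables (S d : 'I_m.+1 -> R) (x : R).
Let D := dbar M.

Fixpoint stock (k : nat) : R :=
  if k is k'.+1
  then Num.max (Num.max (stock k') (S (inord k')) - d (inord k')) 0 else x.

Definition level (k : nat) : R := Num.max (stock k) (S (inord k)).

Lemma loss_sum_level :
  loss M S x d = \sum_(t < m.+1) cost M t (level t) (d t).
Proof.
have H k : (k <= m.+1)%N -> loss M S x d =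
    \sum_(t < k) cost M (inord t) (level t) (d (inord t))
    + loss_to_go M S d (drop k (enum 'I_m.+1)) (stock k).
  elim: k => [|k IH] km; first by rewrite big_ord0 add0r drop0.
  rewrite IH 1?ltnW// big_ord_recr/= -addrA; congr (_ + _).
  rewrite (drop_nth ord0) ?size_enum_ord//=.
  have -> : nth ord0 (enum 'I_m.+1) k = inord k.
    by apply/val_inj; rewrite /= nth_enum_ord// inordK.
  by [].
rewrite (H m.+1)// drop_oversize ?size_enum_ord// addr0.
by apply: eq_bigr => t _; rewrite inord_val.
Qed.

(** The level at which a run without reordering starts; a run from the first period also contains
    the initial stock. *)
Definition first_level (s : nat) : R :=
  if s is 0%N then Num.max x (S ord0) else S (inord s).

Hypothesis SD : forall t, 0 <= S t <= D.
Hypothesis dD : forall t, 0 <= d t <= D.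
Hypothesis xD : 0 <= x <= D.

Lemma first_level_itv s : 0 <= first_level s <= D.
Proof.
case: s => [|s]; last exact: SD.
by have /andP[s0 sD] := SD ord0; case/andP: xD => x0 x1;
  rewrite /= le_max x0 ge_max x1.
Qed.

Lemma level_itv k : 0 <= level k <= D.
Proof.
have /andP[s0 sD] := SD (inord k).
apply/andP; split; first by rewrite le_max s0 orbT.
rewrite ge_max sD andbT; elim: k {s0 sD} => [|k IH]; first by case/andP: xD.
have D0 : 0 <= D by rewrite ltW ?dbar_gt0.
have /andP[_ s1] := SD (inord k); have /andP[d0 _] := dD (inord k).
by rewrite ge_max D0 andbT lerBlDr (@le_trans _ _ D)// ?lerDl// ge_max IH.
Qed.

Lemma level_ge k s : (s <= k)%N ->
  first_level s - \sum_(s <= r < k) d (inord r) <= level k.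
Proof.
elim: k s => [|k IH] s.
  rewrite leqn0 => /eqP ->; rewrite big_geq// subr0 /level/=.
  by rewrite (_ : inord 0 = ord0)//; apply/val_inj; rewrite /= inordK.
rewrite leq_eqVlt ltnS => /predU1P[->|sk].
  by rewrite big_geq// subr0 /level /= le_max lexx orbT.
rewrite big_nat_recr//= opprD addrA.
apply: (@le_trans _ _ (level k - d (inord k))); first by rewrite lerD2r IH.
by rewrite {2}/level/= !le_max lexx.
Qed.

(** A new run starts whenever the base-stock level binds. It also binds when the leftover stock is
    clipped at 0, because base-stock levels are nonnegative. *)
Lemma level_attained k :
  exists2 s, (s <= k)%N & level k = first_level s - \sum_(s <= r < k) d (inord r).
Proof.
elim: k => [|k [s sk IH]].
  exists 0%N => //; rewrite big_geq// subr0 /level/=.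
  by rewrite (_ : inord 0 = ord0)//; apply/val_inj; rewrite /= inordK.
have topk : exists2 s, (s <= k.+1)%N &
    S (inord k.+1) = first_level s - \sum_(s <= r < k.+1) d (inord r).
  by exists k.+1; rewrite ?big_geq ?subr0.
rewrite /level/=; have /andP[s0 _] := SD (inord k.+1).
have [l1|l1] := leP (Num.max (level k - d (inord k)) 0) (S (inord k.+1)).
  exact: topk.
have [l2|l2] := leP (level k - d (inord k)) 0.
  by move: l1; rewrite (max_r l2) ltNge s0.
exists s; first exact: leqW.
by rewrite big_nat_recr//= opprD addrA -IH.
Qed.

End Trajectory.

(** * Exponential moments and deviations of the loss *)

Section LossMgf.
Context (R : realType) (m n : nat) (M : lost_sales R m.+1).
Let T := m.+1.
Let D := dbar M.
Let C := cost_coef M.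

(** Jensen's inequality with weights 1/T replaces [mu] by T mu in each period; this is the source of
    the factor T inside the square. Within a period, [level_ge] and [level_attained] supply the
    maximum that [staircase_mgf] requires. *)
Lemma loss_mgf (u : 'I_n -> 'I_T -> R) (x : R)
    (s : {ffun 'I_n -> bool} -> {S : 'I_T -> R | forall t, 0 <= S t <= D}) (mu : R) :
  (0 < n)%N -> (forall j t, 0 <= u j t <= D) -> 0 <= x <= D ->
  \sum_(e : {ffun 'I_n -> bool})
     expR (mu * \sum_j (-1) ^+ e j * loss M (sval (s e)) x (u j))
  <= 2 ^+ n * expR (60 + 4300 * (mu ^+ 2 * (n%:R * (T%:R * (C * D)) ^+ 2))).
Proof.
move=> n0 uD xD.
have T0 : 0 < T%:R :> R by rewrite ltr0n.
pose X (t : 'I_T) (e : {ffun 'I_n -> bool}) := T%:R * mu *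
  \sum_j (-1) ^+ e j * cost M t (level (sval (s e)) (u j) x t) (u j t).
apply: (@le_trans _ _ (\sum_(e : {ffun 'I_n -> bool})
    \sum_(t < T) T%:R^-1 * expR (X t e))).
  apply: ler_sum => e _.
  have -> : mu * (\sum_j (-1) ^+ e j * loss M (sval (s e)) x (u j)) =
      \sum_(t < T) T%:R^-1 * X t e.
    under eq_bigr do rewrite loss_sum_level mulr_sumr.
    rewrite exchange_big/= mulr_sumr; apply: eq_bigr => t _.
    by rewrite /X; field; rewrite gt_eqF.
  apply: jensen_expR => [t|]; first by rewrite invr_ge0 ltW.
  by rewrite sumr_const card_ord -[LHS]mulr_natl divff// gt_eqF.
rewrite exchange_big/=.
apply: (@le_trans _ _ (\sum_(t < T) T%:R^-1 *
    (2 ^+ n * expR (60 + 4300 * (mu ^+ 2 * (n%:R * (T%:R * (C * D)) ^+ 2)))))); last first.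
  by rewrite sumr_const card_ord -[leLHS]mulr_natl mulrA divff ?mul1r// gt_eqF.
apply: ler_sum => t _; rewrite -mulr_sumr; apply: ler_wpM2l.
  by rewrite invr_ge0 ltW.
have -> : mu ^+ 2 * (n%:R * (T%:R * (C * D)) ^+ 2) =
    (T%:R * mu) ^+ 2 * (n%:R * (C * D) ^+ 2) by ring.
pose ud (j : 'I_n) (r : nat) := u j (inord r).
apply: (@staircase_mgf R n t (fun s j => \sum_(s <= r < t) ud j r) D C
  (fun j y => cost M t y (u j t)) {S : 'I_T -> R | forall t, 0 <= S t <= D}
  (fun S s => first_level (sval S) x s)
  (fun S j => level (sval S) (u j) x t)) => //.
- by move=> i j; apply: sumr_ge0 => r _; case/andP: (uD j (inord r)).
- move=> i i' j ii'; rewrite [leRHS](big_cat_nat (n := i'))//=; last by rewrite -ltnS.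
  by rewrite lerDr; apply: sumr_ge0 => r _; case/andP: (uD j (inord r)).
- exact: dbar_gt0.
- exact: cost_coef_ge0.
- move=> j y y' _ _; apply: le_trans (cost_lip _ _ _ _ _ _) _.
  by rewrite opprB addrA subrK.
- by move=> j y yD; rewrite ger0_norm ?cost_ge0//; apply: cost_le.
- by move=> S i; apply: (@first_level_itv R m M); [exact: (svalP S)|].
- by move=> S j; apply: (@level_itv R m M); [exact: (svalP S)|exact: uD|].
- by move=> S i j; apply: level_ge; rewrite -ltnS.
- move=> S j.
  have [i it E] := @level_attained R m M (sval S) (u j) x (svalP S) t.
  by exists (Ordinal (it : (i < t.+1)%N)).
Qed.

End LossMgf.

Section DeviationTail.
Context (R : realType) (m n : nat) (M : lost_sales R m.+1) (V : finType)
  (p : 'I_m.+1 -> V -> R) (val_ : 'I_m.+1 -> V -> R) (x1 : R).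
Let D := dbar M.
Let B := m.+1%:R * (cost_coef M * D).

Definition mean_loss (S : 'I_m.+1 -> R) : R :=
  \sum_(u : {ffun 'I_m.+1 -> V}) prodw p u * loss M S x1 (fun t => val_ t (u t)).

Definition emp_gap (v : {ffun 'I_m.+1 * 'I_n -> V}) (S : 'I_m.+1 -> R) : R :=
  mean_loss S - empirical_loss M (fun t (i : 'I_n) => val_ t (v (t, i))) x1 S.

Hypothesis n0 : (0 < n)%N.
Hypothesis p0 : forall t x, 0 <= p t x.
Hypothesis p1 : forall t, \sum_x p t x = 1.
Hypothesis valD : forall t x, 0 <= val_ t x <= D.
Hypothesis xD : 0 <= x1 <= D.

(** Chernoff's bound, with [b] choosing the side. The existential over [S] is turned into a selector
    by choice. *)
Lemma deviation_tail (b : bool) (z : R) : 0 < z ->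
  \sum_(v : {ffun 'I_m.+1 * 'I_n -> V} |
      `[< exists2 S : 'I_m.+1 -> R, (forall t, 0 <= S t <= D) & z < (-1) ^+ b * emp_gap v S >])
    prodw (fun q : 'I_m.+1 * 'I_n => p q.1) v
  <= expR (60 - n%:R * z ^+ 2 / (688 * 100 * B ^+ 2)).
Proof.
move=> z0.
have D0 : 0 < D by exact: dbar_gt0.
have B0 : 0 < B by rewrite mulr_gt0 ?ltr0n// mulr_gt0// cost_coef_gt0.
have nR : 0 < n%:R :> R by rewrite ltr0n.
pose I := {S : 'I_m.+1 -> R | forall t, 0 <= S t <= D}.
pose gap v S : R := (-1) ^+ b * emp_gap v S.
have S0 : I by exists (fun=> 0) => t; rewrite lexx ltW.
have : forall v, exists S : I, (exists2 S', (forall t, 0 <= S' t <= D) & z < gap v S') ->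
    z < gap v (sval S).
  move=> v.
  have [[S SD Sz]|no] := pselect (exists2 S, (forall t, 0 <= S t <= D) & z < gap v S);
    last by exists S0.
  by exists (exist _ S SD).
move=> /boolp.choice[s sP].
(* Minimizes 17200 l^2 n B^2 - l n z, with minimum - n z^2 / (68800 B^2); 17200 is 4 * 4300 because
   symmetrization doubles the parameter. *)
pose l : R := z / (344 * 100 * B ^+ 2).
have k0 : 0 < 344 * 100 :> R by lra.
have l0 : 0 < l by exact: divr_gt0 z0 (mulr_gt0 k0 (exprn_gt0 2 B0)).
pose K (mu : R) := expR (60 + 4300 * (mu ^+ 2 * (n%:R * B ^+ 2))).
have Keven mu : K (- mu) = K mu by rewrite /K sqrrN.
pose f (S : I) (u : {ffun 'I_m.+1 -> V}) := loss M (sval S) x1 (fun t => val_ t (u t)).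
have rad (u : 'I_n -> {ffun 'I_m.+1 -> V}) (s' : {ffun 'I_n -> bool} -> I) mu :
    \sum_(e : {ffun 'I_n -> bool}) expR (mu * \sum_j (-1) ^+ e j * f (s' e) (u j))
    <= 2 ^+ n * K mu.
  exact: (@loss_mgf R m n M (fun j t => val_ t (u j t)) x1 s' mu n0).
have := @product_empirical_mgf R _ V p n I f K p0 p1 n0 rad Keven s ((-1) ^+ b * l).
have -> : K (2 * ((-1) ^+ b * l)) = expR (60 + 172 * 100 * (l ^+ 2 * (n%:R * B ^+ 2))).
  by rewrite /K !exprMn sqrr_sign; congr expR; ring.
set W := prodw _; set F := (X in X <= _ -> _) => FK.
have W0 v : 0 <= W v by exact: prodw_ge0.
suff : expR (l * (n%:R * z)) * \sum_(v | `[< exists2 S : 'I_m.+1 -> R,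
    (forall t, 0 <= S t <= D) & z < gap v S >]) W v <= F.
  move=> /le_trans/(_ FK); rewrite -ler_pdivlMl ?expR_gt0// -expRN -expRD.
  move=> /le_trans; apply; rewrite ler_expR /l.
  by rewrite le_eqVlt; apply/orP; left; apply/eqP; field; rewrite gt_eqF.
rewrite mulr_sumr /F.
rewrite big_mkcond/=; apply: ler_sum => v _.
case: asboolP => [/sP|_]; last by rewrite mulr_ge0 ?expR_ge0.
rewrite /gap /emp_gap => /ltW zle; rewrite mulrC ler_wpM2l// ler_expR.
set X := _ - _ in zle *; set Y := _ - _.
have -> : (-1) ^+ b * l * (n%:R * Y) = l * (n%:R * ((-1) ^+ b * Y)) by ring.
rewrite !ler_pM2l//; apply: le_trans zle _.
suff -> : X = Y by [].
rewrite /X /Y /empirical_loss; congr (_ - _ / _).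
apply: eq_bigr => g _; rewrite /f; congr loss_to_go.
by apply/funext => t; rewrite ffunE.
Qed.

End DeviationTail.

(** * Dynamic programming over abstract expectations *)

Definition lip (R : realType) (K : R) (f : R -> R) :=
  forall x y, `|f x - f y| <= K * `|x - y|.

Lemma lip_continuous (R : realType) (K : R) (f : R -> R) :
  (forall x y, `|f x - f y| <= K * `|x - y|) -> continuous f.
Proof.
move=> fK x; apply/cvgrPdist_lt => e e0; near=> y.
have K0 : 0 < `|K| + 1 by rewrite ltr_pwDr.
apply: (@le_lt_trans _ _ ((`|K| + 1) * `|x - y|)).
  apply: le_trans (fK _ _) _; apply: ler_wpM2r => //.
  by rewrite (le_trans (ler_norm _))// lerDl.
rewrite mulrC -ltr_pdivlMr//.
near: y; apply: (@cvgr_dist_lt _ R^o _ (nbhs x) _ id x) => //.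
by rewrite divr_gt0.
Unshelve. all: by end_near.
Qed.

Definition lipschitz_fun (R : realType) (f : R -> R) := exists K, lip K f.

Lemma lipschitz_cst (R : realType) (c : R) : lipschitz_fun (fun=> c).
Proof. by exists 0 => x y; rewrite subrr normr0 mul0r. Qed.

Lemma lipschitzD (R : realType) (f g : R -> R) : lipschitz_fun f ->
  lipschitz_fun g -> lipschitz_fun (fun d => f d + g d).
Proof.
move=> [K fK] [L gL]; exists (K + L) => x y.
rewrite opprD addrACA mulrDl (le_trans (ler_normD _ _))//.
by rewrite lerD.
Qed.

Lemma lipschitzZ (R : realType) (f : R -> R) (a : R) : lipschitz_fun f ->
  lipschitz_fun (fun d => a * f d).
Proof.
move=> [K fK]; exists (`|a| * K) => x y.
by rewrite -mulrBr normrM -mulrA ler_wpM2l.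
Qed.

Lemma lipschitz_nonneg (R : realType) (f : R -> R) : lipschitz_fun f ->
  exists2 K, 0 <= K & lip K f.
Proof.
move=> [K fK]; exists `|K| => // x y; apply: le_trans (fK x y) _.
by rewrite ler_wpM2r// ler_norm.
Qed.

Lemma dist_maxl (R : realDomainType) (x y z : R) :
  `|Num.max x z - Num.max y z| <= `|x - y|.
Proof.
wlog xy : x y / x <= y => [H|].
  by case/orP: (le_total x y) => /H//; rewrite distrC [leRHS]distrC.
rewrite distrC [leRHS]distrC !ger0_norm ?subr_ge0//; last by rewrite le_max2.
have [|] := leP x z; have [|] := leP y z; lra.
Qed.

Lemma dist_max2 (R : realDomainType) (x y x' y' e : R) :
  `|x - x'| <= e -> `|y - y'| <= e -> `|Num.max x y - Num.max x' y'| <= e.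
Proof.
rewrite !ler_norml => /andP[? ?] /andP[? ?].
by have [|] := leP x y; have [|] := leP x' y'; move=> ? ?; apply/andP; split; lra.
Qed.

Lemma dist_minl (R : realDomainType) (x y z : R) :
  `|Num.min x z - Num.min y z| <= `|x - y|.
Proof.
wlog xy : x y / x <= y => [H|].
  by case/orP: (le_total x y) => /H//; rewrite distrC [leRHS]distrC.
rewrite distrC [leRHS]distrC !ger0_norm ?subr_ge0//; last by rewrite le_min2.
have [|] := leP x z; have [|] := leP y z; lra.
Qed.

(* Only integrals of Lipschitz functions occur, so true, capped, discretized
   and empirical demand laws on [0, D] are all treated as such functionals. *)
Record expect (R : realType) (D : R) := Expect {
  ev :> (R -> R) -> R ;
  evD : forall f g, lipschitz_fun f -> lipschitz_fun g ->
    ev (fun d => f d + g d) = ev f + ev g ;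
  evZ : forall a f, lipschitz_fun f -> ev (fun d => a * f d) = a * ev f ;
  ev_cst : forall c, ev (fun=> c) = c ;
  ev_le : forall f g, lipschitz_fun f -> lipschitz_fun g ->
    (forall d, 0 <= d <= D -> f d <= g d) -> ev f <= ev g }.

Section ExpectTheory.
Context (R : realType) (D : R) (E : expect D).

Lemma ev_eq f g : lipschitz_fun f -> lipschitz_fun g ->
  (forall d, 0 <= d <= D -> f d = g d) -> E f = E g.
Proof.
by move=> lf lg fg; apply/eqP; rewrite eq_le !ev_le// => d /fg ->.
Qed.

Lemma evDc f c : lipschitz_fun f -> E (fun d => f d + c) = E f + c.
Proof.
by move=> lf; rewrite evD ?ev_cst//; exact: lipschitz_cst.
Qed.

Lemma ev_dist f g c : lipschitz_fun f -> lipschitz_fun g ->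
  (forall d, 0 <= d <= D -> `|f d - g d| <= c) -> `|E f - E g| <= c.
Proof.
move=> lf lg fg.
have lc h : lipschitz_fun h -> lipschitz_fun (fun d => h d + c).
  by move=> lh; apply: lipschitzD => //; exact: lipschitz_cst.
have h1 : E f <= E g + c.
  rewrite -evDc//; apply: ev_le => //; first exact: lc.
  by move=> d /fg; rewrite ler_norml => /andP[]; lra.
have h2 : E g <= E f + c.
  rewrite -evDc//; apply: ev_le => //; first exact: lc.
  by move=> d /fg; rewrite ler_norml => /andP[]; lra.
by rewrite ler_norml; lra.
Qed.

End ExpectTheory.

Section BaseStockCost.
Context (R : realType) (T : nat) (M : lost_sales R T).
Let D := dbar M.
Let C := cost_coef M.

Section OneLaw.
Variable E : 'I_T -> expect D.

Fixpoint bsval (S : 'I_T -> R) (ts : seq 'I_T) (x : R) : R :=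
  if ts is t :: ts' then
    E t (fun d => cost M t (Num.max x (S t)) d
      + bsval S ts' (Num.max (Num.max x (S t) - d) 0))
  else 0.

Definition stage S ts t y d := cost M t y d + bsval S ts (Num.max (y - d) 0).

Definition qval S ts t y := E t (stage S ts t y).

Lemma bsval_cons S t ts x :
  bsval S (t :: ts) x = qval S ts t (Num.max x (S t)).
Proof. by []. Qed.

(** Ordering up and selling are nonexpansive in the sup norm, so errors in the stock and in the
    levels do not accumulate: each period adds [C * e] once. *)
Lemma bsval_near ts S S' x x' e : `|x - x'| <= e ->
  (forall t, `|S t - S' t| <= e) ->
  `|bsval S ts x - bsval S' ts x'| <= (size ts)%:R * C * e.
Proof.
elim: ts S S' x x' e => [|t ts IH] S S' x x' e xx' SS' /=.
  by rewrite subrr normr0 !mul0r.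
have e0 : 0 <= e by apply: le_trans xx'.
have C0 : 0 <= C by exact: cost_coef_ge0.
have near S1 S2 y y' d d' e' : `|(y - d) - (y' - d')| <= e' ->
    (forall t, `|S1 t - S2 t| <= e') ->
    `|stage S1 ts t y d - stage S2 ts t y' d'| <= (size ts).+1%:R * C * e'.
  move=> yd' SSe; rewrite /stage opprD addrACA -natr1 [_ + 1]addrC !mulrDl mul1r.
  apply: le_trans (ler_normD _ _) _; apply: lerD.
    by apply: le_trans (cost_lip _ _ _ _ _ _) _; apply: ler_wpM2l.
  by apply: IH => //; apply: le_trans (dist_maxl _ _ _) yd'.
have lipS S1 y : lipschitz_fun (stage S1 ts t y).
  exists ((size ts).+1%:R * C) => d d'; apply: near.
    by rewrite (_ : y - d - (y - d') = d' - d) 1?distrC//; ring.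
  by move=> ?; rewrite subrr normr0.
apply: (@ev_dist R D (E t) (stage S ts t (Num.max x (S t)))
  (stage S' ts t (Num.max x' (S' t)))) => // d _; apply: near => //.
by rewrite (_ : _ - d - (_ - d) = Num.max x (S t) - Num.max x' (S' t)) ?dist_max2//; ring.
Qed.

Lemma stage_near S S' ts t y y' d d' e : `|(y - d) - (y' - d')| <= e ->
  (forall t, `|S t - S' t| <= e) ->
  `|stage S ts t y d - stage S' ts t y' d'| <= (size ts).+1%:R * C * e.
Proof.
move=> yd' SSe; rewrite /stage opprD addrACA -natr1 [_ + 1]addrC !mulrDl mul1r.
apply: le_trans (ler_normD _ _) _; apply: lerD.
  apply: le_trans (cost_lip _ _ _ _ _ _) _.
  by apply: ler_wpM2l => //; exact: cost_coef_ge0.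
by apply: bsval_near => //; apply: le_trans (dist_maxl _ _ _) yd'.
Qed.

Lemma stage_lip S ts t y : lip ((size ts).+1%:R * C) (stage S ts t y).
Proof.
move=> d d'; apply: stage_near; last by move=> ?; rewrite subrr normr0.
by rewrite (_ : y - d - (y - d') = d' - d) 1?distrC//; ring.
Qed.

Lemma stage_lipschitz S ts t y : lipschitz_fun (stage S ts t y).
Proof. by exists ((size ts).+1%:R * C); exact: stage_lip. Qed.

Lemma cost_lipschitz t y : lipschitz_fun (cost M t y).
Proof.
exists C => d d'; apply: le_trans (cost_lip _ _ _ _ _ _) _.
by rewrite (_ : y - d - (y - d') = d' - d) 1?distrC//; ring.
Qed.

Lemma bsval_lipschitz S ts y : lipschitz_fun (fun d => bsval S ts (Num.max (y - d) 0)).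
Proof.
exists ((size ts)%:R * C) => d d'; apply: bsval_near => [|?]; last by rewrite subrr normr0.
apply: le_trans (dist_maxl _ _ _) _.
by rewrite (_ : y - d - (y - d') = d' - d) 1?distrC//; ring.
Qed.

Lemma qval_near S ts t y y' :
  `|qval S ts t y - qval S ts t y'| <= (size ts).+1%:R * C * `|y - y'|.
Proof.
apply: ev_dist => [||d _]; rewrite -?/(stage _ _ _ _); try exact: stage_lipschitz.
apply: stage_near => [|?]; last by rewrite subrr normr0.
by rewrite (_ : y - d - (y' - d) = y - y')//; ring.
Qed.

Lemma qvalE S ts t y : qval S ts t y =
  E t (cost M t y) + E t (fun d => bsval S ts (Num.max (y - d) 0)).
Proof. by rewrite /qval evD//; [exact: cost_lipschitz|exact: bsval_lipschitz]. Qed.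

Lemma bsval_ext S S' ts : {in ts, S =1 S'} -> bsval S ts =1 bsval S' ts.
Proof.
elim: ts => // t ts IH SS' x /=; rewrite SS' ?mem_head//; congr (E t _).
apply/funext => d; rewrite IH// => u uts.
by rewrite SS'// in_cons uts orbT.
Qed.

(* Base stock S is optimal from every tail of ts, against all feasible levels. *)
Fixpoint bellman S (ts : seq 'I_T) : Prop :=
  if ts is t :: ts' then
    (forall x y, 0 <= x -> x <= y -> bsval S (t :: ts') x <= qval S ts' t y)
    /\ bellman S ts'
  else True.

Lemma bellman_ext S S' ts : {in ts, S =1 S'} -> bellman S ts -> bellman S' ts.
Proof.
elim: ts => // t ts IH SS' [b1 b2].
have SSts : {in ts, S =1 S'} by move=> u uts; rewrite SS'// in_cons uts orbT.
split; last exact: IH.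
move=> x y x0 xy; rewrite -(bsval_ext SS').
have -> : qval S' ts t y = qval S ts t y; last exact: b1.
by congr (E t _); apply/funext => d; rewrite /stage (bsval_ext SSts).
Qed.

Lemma bellman_ndecr S ts : bellman S ts ->
  forall x y, 0 <= x -> x <= y -> bsval S ts x <= bsval S ts y.
Proof.
case: ts => [//|t ts] [b _] x y x0 xy; rewrite (bsval_cons S t ts y).
by apply: b => //; rewrite le_max xy.
Qed.

Lemma bellman_le S S' ts : bellman S ts ->
  forall x, 0 <= x -> bsval S ts x <= bsval S' ts x.
Proof.
elim: ts => // t ts IH [b1 b2] x x0.
apply: le_trans (b1 x (Num.max x (S' t)) x0 _) _; first by rewrite le_max lexx.
rewrite bsval_cons; apply: ev_le; try exact: stage_lipschitz.
move=> d _; rewrite /stage lerD2l; apply: IH => //.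
by rewrite le_max lexx orbT.
Qed.

Definition convex_nonneg (f : R -> R) := forall x y l, 0 <= x -> 0 <= y ->
  0 <= l <= 1 -> f (l * x + (1 - l) * y) <= l * f x + (1 - l) * f y.

(** The next stock is convex in the level, but composing it with a convex continuation also requires
    that continuation to be nondecreasing; [bellman_ndecr] provides this. *)
Lemma qval_convex S ts t : bellman S ts -> convex_nonneg (bsval S ts) ->
  convex_nonneg (qval S ts t).
Proof.
move=> bl cv x y l x0 y0 /andP[l0 l1].
have l1' : 0 <= 1 - l by rewrite subr_ge0.
have lS z := stage_lipschitz S ts t z.
rewrite /qval -!evZ// -evD; [|exact: lipschitzZ|exact: lipschitzZ].
apply: ev_le => //; first by apply: lipschitzD; apply: lipschitzZ.
move=> d _; rewrite /stage.
have maxc (a b : R) : Num.max (l * a + (1 - l) * b) 0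
    <= l * Num.max a 0 + (1 - l) * Num.max b 0.
  have a1 : a <= Num.max a 0 by rewrite le_max lexx.
  have a2 : 0 <= Num.max a 0 by rewrite le_max lexx orbT.
  have b1 : b <= Num.max b 0 by rewrite le_max lexx.
  have b2 : 0 <= Num.max b 0 by rewrite le_max lexx orbT.
  by rewrite ge_max lerD ?ler_wpM2l// addr_ge0// mulr_ge0.
have e1 : l * x + (1 - l) * y - d = l * (x - d) + (1 - l) * (y - d) by ring.
have e2 : d - (l * x + (1 - l) * y) = l * (d - x) + (1 - l) * (d - y) by ring.
have hV : bsval S ts (Num.max (l * x + (1 - l) * y - d) 0) <=
    l * bsval S ts (Num.max (x - d) 0) + (1 - l) * bsval S ts (Num.max (y - d) 0).
  apply: (@le_trans _ _ (bsval S ts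
      (l * Num.max (x - d) 0 + (1 - l) * Num.max (y - d) 0))).
    by apply: bellman_ndecr => //; rewrite ?le_max ?lexx ?orbT// e1.
  by apply: cv; rewrite ?le_max ?lexx ?orbT// l0.
have hc : cost M t (l * x + (1 - l) * y) d <= l * cost M t x d + (1 - l) * cost M t y d.
  rewrite /cost e1 e2.
  have := ler_wpM2l (ltW (hold_gt0 M t)) (maxc (x - d) (y - d)).
  have := ler_wpM2l (ltW (short_gt0 M t)) (maxc (d - x) (d - y)).
  move: (Num.max (l * _ + _) 0) (Num.max (l * _ + _) 0).
  move: (Num.max (x - d) 0) (Num.max (y - d) 0) (Num.max (d - x) 0) (Num.max (d - y) 0).
  by move: (hold M t) (short M t) => h p A B A' B' P Q hp hh; lra.
by move: hV hc; lra.
Qed.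

Variable a : 'I_T -> R.
Hypothesis aD : forall t, 0 <= a t <= D.
Hypothesis cover : forall t y, a t <= y -> E t (cost M t (a t)) <= E t (cost M t y).

(** Backward induction carrying convexity. By [cover] and monotonicity of the continuation no level
    above [a t] beats [a t], so a minimizer [s] over the compact interval is global; by convexity
    the objective is nondecreasing beyond [s], so max(x, s) is the best feasible level. *)
Lemma exists_bellman ts : uniq ts -> exists S,
  [/\ forall t, 0 <= S t <= a t, bellman S ts & convex_nonneg (bsval S ts)].
Proof.
elim: ts => [|t ts IH].
  move=> _; exists (fun=> 0); split=> // [t|x y l _ _ _]; last by rewrite /= !mulr0 addr0.
  by rewrite lexx; case/andP: (aD t).
rewrite cons_uniq => /andP[tts /IH[S [Sa bS cS]]].
have /andP[at0 atD] := aD t.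
pose Q := qval S ts t.
have Qc : {within `[0, a t], continuous Q}.
  by apply: continuous_subspaceT; exact: lip_continuous (qval_near _ _ _).
have [s sa sQ] := EVT_min at0 Qc.
move: sa; rewrite in_itv/= => /andP[s0 sa].
have Qa y : a t <= y -> Q (a t) <= Q y.
  move=> ay; rewrite /Q !qvalE lerD ?cover//.
  apply: ev_le; try exact: bsval_lipschitz.
  move=> d _; apply: bellman_ndecr => //; first by rewrite le_max lexx orbT.
  by rewrite le_max2// lerD2r.
have Qmin y : 0 <= y -> Q s <= Q y.
  move=> y0; have [ya|/ltW ay] := leP y (a t).
    by apply: sQ; rewrite in_itv/= y0 ya.
  apply: le_trans (Qa y ay); apply: sQ; rewrite in_itv/= at0 lexx//.
have Qconv : convex_nonneg Q by exact: qval_convex.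
have Qnd x y : s <= x -> x <= y -> Q x <= Q y.
  move=> sx xy; have [ys|sy] := leP y s.
    have xs : x <= s by apply: le_trans xy ys.
    by have -> : x = y by apply/eqP; rewrite eq_le xy (le_trans ys sx).
  pose l := (y - x) / (y - s).
  have ys0 : 0 < y - s by rewrite subr_gt0.
  have xE : x = l * s + (1 - l) * y by rewrite /l; field; rewrite gt_eqF.
  have l0 : 0 <= l by rewrite divr_ge0 ?subr_ge0// ltW.
  have l1 : l <= 1 by rewrite ler_pdivrMr// mul1r lerD2l lerN2.
  have y0 : 0 <= y by rewrite ltW// (le_lt_trans s0).
  have l01 : 0 <= l <= 1 by rewrite l0.
  rewrite [in leLHS]xE; apply: le_trans (Qconv s y l s0 y0 l01) _.
  have := ler_wpM2l l0 (Qmin y y0); lra.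
pose S' u := if u == t then s else S u.
have SS' : {in ts, S =1 S'}.
  by move=> u uts; rewrite /S'; case: eqP => // ut; rewrite -ut uts in tts.
have VE x : bsval S' (t :: ts) x = Q (Num.max x s).
  rewrite bsval_cons /S' eqxx; congr (E t _); apply/funext => d.
  by rewrite /stage -(bsval_ext SS').
have cV : convex_nonneg (fun x => Q (Num.max x s)).
  move=> x y l x0 y0 l01.
  have /andP[l0 l1] := l01.
  have l1' : 0 <= 1 - l by rewrite subr_ge0.
  apply: le_trans (Qconv (Num.max x s) (Num.max y s) l _ _ l01);
    rewrite ?le_max ?s0 ?orbT//.
  apply: Qnd; first by rewrite le_max lexx orbT.
  rewrite ge_max lerD ?ler_wpM2l ?le_max ?lexx//=.
  have h1 : l * s <= l * Num.max x s by rewrite ler_wpM2l// le_max lexx orbT.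
  have h2 : (1 - l) * s <= (1 - l) * Num.max y s by rewrite ler_wpM2l// le_max lexx orbT.
  lra.
exists S'; split.
- by move=> u; rewrite /S'; case: eqP => [->|//]; rewrite s0.
- split; last exact: bellman_ext bS.
  move=> x y x0 xy; rewrite -[leLHS]/(bsval S' (t :: ts) x) VE.
  have -> : qval S' ts t y = Q y.
    by congr (E t _); apply/funext => d; rewrite /stage -(bsval_ext SS').
  have [sx|xs] := leP x s; last by apply: Qnd => //; exact: ltW.
  by apply: Qmin; exact: le_trans xy.
- by apply: (eq_ind _ convex_nonneg cV); apply/esym/funext.
Qed.

(* Holds for laws carried by [0, a t], in particular for capped samples. *)
Hypothesis cover_strict : forall t y, a t <= y ->
  E t (cost M t (a t)) + hold M t * (y - a t) <= E t (cost M t y).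

(** Until [S'] first exceeds a cap the stock stays below the caps, which are nondecreasing in time;
    in that period the excess costs a fixed holding charge. The gap is uniform in [x] so that it
    passes through the expectations of earlier periods. *)
Lemma bellman_gap S S' ts t0 : bellman S ts -> sorted (fun s t => a s <= a t) ts ->
  t0 \in ts -> a t0 < S' t0 ->
  exists2 g, 0 < g & forall x, 0 <= x -> x <= a (head t0 ts) ->
    bsval S ts x + g <= bsval S' ts x.
Proof.
elim: ts => // t ts IH [b1 b2] srt t0ts aS'.
have [aSt|Sat] := ltP (a t) (S' t).
  exists (hold M t * (S' t - a t)).
    by rewrite mulr_gt0 ?hold_gt0// subr_gt0.
  move=> x x0 /= xa.
  have -> : Num.max x (S' t) = S' t by apply: max_r; apply: le_trans xa (ltW aSt).
  rewrite -!/(stage _ _ _ _).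
  apply: (@le_trans _ _ (qval S ts t (a t) + hold M t * (S' t - a t))).
    by rewrite lerD2r; apply: b1.
  apply: (@le_trans _ _ (qval S ts t (S' t))).
    rewrite !qvalE addrAC lerD//; first by apply: cover_strict; exact: ltW.
    apply: ev_le; try exact: bsval_lipschitz.
    move=> d _; apply: bellman_ndecr => //; first by rewrite le_max lexx orbT.
    by rewrite le_max2// lerD2r ltW.
  apply: ev_le; try exact: stage_lipschitz.
  move=> d _; rewrite /stage lerD2l; apply: bellman_le => //.
  by rewrite le_max lexx orbT.
have t0in : t0 \in ts.
  move: t0ts; rewrite in_cons => /predU1P[t0t|//].
  by move: aS'; rewrite t0t ltNge Sat.
have [g g0 gP] := IH b2 (path_sorted srt) t0in aS'.
exists g => // x x0 /= xa; rewrite -!/(stage _ _ _ _).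
set y := Num.max x (S' t).
have ya : y <= a t by rewrite ge_max xa.
apply: (@le_trans _ _ (qval S ts t y + g)).
  by rewrite lerD2r; apply: b1 => //; rewrite le_max lexx.
rewrite /qval -evDc; last exact: stage_lipschitz.
apply: ev_le; [|exact: stage_lipschitz|].
  by apply: lipschitzD; [exact: stage_lipschitz|exact: lipschitz_cst].
move=> d /andP[d0 _]; rewrite /stage -addrA lerD2l; apply: gP.
  by rewrite le_max lexx orbT.
have [_ /andP[h0 _]] : True /\ 0 <= a (head t0 ts) <= D by split.
rewrite ge_max h0 andbT.
apply: (@le_trans _ _ (a t)); first by rewrite lerBlDr (le_trans ya)// lerDl.
by case: (ts) srt t0in => // u us /= /andP[].
Qed.

End OneLaw.

(** [eta] bounds the transport distance between the laws. With k later periods the integrand has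
    Lipschitz constant (k + 1) C, and these constants sum to at most a square. *)
Lemma bsval_close (E E' : 'I_T -> expect D) S ts x eta :
  (forall t K f, 0 <= K -> lip K f -> `|E t f - E' t f| <= K * eta) -> 0 <= eta ->
  `|bsval E S ts x - bsval E' S ts x| <= (size ts)%:R ^+ 2 * C * eta.
Proof.
move=> EE' eta0; have C0 : 0 <= C by exact: cost_coef_ge0.
elim: ts x => [|t ts IH] x; first by rewrite /= subrr normr0 expr0n/= !mul0r.
rewrite !bsval_cons; set y := Num.max x (S t).
have h1 : `|qval E S ts t y - E t (stage E' S ts t y)| <= (size ts)%:R ^+ 2 * C * eta.
  apply: ev_dist; try exact: stage_lipschitz.
  by move=> d _; rewrite /stage opprD addrACA subrr add0r.
have h2 : `|E t (stage E' S ts t y) - E' t (stage E' S ts t y)|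
    <= (size ts).+1%:R * C * eta.
  by apply: EE'; [rewrite mulr_ge0|exact: stage_lip].
apply: le_trans (ler_distD (E t (stage E' S ts t y)) _ _) _.
apply: le_trans (lerD h1 h2) _.
rewrite -!mulrDl !ler_wpM2r//= -natr1.
have : 0 <= (size ts)%:R :> R by [].
move: (size ts)%:R => k k0; lra.
Qed.

End BaseStockCost.

Lemma lipschitz_min (R : realType) (f : R -> R) (a : R) :
  lipschitz_fun f -> lipschitz_fun (fun d => f (Num.min d a)).
Proof.
move=> /lipschitz_nonneg[K K0 fK]; exists K => x y.
by apply: le_trans (fK _ _) _; rewrite ler_wpM2l// dist_minl.
Qed.

(** * Capped, finite and empirical laws *)

Section CappedExpect.
Context (R : realType) (D : R) (E : expect D) (a : R).
Hypothesis aD : 0 <= a <= D.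

Definition cap_ev (f : R -> R) := E (fun d => f (Num.min d a)).

Lemma cap_evD f g : lipschitz_fun f -> lipschitz_fun g ->
  cap_ev (fun d => f d + g d) = cap_ev f + cap_ev g.
Proof. by move=> lf lg; rewrite /cap_ev evD//; exact: lipschitz_min. Qed.

Lemma cap_evZ c f : lipschitz_fun f -> cap_ev (fun d => c * f d) = c * cap_ev f.
Proof. by move=> lf; rewrite /cap_ev evZ//; exact: lipschitz_min. Qed.

Lemma cap_ev_cst c : cap_ev (fun=> c) = c.
Proof. exact: ev_cst. Qed.

Lemma cap_ev_le f g : lipschitz_fun f -> lipschitz_fun g ->
  (forall d, 0 <= d <= D -> f d <= g d) -> cap_ev f <= cap_ev g.
Proof.
move=> lf lg fg; apply: ev_le; try exact: lipschitz_min.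
move=> d /andP[d0 dD]; apply: fg; case/andP: aD => a0 a1.
by rewrite le_min d0 a0 ge_min dD.
Qed.

Definition cap_expect : expect D := Expect cap_evD cap_evZ cap_ev_cst cap_ev_le.

End CappedExpect.

Section FiniteExpect.
Context (R : realType) (D : R) (V : finType) (p : V -> R) (v : V -> R).
Hypothesis p0 : forall x, 0 <= p x.
Hypothesis p1 : \sum_x p x = 1.
Hypothesis vD : forall x, 0 <= v x <= D.

Definition fin_ev (f : R -> R) := \sum_x p x * f (v x).

Lemma fin_evD f g : lipschitz_fun f -> lipschitz_fun g ->
  fin_ev (fun d => f d + g d) = fin_ev f + fin_ev g.
Proof.
by move=> _ _; rewrite /fin_ev -big_split/=; apply: eq_bigr => x _; rewrite mulrDr.
Qed.

Lemma fin_evZ c f : lipschitz_fun f -> fin_ev (fun d => c * f d) = c * fin_ev f.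
Proof.
by move=> _; rewrite /fin_ev mulr_sumr; apply: eq_bigr => x _; rewrite mulrCA.
Qed.

Lemma fin_ev_cst c : fin_ev (fun=> c) = c.
Proof. by rewrite /fin_ev -mulr_suml p1 mul1r. Qed.

Lemma fin_ev_le f g : lipschitz_fun f -> lipschitz_fun g ->
  (forall d, 0 <= d <= D -> f d <= g d) -> fin_ev f <= fin_ev g.
Proof.
by move=> _ _ fg; apply: ler_sum => x _; rewrite ler_wpM2l// fg.
Qed.

Definition fin_expect : expect D := Expect fin_evD fin_evZ fin_ev_cst fin_ev_le.

End FiniteExpect.

Section CapEquivalence.
Context (R : realType) (T : nat) (M : lost_sales R T) (E : 'I_T -> expect (dbar M))
  (a : 'I_T -> R).
Hypothesis aD : forall t, 0 <= a t <= dbar M.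

Lemma max_sub_min (y d b : R) : 0 <= d -> y <= b ->
  Num.max (y - Num.min d b) 0 = Num.max (y - d) 0.
Proof.
move=> d0 yb; have [//|/ltW bd] := leP d b.
by rewrite !max_r ?subr_le0//; exact: le_trans yb bd.
Qed.

Lemma cost_cap t y d : 0 <= d -> y <= a t ->
  cost M t y d = cost M t y (Num.min d (a t)) + short M t * Num.max (d - a t) 0.
Proof.
move=> d0 ya; rewrite /cost max_sub_min// -addrA -mulrDr; congr (_ + _ * _).
have [da|/ltW ad] := leP d (a t).
  by rewrite [Num.max (d - a t) 0]max_r ?subr_le0// addr0.
by rewrite !max_l ?subr_ge0//; [ring|exact: le_trans ya ad].
Qed.

Definition lost_cap (ts : seq 'I_T) : R :=
  \sum_(t <- ts) E t (fun d => short M t * Num.max (d - a t) 0).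

(** Below the caps the next stock sees the demand only through its capped value, while demand beyond
    the cap is lost at any such level, at a cost collected in [lost_cap]. Leftover stock stays below
    the next cap because caps are nondecreasing. *)
Lemma bsval_cap S ts x : sorted (fun s t => a s <= a t) ts ->
  (forall t, 0 <= S t <= a t) ->
  (if ts is t :: _ then x <= a t else True) ->
  bsval E S ts x = bsval (fun t => cap_expect (E t) (aD t)) S ts x + lost_cap ts.
Proof.
move=> + Sa; elim: ts x => [|t ts IH] x srt.
  by move=> _; rewrite /lost_cap big_nil/= addr0.
move=> xa; have /andP[S0 S1] := Sa t.
set E' := fun t => cap_expect (E t) (aD t).
have lp : lipschitz_fun (fun d => short M t * Num.max (d - a t) 0).
  apply: lipschitzZ; exists 1 => d d'; rewrite mul1r; apply: le_trans (dist_maxl _ _ _) _.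
  by rewrite (_ : d - a t - (d' - a t) = d - d')//; ring.
rewrite !bsval_cons /lost_cap big_cons -/(lost_cap ts).
set y := Num.max x (S t).
have ya : y <= a t by rewrite ge_max xa.
have l2 := lipschitz_min (a t) (stage_lipschitz E' S ts t y).
have l3 : lipschitz_fun (fun d => short M t * Num.max (d - a t) 0 + lost_cap ts).
  by apply: lipschitzD => //; exact: lipschitz_cst.
transitivity (E t (fun d => stage E' S ts t y (Num.min d (a t))
    + (short M t * Num.max (d - a t) 0 + lost_cap ts))); last first.
  by rewrite evD// evDc.
apply: ev_eq; [exact: stage_lipschitz|exact: lipschitzD|].
move=> d /andP[d0 _]; rewrite /stage (cost_cap d0 ya).
move: (cost M t y (Num.min d (a t))) => c.
rewrite -[LHS]addrA -[RHS]addrA; congr (c + _); rewrite [RHS]addrCA; congr (_ + _); rewrite IH; last 2 first.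
- exact: path_sorted srt.
- case: (ts) srt => // u us /= /andP[tu _]; have /andP[u0 _] := aD u.
  by rewrite ge_max u0 andbT lerBlDr (le_trans ya)// (le_trans tu)// lerDl.
by rewrite max_sub_min.
Qed.

End CapEquivalence.

Section FiniteProduct.
Context (R : realType) (T : nat) (M : lost_sales R T) (V : finType)
  (p : 'I_T -> V -> R) (v : 'I_T -> V -> R).
Hypothesis p0 : forall t x, 0 <= p t x.
Hypothesis p1 : forall t, \sum_x p t x = 1.
Hypothesis vD : forall t x, 0 <= v t x <= dbar M.

Let E t := fin_expect (p0 t) (p1 t) (vD t).

Lemma loss_to_go_ext S (d d' : 'I_T -> R) ts x : {in ts, d =1 d'} ->
  loss_to_go M S d ts x = loss_to_go M S d' ts x.
Proof.
elim: ts x => // t ts IH x dd' /=; rewrite dd' ?mem_head// IH// => u uts.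
by rewrite dd'// in_cons uts orbT.
Qed.

(** Iterated expectations equal the product mean because, the periods being distinct, the coordinate
    integrated out in period [t] is not read again. *)
Lemma bsval_fin S ts x : uniq ts ->
  bsval E S ts x = \sum_(u : {ffun 'I_T -> V})
    prodw p u * loss_to_go M S (fun t => v t (u t)) ts x.
Proof.
elim: ts x => [|t ts IH] x.
  by move=> _; rewrite /= big1// => u _; rewrite mulr0.
move=> /= /andP[tts uts]; rewrite (sum_prodw_upd p1 t).
apply: eq_bigr => i _; congr (_ * _); rewrite IH//.
set y := Num.max x (S t).
under [RHS]eq_bigr do rewrite ffunE eqxx mulrDr.
rewrite big_split/= -mulr_suml sum_prodw// mul1r; congr (_ + _).
apply: eq_bigr => u _; congr (_ * _); apply: loss_to_go_ext => r rts.
by rewrite ffunE; case: eqP => // rt; rewrite -rt rts in tts.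
Qed.

End FiniteProduct.

Lemma bsval_mean_loss (R : realType) (m : nat) (M : lost_sales R m.+1) (V : finType)
  (p : 'I_m.+1 -> V -> R) (v : 'I_m.+1 -> V -> R)
  (p0 : forall t x, 0 <= p t x) (p1 : forall t, \sum_x p t x = 1)
  (vD : forall t x, 0 <= v t x <= dbar M) S x :
  bsval (fun t => fin_expect (p0 t) (p1 t) (vD t)) S (enum 'I_m.+1) x
  = mean_loss M p v x S.
Proof. by rewrite bsval_fin// enum_uniq. Qed.

Section Empirical.
Context (R : realType) (T : nat) (M : lost_sales R T) (n : nat)
  (w : 'I_T -> 'I_n.+1 -> R).
Hypothesis wD : forall t i, 0 <= w t i <= dbar M.

Definition unif_pmf (i : 'I_n.+1) : R := n.+1%:R^-1.

Lemma unif_pmf_ge0 i : 0 <= unif_pmf i. Proof. by rewrite invr_ge0. Qed.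

Lemma sum_unif_pmf : \sum_i unif_pmf i = 1.
Proof.
by rewrite sumr_const card_ord -[LHS]mulr_natl divff// pnatr_eq0.
Qed.

Definition emp_expect t : expect (dbar M) := fin_expect unif_pmf_ge0 sum_unif_pmf (wD t).

Lemma bsval_empirical S x :
  bsval emp_expect S (enum 'I_T) x = empirical_loss M w x S.
Proof.
rewrite bsval_fin ?enum_uniq// /empirical_loss mulr_suml.
apply: eq_bigr => f _; rewrite mulrC; congr (_ * _).
rewrite /prodw /unif_pmf prodr_const card_ffun !card_ord natrX.
by rewrite -exprVn.
Qed.

End Empirical.

(** * True laws and policies *)

(** Comes straight from the integral as a supremum over simple functions. Being free of
    measurability, it applies to the cost-to-go of an arbitrary policy, whose measurability is never
    established. *)
Lemma ge0_le_integralT d (T : measurableType d) (R : realType)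
    (mu : {measure set T -> \bar R}) (f1 f2 : T -> \bar R) :
  (forall x, 0 <= f1 x)%E -> (forall x, f1 x <= f2 x)%E ->
  (\int[mu]_x f1 x <= \int[mu]_x f2 x)%E.
Proof.
move=> f10 f12; rewrite !ge0_integralTE//; last first.
  by move=> x; exact: le_trans (f12 x).
apply: le_ereal_sup => _ [h hf1 <-]; exists h => // x.
exact: le_trans (hf1 x) (f12 x).
Qed.

Lemma probability_setI1 d (T : measurableType d) (R : realType)
    (P : probability T R) (A B : set T) :
  measurable A -> measurable B -> P B = 1%E -> P (A `&` B) = P A.
Proof.
move=> mA mB PB; have mBC := measurableC mB.
have PC : P (~` B) = 0%E by rewrite probability_setC// PB subee.
rewrite -[in RHS](setIT A) -(setvU B) setIUr setUC measureU0//;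
  [exact: measurableI|exact: measurableI|].
apply: (@subset_measure0 _ _ _ _ _ (~` B)) => //.
exact: measurableI.
Qed.

Section TrueExpect.
Context (R : realType) (D : R) (P : probability R R).
Hypothesis PD : P `[0, D]%classic = 1%E.

Let mP : {measure set R -> \bar R} := P.
Let PDm : mP `[0, D]%classic = 1%E. Proof. exact: PD. Qed.

Lemma lipschitz_measurable (f : R -> R) (A : set R) : measurable A ->
  lipschitz_fun f -> measurable_fun A f.
Proof.
move=> mA [K fK]; apply: measurable_funTS.
by apply: continuous_measurable_fun; exact: lip_continuous fK.
Qed.

Lemma lipschitz_integrable (f : R -> R) : lipschitz_fun f ->
  P.-integrable `[0, D]%classic (EFin \o f).
Proof.
move=> lf; have [K K0 fK] := lipschitz_nonneg lf.
apply: measurable_bounded_integrable => //.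
- by apply: le_lt_trans (probability_le1 P _) (ltry 1).
- exact: lipschitz_measurable.
- exists (`|f 0| + K * D); split; first exact: num_real.
  move=> B BK x /=; rewrite in_itv/= => /andP[x0 xD].
  apply: le_trans (ltW BK); rewrite -[f x](subrK (f 0)) addrC.
  apply: le_trans (ler_normD _ _) _; rewrite lerD2l.
  apply: le_trans (fK _ _) _; rewrite ler_wpM2l//.
  by rewrite subr0 ger0_norm.
Qed.

Definition true_ev (f : R -> R) : R := \int[P]_(d in `[0, D]%classic) f d.

Lemma true_evD f g : lipschitz_fun f -> lipschitz_fun g ->
  true_ev (fun d => f d + g d) = true_ev f + true_ev g.
Proof. by move=> lf lg; rewrite /true_ev RintegralD//; exact: lipschitz_integrable. Qed.

Lemma true_evZ a f : lipschitz_fun f -> true_ev (fun d => a * f d) = a * true_ev f.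
Proof. by move=> lf; rewrite /true_ev RintegralZl//; exact: lipschitz_integrable. Qed.

Lemma true_ev_cst c : true_ev (fun=> c) = c.
Proof. by rewrite /true_ev Rintegral_cst// PDm mulr1. Qed.

Lemma true_ev_le f g : lipschitz_fun f -> lipschitz_fun g ->
  (forall d, 0 <= d <= D -> f d <= g d) -> true_ev f <= true_ev g.
Proof.
by move=> lf lg fg; apply: le_Rintegral => //; exact: lipschitz_integrable.
Qed.

Definition true_expect : expect D := Expect true_evD true_evZ true_ev_cst true_ev_le.

Lemma integral_true_ev f : lipschitz_fun f -> (forall d, 0 <= f d) ->
  (\int[P]_d (f d)%:E)%E = (true_ev f)%:E.
Proof.
move=> lf f0.
have N0 : P (~` `[0, D]%classic) = 0%E by rewrite probability_setC// PD subee.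
rewrite (@ge0_negligible_integral _ _ _ P setT (~` `[0, D]%classic))//.
- rewrite setTD setCK /true_ev /Rintegral fineK//.
  by apply: integrable_fin_num => //; exact: lipschitz_integrable.
- exact: measurableC.
- by apply/measurable_EFinP; exact: lipschitz_measurable.
- by move=> x _; rewrite lee_fin.
Qed.

End TrueExpect.

Section Policies.
Context (R : realType) (T : nat) (M : lost_sales R T).

Definition law_expect (t : 'I_T) : expect (dbar M) :=
  true_expect (law_supp M t).

Lemma bsval_ge0 (E : 'I_T -> expect (dbar M)) S ts x : 0 <= bsval E S ts x.
Proof.
elim: ts x => [//|t ts IH] x; rewrite bsval_cons /qval -(ev_cst (E t) 0).
apply: ev_le; [exact: lipschitz_cst|exact: stage_lipschitz|move=> d _].
by rewrite /stage addr_ge0// cost_ge0.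
Qed.

Lemma stage_ge0 (E : 'I_T -> expect (dbar M)) S ts t y d : 0 <= stage E S ts t y d.
Proof. by rewrite /stage addr_ge0// ?cost_ge0// bsval_ge0. Qed.

Lemma integral_stage S ts t y :
  (\int[law M t]_d (stage law_expect S ts t y d)%:E)%E
  = (qval law_expect S ts t y)%:E.
Proof.
rewrite (integral_true_ev (law_supp M t))//; first exact: stage_lipschitz.
by move=> d; exact: stage_ge0.
Qed.

Lemma cost_to_go_ge0 (pi : policy R T) ts x r : (0 <= cost_to_go M pi ts x r)%E.
Proof.
elim: ts x r => [//|t ts IH] x r /=.
apply: integral_ge0 => y _; apply: integral_ge0 => d _.
by rewrite adde_ge0// lee_fin cost_ge0.
Qed.

(** The constant [v] is integrated over the feasible levels, which carry mass 1; on the other levels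
    nonnegativity of the cost suffices. The induction is over all histories [r]. *)
Lemma bellman_le_cost_to_go (pi : policy R T) S ts (x : R) r :
  bellman law_expect S ts -> 0 <= x ->
  ((bsval law_expect S ts x)%:E <= cost_to_go M pi ts x r)%E.
Proof.
elim: ts x r => [//|t ts IH] x r [b1 b2] x0.
set v := bsval _ _ _ _; have v0 : 0 <= v by exact: bsval_ge0.
have mx : measurable [set y : R | x <= y].
  by rewrite (_ : [set y | x <= y] = `[x, +oo[%classic)//; apply/seteqP; split=> y /=;
    rewrite in_itv/= andbT.
have h1 : (v%:E <= \int[decide pi t (x, r)]_(y in [set y | (x <= y)%R]) (cst v%:E y))%E.
  by rewrite integral_cst// decide_feasible// mule1.
apply: (le_trans h1).
rewrite integral_mkcond/=; apply: ge0_le_integralT => y.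
  by rewrite patchE; case: ifP; rewrite ?lee_fin.
rewrite patchE; case: ifPn => [|_]; last first.
  apply: integral_ge0 => d _.
  by rewrite adde_ge0// ?cost_to_go_ge0// lee_fin cost_ge0.
rewrite inE/= => xy; apply: (@le_trans _ _ (qval law_expect S ts t y)%:E).
  by rewrite lee_fin b1.
rewrite -integral_stage; apply: ge0_le_integralT => d.
  by rewrite lee_fin stage_ge0.
rewrite /stage EFinD leeD2l//; apply: IH => //.
by rewrite le_max lexx orbT.
Qed.

Lemma cost_to_go_base_stock S ts x r :
  cost_to_go M (base_stock S) ts x r = (bsval law_expect S ts x)%:E.
Proof.
elim: ts x r => [//|t ts IH] x r.
rewrite bsval_cons /=.
under eq_integral.
  move=> y _; under eq_integral.
    by move=> d _; rewrite IH -EFinD -/(stage _ _ _ _ _ _); over.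
  rewrite integral_stage; over.
rewrite /= integral_dirac//.
  by rewrite diracT mul1e.
apply/measurable_EFinP; apply: lipschitz_measurable => //.
by exists ((size ts).+1%:R * cost_coef M); exact: qval_near.
Qed.

Lemma opt_valueE S x : bellman law_expect S (enum 'I_T) -> 0 <= x ->
  opt_value M x = (bsval law_expect S (enum 'I_T) x)%:E.
Proof.
move=> b x0; apply/eqP; rewrite eq_le; apply/andP; split.
  apply: ereal_inf_lbound; exists (base_stock S) => //.
  by rewrite /value cost_to_go_base_stock.
apply: le_ereal_inf_tmp => _ [pi _ <-]; exact: bellman_le_cost_to_go.
Qed.

Lemma regretE S S' x : bellman law_expect S' (enum 'I_T) -> 0 <= x ->
  regret M (base_stock S) x =
  (bsval law_expect S (enum 'I_T) x - bsval law_expect S' (enum 'I_T) x)%:E.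
Proof.
by move=> b x0; rewrite /regret (opt_valueE b x0) /value cost_to_go_base_stock.
Qed.

End Policies.

(** * Discretized demands *)

Section Quantization.
Context (R : realType) (D a : R) (N : nat).
Hypothesis D0 : 0 < D.
Hypothesis aD : 0 <= a <= D.
Hypothesis N0 : (0 < N)%N.

(** Capping precedes rounding, so the grid law approximates the capped law; clipping at 0 defines
    the index on all of [R], where the laws live. *)
Let scaled (d : R) : R := Num.max (Num.min d a) 0 * (N%:R / D).

Definition quant (d : R) : 'I_N.+1 := inord (Num.truncn (scaled d)).

Definition gridv (k : 'I_N.+1) : R := k%:R * (D / N%:R).

Let NR : 0 < N%:R :> R. Proof. by rewrite ltr0n. Qed.
Let ND : 0 < N%:R / D. Proof. exact: divr_gt0. Qed.
Let DN : 0 < D / N%:R. Proof. exact: divr_gt0. Qed.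

Let scaled_ge0 d : 0 <= scaled d.
Proof. by rewrite mulr_ge0// ?(ltW ND)// le_max lexx orbT. Qed.

Let quantE d : quant d = Num.truncn (scaled d) :> nat.
Proof.
rewrite /quant inordK// ltnS -(ler_nat R).
have /andP[l _] := truncn_itv (scaled_ge0 d).
apply: le_trans l _; rewrite /scaled mulrA ler_pdivrMr// mulrC ler_pM2l//.
by case/andP: aD => a0 a1; rewrite ge_max ge_min a1 orbT (le_trans a0).
Qed.

Lemma gridv_itv k : 0 <= gridv k <= D.
Proof.
rewrite /gridv mulr_ge0 ?(ltW DN)//=.
rewrite mulrA ler_pdivrMr// mulrC ler_pM2l// ler_nat -ltnS.
exact: ltn_ord.
Qed.

Lemma quant_close d : 0 <= d -> `|gridv (quant d) - Num.min d a| <= D / N%:R.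
Proof.
move=> d0; have m0 : 0 <= Num.min d a by rewrite le_min d0; case/andP: aD.
rewrite /gridv quantE.
have /andP[] := truncn_itv (scaled_ge0 d).
rewrite /scaled max_l//; move: (Num.min d a) m0 => u u0.
move: (Num.truncn _) => k l r.
have l' : k%:R * (D / N%:R) <= u by rewrite -ler_pdivlMr// invf_div.
have r' : u <= (k%:R + 1) * (D / N%:R).
  by rewrite -ler_pdivrMr// invf_div natr1 ltW.
by rewrite ler_norml; lra.
Qed.

Lemma measurable_quant k : measurable (quant @^-1` [set k]).
Proof.
have mc (c : R) : measurable [set d | c <= scaled d].
  rewrite (_ : [set d | _] = setT `&` scaled @^-1` `[c, +oo[%classic); last first.
    by rewrite setTI; apply/seteqP; split=> d /=; rewrite in_itv/= andbT.
  have ms : measurable_fun setT scaled.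
    apply: measurable_funM => //; apply: measurable_maxr => //.
    exact: measurable_minr.
  exact: ms.
rewrite (_ : _ @^-1` _ = [set d | k%:R <= scaled d] `\` [set d | k.+1%:R <= scaled d]).
  exact: measurableD.
apply/seteqP; split=> d /=.
  move=> <-; have /andP[l r] := truncn_itv (scaled_ge0 d).
  by rewrite quantE; split=> //; apply/negP; rewrite -ltNge.
move=> [l /negP]; rewrite -ltNge => r; apply/val_inj; rewrite /= quantE.
by apply: truncn_def; rewrite l.
Qed.

Context (P : probability R R).
Hypothesis PD : P `[0, D]%classic = 1%E.

Definition qpmf (k : 'I_N.+1) : R := fine (P (quant @^-1` [set k])).

Lemma qpmf_ge0 k : 0 <= qpmf k.
Proof. by rewrite fine_ge0// measure_ge0. Qed.

Lemma qpmfE k : P (quant @^-1` [set k]) = (qpmf k)%:E.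
Proof.
by rewrite /qpmf fineK// fin_num_measure//; exact: measurable_quant.
Qed.

Lemma sum_qpmf : \sum_k qpmf k = 1.
Proof.
apply: EFin_inj; rewrite -sumEFin -(probability_setT P).
under eq_bigr do rewrite -qpmfE.
rewrite -(@measure_bigsetU_ord _ _ _ P N.+1 predT (fun k => quant @^-1` [set k])).
- congr (P _); apply/seteqP; split=> // d _.
  by rewrite (bigD1 (quant d))//=; left.
- exact: measurable_quant.
- by move=> i j _ _ [d [/= <- <-]].
Qed.

Let P_quantI k : P (quant @^-1` [set k] `&` `[0, D]%classic) = (qpmf k)%:E.
Proof.
rewrite -qpmfE; apply: probability_setI1 => //; exact: measurable_quant.
Qed.

(** A coupling: rounding moves the capped demand by at most one grid step. Once the grid mean is the
    integral of the step function [g], the bound is pointwise. *)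
Lemma qpmf_close (K : R) (f : R -> R) : 0 <= K -> lip K f ->
  `|cap_ev (true_expect PD) a f - \sum_k qpmf k * f (gridv k)| <= K * (D / N%:R).
Proof.
move=> K0 fK.
have lf : lipschitz_fun (fun d => f (Num.min d a)) by apply: lipschitz_min; exists K.
have mI : measurable (`[0, D]%classic : set R) by [].
pose g (d : R) := \sum_k f (gridv k) * \1_(quant @^-1` [set k]) d.
have gE d : g d = f (gridv (quant d)).
  rewrite /g (bigD1 (quant d))//= indicE mem_set// mulr1 big1 ?addr0// => k kq.
  by rewrite indicE memNset ?mulr0//= => /esym/eqP; rewrite (negPf kq).
have ig k : P.-integrable `[0, D]%classic
    (fun d => (f (gridv k) * \1_(quant @^-1` [set k]) d)%:E).
  have i1 : P.-integrable `[0, D]%classic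
      (fun d => (\1_(quant @^-1` [set k]) d : R)%:E).
    apply: (@integrableS _ _ _ P setT) => //.
    by apply: integrable_indic; exact: measurable_quant.
  exact: (integrableZl mI (f (gridv k)) i1).
have igg : P.-integrable `[0, D]%classic (EFin \o g).
  rewrite (_ : EFin \o g = fun d => (\sum_k (f (gridv k) * \1_(quant @^-1` [set k]) d)%:E)%E).
    by apply: integrable_sum => // k _; exact: ig.
  by apply/funext => d /=; rewrite sumEFin.
have intg : \int[P]_(d in `[0, D]%classic) g d = \sum_k qpmf k * f (gridv k).
  apply: EFin_inj; rewrite /Rintegral fineK; last exact: integrable_fin_num.
  under eq_integral do rewrite /g -sumEFin.
  rewrite integral_sum// -sumEFin; apply: eq_bigr => k _.
  under eq_integral do rewrite EFinM.
  rewrite integralZl//; last first.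
    apply: (@integrableS _ _ _ P setT) => //.
    by apply: integrable_indic; exact: measurable_quant.
  rewrite integral_indic//; last exact: measurable_quant.
  have PI : (P : {measure set R -> \bar R}) (quant @^-1` [set k] `&` `[0, D]%classic)
    = (qpmf k)%:E := P_quantI k.
  by rewrite PI -EFinM mulrC.
rewrite -intg /cap_ev /= /true_ev -RintegralB//; last exact: lipschitz_integrable.
have ifg : P.-integrable `[0, D]%classic (EFin \o (fun d => f (Num.min d a) - g d)).
  rewrite (_ : _ \o _ = (EFin \o (fun d => f (Num.min d a))) \- (EFin \o g))%E//.
  by apply: integrableB => //; exact: lipschitz_integrable.
apply: le_trans (le_normr_Rintegral _ ifg) _ => //.
have -> : K * (D / N%:R) = \int[P]_(d in `[0, D]%classic) (K * (D / N%:R)).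
  by rewrite Rintegral_cst// (_ : fine _ = 1) ?mulr1//; have := congr1 fine PD.
apply: le_Rintegral => //.
- exact: integrable_norm.
- have lc := lipschitz_cst (K * (D / N%:R)); exact: (lipschitz_integrable D P lc).
- move=> d /=; rewrite in_itv/= => /andP[d0 _].
  rewrite gE; apply: le_trans (fK _ _) _; rewrite ler_wpM2l// distrC.
  exact: quant_close.
Qed.

End Quantization.

(** * Finite events of independent observations *)

Section FiniteEvents.
Context (R : realType) (d : measure_display) (Omega : measurableType d)
  (Pr : probability Omega R).

Lemma probability_le_sum (V : finType) (B : pred V) (F : V -> set Omega)
    (A N : set Omega) :
  measurable A -> measurable N -> Pr N = 0%E -> (forall v, measurable (F v)) ->
  (forall w, A w -> N w \/ exists2 v, B v & F v w) ->
  (Pr A <= \sum_(v | B v) Pr (F v))%E.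
Proof.
move=> mA mN N0 mF AF.
have mU : measurable (\big[setU/set0]_(v | B v) F v) by apply: bigsetU_measurable.
apply: (@le_trans _ _ (Pr (N `|` \big[setU/set0]_(v | B v) F v))).
  apply: le_measure; rewrite ?inE//; first exact: measurableU.
  move=> w /AF[Nw|[v Bv Fv]]; [by left|right].
  by rewrite (bigD1 v)//=; left.
have := measureU2 Pr mN mU; rewrite [X in (_ <= X + _)%E]N0 add0e => /le_trans; apply.
suff [_ //] : measurable (\big[setU/set0]_(v | B v) F v) /\
  (Pr (\big[setU/set0]_(v | B v) F v) <= \sum_(v | B v) Pr (F v))%E.
elim/big_rec2 : _ => [|v x S _ [mS Sx]].
  by split=> //; rewrite measure0.
split; first exact: measurableU.
by have := measureU2 Pr (mF v) mS => /le_trans; apply; rewrite leeD2l.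
Qed.

Lemma mutually_independent_inj (I J : finType) (X : I -> Omega -> R) (e : J -> I) :
  injective e -> mutually_independent Pr X ->
  mutually_independent Pr (fun j => X (e j)).
Proof.
move=> ei Xi K A mA.
pose A' i := if [pick j | e j == i] is Some j then A j else setT.
have A'e j : A' (e j) = A j.
  rewrite /A'; case: pickP => [k /eqP/ei -> //|/(_ j)]; by rewrite eqxx.
have mA' i : measurable (A' i) by rewrite /A'; case: pickP.
have := Xi (e @: K)%SET A' mA'; rewrite big_imset/=; last by move=> ? ? _ _ /ei.
under [X in _ = X -> _]eq_bigr do rewrite A'e.
move=> <-; congr (Pr _); apply/seteqP; split=> w Hw i /=.
  by move=> /imsetP[j jK ->]; rewrite A'e; exact: Hw.
by move=> iK; rewrite -A'e; apply: Hw; rewrite /= imset_f.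
Qed.

(** The passage from [Pr] to finite product weights. The null set [N] leaves room for demands
    outside the support. *)
Lemma quantized_probability_le (I V : finType) (X : I -> {RV Pr >-> R})
    (q : I -> R -> V) (p : I -> V -> R) (B : pred {ffun I -> V}) (A N : set Omega) :
  mutually_independent Pr (fun i => X i : Omega -> R) ->
  (forall i k, measurable (q i @^-1` [set k])) ->
  (forall i k, Pr (X i @^-1` (q i @^-1` [set k])) = (p i k)%:E) ->
  measurable A -> measurable N -> Pr N = 0%E ->
  (forall w, A w -> N w \/ B [ffun i => q i (X i w)]) ->
  (Pr A <= (\sum_(v | B v) prodw p v)%:E)%E.
Proof.
move=> Xi mq pE mA mN N0 AB.
pose F (v : {ffun I -> V}) :=
  \bigcap_(i in [set` [set: I]%SET]) (X i @^-1` (q i @^-1` [set v i])).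
have mF v : measurable (F v).
  apply: fin_bigcap_measurable => // i _.
  by rewrite -[X in measurable X]setTI; exact: (measurable_funPT (X i)).
have PF v : Pr (F v) = (prodw p v)%:E.
  rewrite /F (Xi [set: I]%SET (fun i => q i @^-1` [set v i]))// /prodw -prodEFin.
  by apply: eq_big => [i|i _]; rewrite ?inE ?pE.
apply: le_trans (probability_le_sum mA mN N0 mF _) _; last first.
  by rewrite -sumEFin; under eq_bigr do rewrite PF.
move=> w /AB[Nw|Bw]; [by left|right].
by exists [ffun i => q i (X i w)] => // i _ /=; rewrite ffunE.
Qed.

End FiniteEvents.

(** Chernoff's bound at [l = 4 * z], the minimizer of l^2 / 8 - l z, with minimum - 2 z^2 per
    observation. *)
Lemma bernoulli_tail (R : realType) (I : finType) (f z : R) :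
  0 <= f <= 1 -> 0 <= z ->
  \sum_(v : {ffun I -> bool} | #|I|%:R * (f + z) <= \sum_i (v i)%:R)
    prodw (fun (_ : I) (b : bool) => if b then f else 1 - f) v
  <= expR (- (2 * #|I|%:R * z ^+ 2)).
Proof.
move=> /andP[f0 f1] z0.
pose p (b : bool) : R := if b then f else 1 - f.
have p0 b : 0 <= p b by rewrite /p; case: b => //; rewrite subr_ge0.
pose l := 4 * z.
have l0 : 0 <= l by rewrite mulr_ge0.
apply: (@le_trans _ _ (\sum_(v : {ffun I -> bool})
    expR (- (l * (#|I|%:R * (f + z)))) * (prodw (fun=> p) v * expR (l * \sum_i (v i)%:R)))).
  rewrite big_mkcond/=; apply: ler_sum => v _.
  have w0 : 0 <= prodw (fun=> p) v by apply: prodw_ge0.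
  case: ifPn => [vz|_]; last by rewrite !mulr_ge0 ?expR_ge0.
  rewrite mulrCA -expRD ler_peMr// -[X in X <= _]expR0 ler_expR addrC subr_ge0.
  by rewrite ler_wpM2l.
rewrite -mulr_sumr.
have -> : \sum_(v : {ffun I -> bool}) prodw (fun=> p) v * expR (l * \sum_i (v i)%:R)
    = (1 - f + f * expR l) ^+ #|I|.
  under eq_bigr do rewrite mulr_sumr expR_sum -big_split/=.
  rewrite -(bigA_distr_bigA (fun (_ : I) (b : bool) => p b * expR (l * b%:R)))/=.
  rewrite -prodr_const; apply: eq_bigr => i _; rewrite big_bool/= mulr1 mulr0 expR0.
  by rewrite mulr1 addrC.
have f01 : 0 <= f <= 1 by rewrite f0.
apply: (@le_trans _ _ (expR (- (l * (#|I|%:R * (f + z))))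
    * expR (#|I|%:R * (f * l + l ^+ 2 / 8)))).
  apply: ler_wpM2l; first exact: expR_ge0.
  have m0 : 0 <= 1 - f + f * expR l.
    by rewrite addr_ge0 ?subr_ge0// mulr_ge0// expR_ge0.
  by rewrite expRM_natl; apply: lerXn2r; rewrite ?nnegrE ?expR_ge0//; exact: bernoulli_mgf.
rewrite -expRD ler_expR /l le_eqVlt; apply/orP; left; by apply/eqP; field.
Qed.

Section HoeffdingCount.
Context (R : realType) (d : measure_display) (Omega : measurableType d)
  (Pr : probability Omega R) (I : finType) (X : I -> {RV Pr >-> R})
  (A : set R) (f : R).
Hypothesis Xi : mutually_independent Pr (fun i => X i : Omega -> R).
Hypothesis mA : measurable A.
Hypothesis XA : forall i, Pr (X i @^-1` A) = f%:E.

Lemma hoeffding_count_ge (z : R) (E : set Omega) : 0 <= f <= 1 -> 0 <= z ->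
  measurable E ->
  (forall w, E w -> #|I|%:R * (f + z) <= \sum_i \1_A (X i w)) ->
  (Pr E <= (expR (- (2 * #|I|%:R * z ^+ 2)))%:E)%E.
Proof.
move=> f01 z0 mE EX.
pose q (_ : I) (x : R) : bool := x \in A.
have qE b i : q i @^-1` [set b] = if b then A else ~` A.
  apply/seteqP; split=> x /=; rewrite /q; case: b.
  - by move/set_mem.
  - by move=> xA /mem_set; rewrite xA.
  - by move/mem_set.
  - by move=> nA; apply/negP => /set_mem.
pose p (_ : I) (b : bool) : R := if b then f else 1 - f.
have pE i b : Pr (X i @^-1` (q i @^-1` [set b])) = (p i b)%:E.
  rewrite qE /p; case: b; first exact: XA.
  rewrite preimage_setC probability_setC; last first.
    by rewrite -[X in measurable X]setTI; exact: (measurable_funPT (X i)).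
  by rewrite [X in (_ - X)%E]XA.
have mq i b : measurable (q i @^-1` [set b]).
  by rewrite qE; case: b => //; exact: measurableC.
pose B (v : {ffun I -> bool}) := #|I|%:R * (f + z) <= \sum_i (v i)%:R.
have EB w : E w -> (@set0 Omega) w \/ B [ffun i => q i (X i w)].
  move=> Ew; right; apply: le_trans (EX w Ew) _.
  by apply: ler_sum => i _; rewrite ffunE indicE /q.
apply: le_trans (quantized_probability_le Xi mq pE mE measurable0 (measure0 Pr) EB) _.
by rewrite lee_fin; exact: bernoulli_tail.
Qed.

End HoeffdingCount.

Lemma hoeffding_count_le (R : realType) (d : measure_display)
    (Omega : measurableType d) (Pr : probability Omega R) (I : finType)
    (X : I -> {RV Pr >-> R}) (A : set R) (f z : R) (E : set Omega) :
  mutually_independent Pr (fun i => X i : Omega -> R) -> measurable A ->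
  (forall i, Pr (X i @^-1` A) = f%:E) -> 0 <= f <= 1 -> 0 <= z -> measurable E ->
  (forall w, E w -> \sum_i \1_A (X i w) <= #|I|%:R * (f - z)) ->
  (Pr E <= (expR (- (2 * #|I|%:R * z ^+ 2)))%:E)%E.
Proof.
move=> Xi mA XA f01 z0 mE EX.
apply: (@hoeffding_count_ge _ _ _ _ _ X (~` A) (1 - f)) => //.
- exact: measurableC.
- move=> i; rewrite preimage_setC probability_setC ?XA//.
  by rewrite -[X in measurable X]setTI; exact: (measurable_funPT (X i)).
- by lra.
- move=> w /EX h.
  have -> : \sum_i \1_(~` A) (X i w) = #|I|%:R - \sum_i \1_A (X i w) :> R.
    have -> : #|I|%:R = \sum_(i : I) 1 :> R by rewrite sumr_const.
    rewrite -sumrB; apply: eq_bigr => i _; rewrite !indicE in_setC.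
    by case: (_ \in _); rewrite ?subrr ?subr0.
  lra.
Qed.

(** * Caps, coverage and measurability *)

Section Caps.
Context (R : realType) (T : nat) (lam : 'I_T -> R).

Lemma cap_le (t : 'I_T) : cap lam t <= lam t.
Proof. exact: bigmin_le_cond. Qed.

Lemma cap_ge0 (t : 'I_T) : (forall s, 0 <= lam s) -> 0 <= cap lam t.
Proof. by move=> l0; apply: le_bigmin. Qed.

Lemma cap_ndecr (s t : 'I_T) : (s <= t)%N -> cap lam s <= cap lam t.
Proof.
move=> st; apply: le_bigmin => [|r tr]; apply: bigmin_le_cond => //.
exact: leq_trans tr.
Qed.

Lemma sorted_cap : sorted (fun s t => cap lam s <= cap lam t) (enum 'I_T).
Proof.
apply: (@sub_sorted _ (relpre val leq)); first by move=> s t; exact: cap_ndecr.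
by rewrite -sorted_map val_enum_ord iota_sorted.
Qed.

End Caps.

Section Coverage.
Context (R : realType) (T : nat) (M : lost_sales R T).

(** A newsvendor subgradient: pointwise, c(y) - c(a) >= (y - a) ((h + p) 1[d < a] - p), and the mean
    of the right-hand side is (y - a) ((h + p) F^-(a) - p), nonnegative under coverage. *)
Lemma law_cover t (a y : R) : crit_ratio M t <= Fminus M t a -> a <= y ->
  law_expect M t (cost M t a) <= law_expect M t (cost M t y).
Proof.
move=> cov ay; have mI : measurable (`[0, dbar M]%classic : set R) by [].
set h := hold M t; set p := short M t.
have h0 : 0 < h by exact: hold_gt0.
have p0 : 0 < p by exact: short_gt0.
pose A : set R := [set d | d < a].
have mA : measurable A.
  by rewrite (_ : A = `]-oo, a[%classic)//; apply/seteqP; split=> d /=; rewrite in_itv.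
have iA : (law M t).-integrable `[0, dbar M]%classic (EFin \o (\1_A : R -> R)).
  by apply: (@integrableS _ _ _ _ setT) => //; exact: integrable_indic.
have iL (f : R -> R) : lipschitz_fun f ->
    (law M t).-integrable `[0, dbar M]%classic (EFin \o f).
  exact: lipschitz_integrable.
have intA : \int[law M t]_(d in `[0, dbar M]%classic) (\1_A d : R) = Fminus M t a.
  rewrite /Rintegral integral_indic// /Fminus; congr fine.
  exact: (probability_setI1 mA mI (law_supp M t)).
pose c : R := (y - a) * (h + p).
have icA : (law M t).-integrable `[0, dbar M]%classic (EFin \o (fun d => c * \1_A d)).
  exact: (integrableZl mI c iA).
have ic : (law M t).-integrable `[0, dbar M]%classic
    (EFin \o (fun d => c * \1_A d - (y - a) * p)).
  rewrite (_ : _ \o _ = ((fun d => c%:E * (\1_A d)%:E) \- (EFin \o (fun=> ((y - a) * p)%R)))%E)//.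
  apply: integrableB => //.
  by apply: iL; exact: lipschitz_cst.
have lc z := cost_lipschitz M t z.
rewrite -subr_ge0 /= /true_ev -RintegralB//; try exact: iL.
apply: (@le_trans _ _ (\int[law M t]_(d in `[0, dbar M]%classic)
    (c * \1_A d - (y - a) * p))).
  rewrite RintegralB//; last by apply: iL; exact: lipschitz_cst.
  rewrite RintegralZl// intA Rintegral_cst//.
  have -> : fine (law M t `[0, dbar M]%classic) = 1 by rewrite law_supp.
  have : 0 <= y - a by rewrite subr_ge0.
  move: cov; rewrite /crit_ratio ler_pdivrMr ?addr_gt0// => cov ya.
  have := ler_wpM2l ya cov; rewrite /c -/h -/p; lra.
apply: le_Rintegral => //.
  rewrite (_ : _ \o _ = ((EFin \o cost M t y) \- (EFin \o cost M t a))%E)//.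
  by apply: integrableB => //; exact: iL.
move=> d _; rewrite /c indicE /cost -/h -/p.
have [dA|dA] := boolP (d \in A).
  have da : d < a by move/set_mem: dA.
  have dy : d <= y by apply: ltW; exact: lt_le_trans ay.
  have -> : Num.max (y - d) 0 = y - d by apply: max_l; rewrite subr_ge0.
  have -> : Num.max (a - d) 0 = a - d by apply: max_l; rewrite subr_ge0 ltW.
  have -> : Num.max (d - y) 0 = 0 by apply: max_r; rewrite subr_le0.
  have -> : Num.max (d - a) 0 = 0 by apply: max_r; rewrite subr_le0 ltW.
  by rewrite mulr1; lra.
have ad : a <= d by rewrite leNgt; apply/negP => da; move/negP: dA; apply; exact: mem_set.
rewrite mulr0 sub0r.
have hy : 0 <= h * Num.max (y - d) 0.
  by rewrite mulr_ge0 ?(ltW h0)// le_max lexx orbT.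
have -> : Num.max (a - d) 0 = 0 by apply: max_r; rewrite subr_le0.
have -> : Num.max (d - a) 0 = d - a by apply: max_l; rewrite subr_ge0.
have : p * (d - y) <= p * Num.max (d - y) 0.
  by rewrite ler_wpM2l ?(ltW p0)// le_max lexx.
lra.
Qed.

End Coverage.

(** Lets base-stock levels meet the constraint of Product ERM on the first period without a change
    of cost. *)
Lemma bsval_raise (R : realType) (T : nat) (M : lost_sales R T)
    (E : 'I_T -> expect (dbar M)) S t ts (x : R) : t \notin ts ->
  bsval E (fun s => if s == t then Num.max x (S s) else S s) (t :: ts) x
  = bsval E S (t :: ts) x.
Proof.
move=> tts /=; rewrite eqxx maxA maxxx; congr (E t _); apply/funext => d.
congr (_ + _); apply: bsval_ext => s sts; case: eqP => // st.
by rewrite -st sts in tts.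
Qed.

(** The superlevel set is a countable union over rational level vectors near [S w] at which [g]
    exceeds [c] by the Lipschitz margin. Only coordinatewise measurability of [S] enters. *)
Lemma measurable_lipschitz_levels (R : realType) (d : measure_display)
    (Omega : measurableType d) (T : nat) (g : ('I_T -> R) -> R) (K : R)
    (S : Omega -> 'I_T -> R) (c : R) :
  0 <= K ->
  (forall S S' e, (forall t, `|S t - S' t| <= e) -> 0 <= e -> `|g S - g S'| <= K * e) ->
  (forall t, measurable_fun setT (S ^~ t)) ->
  measurable [set w | c < g (S w)].
Proof.
move=> K0 gK mS.
pose q (r : {ffun 'I_T -> rat}) (t : 'I_T) : R := ratr (r t).
pose F (rk : {ffun 'I_T -> rat} * nat) : set Omega :=
  if c + K / rk.2.+1%:R < g (q rk.1)
  then \bigcap_(t in [set: 'I_T]) [set w | `|S w t - q rk.1 t| < rk.2.+1%:R^-1]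
  else set0.
rewrite (_ : [set w | _] = \bigcup_rk F rk).
  apply: countable_bigcupT_measurable => [|[r k]].
    exact: countableP.
  rewrite /F; case: ifP => // _; apply: fin_bigcap_measurable => // t _.
  rewrite (_ : [set w | _] = setT `&` (S ^~ t) @^-1`
      `](q r t - k.+1%:R^-1), (q r t + k.+1%:R^-1)[%classic); last first.
    rewrite setTI; apply/seteqP; split=> w /=; rewrite in_itv/= ltr_norml.
      by move: (k.+1%:R^-1) => e /andP[? ?]; apply/andP; split; lra.
    by move: (k.+1%:R^-1) => e /andP[? ?]; apply/andP; split; lra.
  exact: mS.
apply/seteqP; split=> w /=.
  move=> cg; pose e := g (S w) - c; have e0 : 0 < e by rewrite subr_gt0.
  (* The margin K / (k + 1) is spent twice: in passing to the rational vector and in the condition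
     that defines [F]. *)
  have [k kP] : exists k : nat, 2 * K / e < k.+1%:R.
    exists (Num.truncn (2 * K / e)).
    have x0 : 0 <= 2 * K / e by rewrite divr_ge0 ?mulr_ge0// ltW.
    by have /andP[] := truncn_itv x0.
  have k0 : 0 < k.+1%:R^-1 :> R by rewrite invr_gt0.
  have dens t : exists r : rat, `|S w t - ratr r| < k.+1%:R^-1.
    have lt : S w t - k.+1%:R^-1 < S w t + k.+1%:R^-1 by move: (k.+1%:R^-1) k0 => u u0; lra.
    have [r] := rat_in_itvoo lt; rewrite in_itv/= => rP.
    exists r; move/andP: rP => [+ +]; rewrite ltr_norml.
    by move: (k.+1%:R^-1) => u ? ?; apply/andP; split; lra.
  have [r rP] := boolp.choice dens.
  exists (finfun r, k) => //; rewrite /F/=.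
  have near t : `|S w t - q (finfun r) t| < k.+1%:R^-1 by rewrite /q ffunE.
  have := gK (S w) (q (finfun r)) k.+1%:R^-1 (fun t => ltW (near t)) (ltW k0).
  have : 2 * (K / k.+1%:R) < e.
    by rewrite mulrA ltr_pdivrMr ?ltr0n// -ltr_pdivrMl// mulrC.
  rewrite ler_norml => h1 /andP[h2 h3].
  case: ifP => [_ t _|/negP[]]; first exact: near.
  by move: h1 h2 h3; rewrite /e; move: (K / k.+1%:R) => u; lra.
move=> [[r k] _]; rewrite /F/=; case: ifP => // cq wq.
have k0 : 0 <= k.+1%:R^-1 :> R by rewrite invr_ge0.
have := gK (S w) (q r) k.+1%:R^-1 (fun t => ltW (wq t I)) k0.
by rewrite ler_norml => /andP[h2 _]; move: cq h2; move: (K / k.+1%:R) => u; lra.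
Qed.

(** * Regret of the empirical minimizer *)

Lemma empirical_loss_near (R : realType) (T n : nat) (M : lost_sales R T)
    (w w' : 'I_T -> 'I_n -> R) (x eta : R) S :
  (0 < n)%N -> (forall t i, 0 <= w t i <= dbar M) ->
  (forall t i, 0 <= w' t i <= dbar M) -> 0 <= eta ->
  (forall t i, `|w t i - w' t i| <= eta) ->
  `|empirical_loss M w x S - empirical_loss M w' x S|
    <= T%:R ^+ 2 * cost_coef M * eta.
Proof.
case: n w w' => // n w w' _ wD wD' eta0 ww'.
have sz : T%:R = (size (enum 'I_T))%:R :> R by rewrite size_enum_ord.
rewrite -(bsval_empirical wD) -(bsval_empirical wD') sz.
apply: bsval_close => // t K f K0 fK.
rewrite /= /fin_ev -sumrB.
apply: le_trans (ler_norm_sum _ _ _) _.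
apply: (@le_trans _ _ (\sum_(i < n.+1) unif_pmf R i * (K * eta))).
  apply: ler_sum => i _; rewrite -mulrBr normrM ger0_norm ?unif_pmf_ge0//.
  rewrite ler_wpM2l ?unif_pmf_ge0//; apply: le_trans (fK _ _) _.
  by rewrite ler_wpM2l.
by rewrite -mulr_suml sum_unif_pmf mul1r.
Qed.

Section RegretTail.
Context (R : realType) (m : nat) (M : lost_sales R m.+1)
  (d : measure_display) (Omega : measurableType d) (Pr : probability Omega R)
  (L : sales_logs M Pr) (lam : 'I_m.+1 -> R) (hT : (0 < m.+1)%N)
  (eps x1 : R) (n : nat) (F : fitted L lam hT x1 n).
Let D := dbar M.
Let C := cost_coef M.
Let a := cap lam.
Let T := m.+1.
Hypothesis lamD : forall t, 0 <= lam t <= D.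
Hypothesis cov : forall t, crit_ratio M t <= Fminus M t (a t).
Hypothesis eps0 : 0 < eps.
Hypothesis x1a : 0 <= x1 <= a (period1 hT).
Hypothesis n0 : (0 < n)%N.

Let aD t : 0 <= a t <= D.
Proof.
rewrite cap_ge0 => [|s]; last by case/andP: (lamD s).
by apply: le_trans (cap_le _ _) _; case/andP: (lamD t).
Qed.

Let period1E : period1 hT = ord0. Proof. exact/val_inj. Qed.

Let enumE : enum 'I_m.+1 = ord0 :: [seq lift ord0 i | i <- enum 'I_m].
Proof. exact: enum_ordSl. Qed.

Let ord0_notin : ord0 \notin [seq lift ord0 i | i <- enum 'I_m].
Proof. by apply/mapP => -[i _ /eqP]; rewrite eq_liftF. Qed.

Let raise (S : 'I_m.+1 -> R) s := if s == ord0 then Num.max x1 (S s) else S s.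

Let bsval_raise0 (E : 'I_m.+1 -> expect D) S :
  bsval E (raise S) (enum 'I_m.+1) x1 = bsval E S (enum 'I_m.+1) x1.
Proof. by rewrite enumE; exact: bsval_raise. Qed.

Let raise_itv S : (forall t, 0 <= S t <= a t) -> forall t, 0 <= raise S t <= a t.
Proof.
move=> Sa t; rewrite /raise; case: eqP => [->|_]; last exact: Sa.
have /andP[S0 S1] := Sa ord0; have /andP[x0 xa] := x1a.
by rewrite le_max x0 ge_max S1 -period1E xa.
Qed.

Let raise_feasible S : (forall t, 0 <= S t <= a t) -> erm_feasible M hT x1 (raise S).
Proof.
move=> Sa; split=> [t|].
  have /andP[-> r1] := raise_itv Sa t; have /andP[_ r2] := aD t.
  exact: le_trans r1 r2.
by rewrite period1E /raise eqxx le_max lexx.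
Qed.

Let E := law_expect M.

Let Ecap t : expect D := cap_expect (E t) (aD t).

Lemma exists_optimal : exists S, [/\ forall t, 0 <= S t <= a t,
  erm_feasible M hT x1 S &
  forall S', regret M (base_stock S') x1 =
    (bsval E S' (enum 'I_m.+1) x1 - bsval E S (enum 'I_m.+1) x1)%:E].
Proof.
have [S [Sa bS _]] := @exists_bellman R T M E a aD
  (fun t y => law_cover (cov t)) (enum 'I_m.+1) (enum_uniq _).
exists (raise S); split=> //; [exact: raise_itv|exact: raise_feasible|].
move=> S'; rewrite bsval_raise0; apply: regretE => //.
by case/andP: x1a.
Qed.

Section EmpiricalErm.
Variable w : 'I_m.+1 -> 'I_n -> R.
Hypothesis wa : forall t i, 0 <= w t i <= a t.

(** Otherwise optimal levels for the empirical laws, raised to [x1] in the first period, would be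
    feasible and better by the positive amount of [bellman_gap]. The argument applies to every
    minimizer, however ties are broken. *)
Lemma erm_le_cap S : product_erm M hT w x1 S -> forall t, S t <= a t.
Proof.
case: n n0 w wa => // n' _ w' wa'.
have wD t i : 0 <= w' t i <= D.
  have /andP[-> w1] := wa' t i; have /andP[_ w2] := aD t.
  exact: le_trans w1 w2.
move=> [Sf Smin] t; rewrite leNgt; apply/negP => aS.
pose Ee t := emp_expect wD t.
have strict t' y : a t' <= y ->
    Ee t' (cost M t' (a t')) + hold M t' * (y - a t') <= Ee t' (cost M t' y).
  move=> ay; rewrite -evDc; last exact: cost_lipschitz.
  apply: ler_sum => i _; rewrite ler_wpM2l ?unif_pmf_ge0//.
  have /andP[_ wi] := wa' t' i; rewrite /cost.
  rewrite [Num.max (w' t' i - a t') 0]max_r ?subr_le0//.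
  rewrite [Num.max (w' t' i - y) 0]max_r ?subr_le0 ?(le_trans wi)//.
  rewrite [Num.max (a t' - w' t' i) 0]max_l ?subr_ge0//.
  rewrite [Num.max (y - w' t' i) 0]max_l ?subr_ge0 ?(le_trans wi)//.
  by rewrite !mulr0; lra.
have cover t' y : a t' <= y -> Ee t' (cost M t' (a t')) <= Ee t' (cost M t' y).
  move=> ay; apply: le_trans (strict t' y ay); rewrite lerDl mulr_ge0 ?subr_ge0//.
  by rewrite ltW ?hold_gt0.
have [Se [Sa bS _]] := @exists_bellman R T M Ee a aD cover (enum 'I_m.+1) (enum_uniq _).
have [g g0 gP] := bellman_gap aD strict bS (sorted_cap lam) (mem_enum _ t) aS.
have := gP x1; case/andP: x1a => x0 xa.
have -> : head t (enum 'I_m.+1) = period1 hT by rewrite enumE period1E.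
move=> /(_ x0 xa).
have := Smin _ (raise_feasible Sa).
rewrite -!(bsval_empirical wD) bsval_raise0 => h1 h2.
by move: g0; rewrite ltNge => /negP; apply; lra.
Qed.

End EmpiricalErm.

Let X (q : 'I_m.+1 * 'I_n) : {RV Pr >-> R} := latent (sel F q.1 q.2).

Let X_indep : mutually_independent Pr (fun q => X q : Omega -> R).
Proof.
pose e (q : 'I_m.+1 * 'I_n) : {t : 'I_m.+1 & 'I_(nlogs L t)} :=
  Tagged (fun t => 'I_(nlogs L t)) (sel F q.1 q.2).
have ei : injective e.
  move=> [t i] [t' i'] /= ee.
  have tt' : t = t' := congr1 tag ee.
  move: i' ee; rewrite -tt' => i' /eqP; rewrite /e eq_Tagged /= => /eqP se.
  by rewrite (sel_inj se).
exact: (mutually_independent_inj ei (@latent_indep _ _ _ _ _ _ L)).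
Qed.

(** Fitted and optimal levels both lie below the caps, so [lost_cap] cancels in the regret. A regret
    above eps then forces a deviation above eps/4, upward at the fitted levels or downward at the
    optimal ones; hence the factor 2. *)
Lemma regret_tail (A : set Omega) : measurable A ->
  (forall w, A w -> (eps%:E < regret M (base_stock (levels F w)) x1)%E) ->
  (Pr A <= (2 * expR (60 - n%:R * (eps / 4) ^+ 2
      / (688 * 100 * (T%:R * (C * D)) ^+ 2)))%:E)%E.
Proof.
move=> mA Aeps.
have D0 : 0 < D by exact: dbar_gt0.
have C0 : 0 < C by exact: cost_coef_gt0.
have [Ss [Ssa Ssf regE]] := exists_optimal.
(* Four rounding errors T^2 C eta occur, for the mean and the empirical loss at either level vector.
   This [N] keeps their sum below eps/2, which leaves eps/2 for the two gaps. *)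
pose N := (Num.truncn (8 * (T%:R ^+ 2 * C * D) / eps)).+1.
have N0 : (0 < N)%N by [].
pose eta := D / N%:R.
have eta0 : 0 < eta by rewrite divr_gt0// ltr0n.
have etaP : 4 * (T%:R ^+ 2 * C * eta) < eps / 2.
  have y0 : 0 <= 8 * (T%:R ^+ 2 * C * D) / eps.
    apply: divr_ge0 (ltW eps0); apply: mulr_ge0 => //.
    by apply: mulr_ge0 (ltW D0); apply: mulr_ge0 (ltW C0); exact: sqr_ge0.
  have /andP[_] := truncn_itv y0; rewrite -/N ltr_pdivrMr// => h.
  have NR : 0 < N%:R :> R by rewrite ltr0n.
  have -> : 4 * (T%:R ^+ 2 * C * eta) = 4 * (T%:R ^+ 2 * C * D) / N%:R.
    by rewrite /eta; field; rewrite gt_eqF.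
  by rewrite ltr_pdivrMr//; lra.
pose q (i : 'I_m.+1 * 'I_n) := @quant R D (a i.1) N.
pose p t := @qpmf R D (a t) N (law M t).
pose V := 'I_N.+1.
pose val_ (t : 'I_m.+1) := @gridv R D N.
have valD t x : 0 <= val_ t x <= D by exact: gridv_itv.
have p0 t x : 0 <= p t x by exact: qpmf_ge0.
have p1 t : \sum_x p t x = 1 by exact: sum_qpmf.
have xD : 0 <= x1 <= D.
  by case/andP: x1a => -> /le_trans; apply; case/andP: (aD (period1 hT)).
pose gap (v : {ffun 'I_m.+1 * 'I_n -> V}) S := emp_gap M p val_ x1 v S.
pose bad b (v : {ffun 'I_m.+1 * 'I_n -> V}) := `[< exists2 S : 'I_m.+1 -> R,
  (forall t, 0 <= S t <= D) & eps / 4 < (-1) ^+ b * gap v S >].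
(* Off this event all selected demands lie in [[0, D]], as the pointwise use of [erm_le_cap] and
   [quant_close] requires. *)
pose Nul : set Omega := ~` \bigcap_(i in [set: 'I_m.+1 * 'I_n])
  (X i @^-1` `[0, D]%classic).
have mX i (B : set R) : measurable B -> measurable (X i @^-1` B).
  by move=> mB; rewrite -[X in measurable X]setTI; exact: (measurable_funPT (X i)).
have mNul : measurable Nul.
  by apply: measurableC; apply: fin_bigcap_measurable => // i _; exact: mX.
have XP i (B : set R) : measurable B -> Pr (X i @^-1` B) = law M i.1 B.
  by move=> mB; rewrite -(latent_law (sel F i.1 i.2) mB).
have Nul0 : Pr Nul = 0%E.
  apply/eqP; rewrite eq_le measure_ge0 andbT.
  have mF (i : 'I_m.+1 * 'I_n) : measurable (~` (X i @^-1` `[0, D]%classic)).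
    by apply: measurableC; exact: mX.
  apply: le_trans (probability_le_sum (B := predT)
    (F := fun i => ~` (X i @^-1` `[0, D]%classic)) mNul measurable0 (measure0 Pr) mF _) _.
    move=> w; rewrite /Nul setC_bigcap => -[i _ iw]; right; by exists i.
  rewrite big1// => i _; rewrite probability_setC; last exact: mX.
  have -> : Pr (X i @^-1` `[0, D]%classic) = 1%E by rewrite XP// law_supp.
  by rewrite subee.
apply: le_trans (quantized_probability_le (X := X) (q := q) (p := fun i => p i.1)
  (B := fun v => bad false v || bad true v) X_indep _ _ mA mNul Nul0 _) _.
- by move=> i k; exact: measurable_quant.
- by move=> i k; rewrite XP; [exact: qpmfE|exact: measurable_quant].
- move=> w Aw; have [?|nNul] := pselect (Nul w); [by left|right].
  have XD i : 0 <= X i w <= D.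
    apply: contrapT => nX; apply: nNul => /(_ i Logic.I) /=.
    by rewrite in_itv.
  pose Wc t i := capped_sales lam (sel F t i) w.
  have WcE t i : Wc t i = Num.min (X (t, i) w) (a t).
    rewrite /Wc /capped_sales /sales -minA; congr Num.min.
    by apply: min_r; have := sel_qualified F t i; rewrite inE.
  have Wca t i : 0 <= Wc t i <= a t.
    rewrite WcE le_min ge_min lexx orbT andbT.
    by have /andP[-> _] := XD (t, i); have /andP[-> _] := aD t.
  have WcD t i : 0 <= Wc t i <= D.
    have /andP[-> w1] := Wca t i; have /andP[_ w2] := aD t.
    exact: le_trans w1 w2.
  set Sh := levels F w.
  have erm : product_erm M hT Wc x1 Sh := levels_erm F w.
  have Sha t : 0 <= Sh t <= a t.
    by rewrite (erm_le_cap Wca erm) andbT; have [[/(_ t)/andP[]]] := erm.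
  have SD S : (forall t, 0 <= S t <= a t) -> forall t, 0 <= S t <= D.
    move=> Sa t; have /andP[-> s1] := Sa t; have /andP[_ s2] := aD t.
    exact: le_trans s1 s2.
  pose v : {ffun 'I_m.+1 * 'I_n -> V} := [ffun i => q i (X i w)].
  pose Wq t i := val_ t (v (t, i)).
  have WqD t i : 0 <= Wq t i <= D by exact: valD.
  have Wclose t i : `|Wc t i - Wq t i| <= eta.
    rewrite distrC WcE /Wq ffunE; apply: quant_close => //.
    by have /andP[] := XD (t, i).
  have emp S := empirical_loss_near x1 S n0 WcD WqD (ltW eta0) Wclose.
  have capE S : (forall t, 0 <= S t <= a t) -> bsval E S (enum 'I_m.+1) x1 =
      bsval Ecap S (enum 'I_m.+1) x1 + lost_cap E a (enum 'I_m.+1).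
    move=> Sa; apply: bsval_cap => //; first exact: sorted_cap.
    by rewrite enumE -period1E; case/andP: x1a.
  have mean S : `|bsval Ecap S (enum 'I_m.+1) x1 - mean_loss M p val_ x1 S|
      <= T%:R ^+ 2 * C * eta.
    have sz : T%:R = (size (enum 'I_m.+1))%:R :> R by rewrite size_enum_ord.
    rewrite -(bsval_mean_loss p0 p1 valD) sz.
    apply: bsval_close; last exact: ltW.
    by move=> t K f K0 fK; exact: qpmf_close.
  have := Aeps w Aw; rewrite regE lte_fin !capE// => h1.
  have h2 : empirical_loss M Wc x1 Sh <= empirical_loss M Wc x1 Ss by exact: erm.2.
  have := emp Sh; have := emp Ss; have := mean Sh; have := mean Ss.
  rewrite !ler_norml => /andP[h3 h4] /andP[h5 h6] /andP[h7 h8] /andP[h9 h10].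
  have [big|small] := ltP (eps / 4) (gap v Sh).
    apply/orP; left; apply/asboolP; exists Sh; first exact: SD.
    by rewrite expr0 mul1r.
  apply/orP; right; apply/asboolP; exists Ss; first exact: SD.
  have gE S : gap v S = mean_loss M p val_ x1 S - empirical_loss M Wq x1 S by [].
  rewrite expr1 mulN1r; move: small h1 h2 h3 h4 h5 h6 h7 h8 h9 h10 etaP; rewrite !gE /T -/C.
  move: (mean_loss _ _ _ _ _) (mean_loss _ _ _ _ _) (bsval _ _ _ _) (bsval _ _ _ _).
  move: (empirical_loss _ _ _ Ss) (empirical_loss _ _ _ Ss).
  move: (empirical_loss _ _ _ Sh) (empirical_loss _ _ _ Sh).
  move: (m.+1%:R ^+ 2 * C * eta) (lost_cap _ _ _) => A1 A2 A3 A4 A5 A6 A7 A8 A9 A10.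
  lra.
rewrite lee_fin.
have dev b := deviation_tail n0 p0 p1 valD xD b (divr_gt0 eps0 (ltr0Sn R 3)).
have W0 v : 0 <= prodw (fun q : 'I_m.+1 * 'I_n => p q.1) v by apply: prodw_ge0.
rewrite mulr_natl mulr2n; apply: le_trans (lerD (dev false) (dev true)).
rewrite big_mkcond [X in _ <= X + _]big_mkcond [X in _ <= _ + X]big_mkcond -big_split/=.
apply: ler_sum => v _; rewrite -/(bad false v) -/(bad true v).
by case: (bad false v); case: (bad true v) => /=; rewrite ?addr0 ?add0r// lerDl.
Qed.

End RegretTail.

(** * The coverage test *)

Section CoverageTest.
Context (R : realType) (T : nat) (M : lost_sales R T)
  (d : measure_display) (Omega : measurableType d) (Pr : probability Omega R)
  (L : sales_logs M Pr) (lam : 'I_T -> R) (delta : R).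
Hypothesis delta01 : 0 < delta < 1.
Variable t : 'I_T.
Hypothesis qualified_gt0 : (1 <= nqualified L lam t)%N.

Let a := cap lam t.
Let mt := nqualified L lam t.
Let A : set R := [set x | x < a].
Let lg := ln (4 * T%:R / delta).
Let r := Num.sqrt (lg / (2 * mt%:R)).
Let X (i : 'I_mt) : {RV Pr >-> R} := latent (enum_val i).

Definition test_mean (w : Omega) : R :=
  (\sum_(j in qualified L lam t) (sales j w < cap lam t)%R%:R) / mt%:R.

Let T0 : 0 < T%:R :> R.
Proof. by rewrite ltr0n; apply: leq_ltn_trans (ltn_ord t). Qed.

Let mt0 : 0 < mt%:R :> R. Proof. by rewrite ltr0n. Qed.

Let mA : measurable A.
Proof.
by rewrite (_ : A = `]-oo, a[%classic)//; apply/seteqP; split=> x /=; rewrite in_itv.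
Qed.

Lemma log_test_gt0 : 0 < ln (4 * T%:R / delta).
Proof.
apply: ln_gt0; have /andP[d0 d1] := delta01.
rewrite ltr_pdivlMr// mul1r (lt_le_trans d1)//.
have : 1 <= T%:R :> R by rewrite ler1n -(ltr0n R).
by lra.
Qed.

(** On a qualified log the boundary is at least the cap, so sales fall below the cap exactly when
    demand does. *)
Let test_sum w : \sum_(j in qualified L lam t) (sales j w < cap lam t)%R%:R
  = \sum_i \1_A (X i w) :> R.
Proof.
rewrite big_enum_val/=; apply: eq_bigr => i _; rewrite indicE /X.
congr ((nat_of_bool _)%:R : R); apply/idP/idP.
  rewrite /sales gt_min => /orP[lt|]; first exact: mem_set.
  have : cap lam t <= boundary (enum_val i).
    by have := enum_valP i; rewrite /qualified finset.in_set.
  by rewrite leNgt => /negPf ->.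
by move/set_mem => /= lt; rewrite /sales gt_min lt.
Qed.

Let X_indep : mutually_independent Pr (fun i => X i : Omega -> R).
Proof.
pose e (i : 'I_mt) : {t : 'I_T & 'I_(nlogs L t)} :=
  Tagged (fun t => 'I_(nlogs L t)) (enum_val i : 'I_(nlogs L t)).
have ei : injective e.
  by move=> i j /eqP; rewrite /e eq_Tagged /= => /eqP /enum_val_inj.
exact: (mutually_independent_inj ei (@latent_indep _ _ _ _ _ _ L)).
Qed.

Let XA i : Pr (X i @^-1` A) = (Fminus M t a)%:E.
Proof.
rewrite -[LHS]/(distribution Pr (X i) A) latent_law// /Fminus fineK//.
by rewrite fin_num_measure.
Qed.

Let F01 : 0 <= Fminus M t a <= 1.
Proof.
rewrite /Fminus fine_ge0//= -lee_fin fineK ?fin_num_measure//.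
exact: probability_le1.
Qed.

Let rad_sq : expR (- (2 * mt%:R * r ^+ 2)) = delta / (4 * T%:R).
Proof.
have /andP[d0 _] := delta01.
rewrite /r sqr_sqrtr; last first.
  by rewrite divr_ge0 ?mulr_ge0// ltW// log_test_gt0.
have -> : 2 * mt%:R * (lg / (2 * mt%:R)) = lg by field; rewrite gt_eqF.
rewrite expRN lnK ?invf_div// posrE.
by rewrite divr_gt0// mulr_gt0.
Qed.

Lemma measurable_test_mean : measurable_fun setT test_mean.
Proof.
rewrite (_ : test_mean = fun w => (\sum_i \1_A (X i w)) / mt%:R); last first.
  by apply/funext => w; rewrite /test_mean test_sum.
apply: measurable_funM => //; apply: measurable_sum => i.
apply: measurableT_comp => //; exact: measurable_indic.
Qed.

(** Passing puts the sample mean above q + r >= F + r, and [rad_sq] evaluates Hoeffding's bound at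
    the radius r. *)
Lemma test_pass_tail (E : set Omega) : Fminus M t a <= crit_ratio M t ->
  measurable E -> (forall w, E w -> test_passes L lam delta w) ->
  (Pr E <= (delta / (4 * T%:R))%:E)%E.
Proof.
move=> Fq mE Etest; rewrite -rad_sq.
have -> : mt%:R = #|'I_mt|%:R :> R by rewrite card_ord.
apply: (hoeffding_count_ge X_indep mA XA F01 (sqrtr_ge0 _) mE).
move=> w /Etest/(_ t); rewrite -/mt test_sum card_ord => lt.
rewrite mulrC -ler_pdivlMr//.
move: lt; rewrite -/lg -/r; move: (crit_ratio _ _) Fq => q; lra.
Qed.

(** The sample size gives r <= gamma / 2, so on failure the sample mean is at most q + r <= F -
    gamma + r <= F - r. *)
Lemma test_fail_tail (gamma : R) : 0 < gamma ->
  crit_ratio M t + gamma <= Fminus M t a ->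
  4 * (lg / gamma ^+ 2) <= mt%:R ->
  (Pr [set w | (test_mean w - r <= crit_ratio M t)%R] <= (delta / (4 * T%:R))%:E)%E.
Proof.
move=> g0 Fq mg; rewrite -rad_sq.
have rg : r <= gamma / 2.
  rewrite /r -[gamma / 2]ger0_norm; last by rewrite divr_ge0 ?ltW.
  rewrite -sqrtr_sqr ler_sqrt; last exact: sqr_ge0.
  rewrite ler_pdivrMr ?mulr_gt0//.
  move: mg; rewrite mulrA ler_pdivrMr ?exprn_gt0// => mg.
  have : 0 < lg by exact: log_test_gt0.
  by rewrite expr_div_n; lra.
have mE : measurable [set w | test_mean w - r <= crit_ratio M t].
  rewrite (_ : [set w | _] = setT `&` test_mean @^-1` `]-oo, (crit_ratio M t + r)]%classic).
    exact: measurable_test_mean.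
  rewrite setTI; apply/seteqP; split=> w /=; rewrite in_itv/=.
    by rewrite lerBlDr.
  by rewrite -lerBlDr.
have -> : mt%:R = #|'I_mt|%:R :> R by rewrite card_ord.
apply: (hoeffding_count_le X_indep mA XA F01 (sqrtr_ge0 _) mE).
move=> w /=; rewrite /test_mean test_sum card_ord => le.
rewrite mulrC -ler_pdivrMr//.
move: le Fq; move: (_ / _) (crit_ratio _ _) (Fminus _ _ _) => x y z; rewrite -/lg -/r; lra.
Qed.

End CoverageTest.

(** * Guarantees *)

(* deviation_tail at eps/4 gives the exponent 60 - n eps^2/(16 * 688 * 100 * B^2),
   and 60 - 62 (1 + l) <= - (l + ln 2) for l >= 0. *)
Definition sample_const (R : realType) : R := 16 * (688 * 100) * 62.

Lemma ln2_le1 (R : realType) : ln 2 <= 1 :> R.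
Proof.
rewrite -[leRHS]expRK.
by rewrite ler_ln ?posrE ?expR_gt0//; have := expR_ge1Dx (1 : R); lra.
Qed.

(** Caps equal to [dbar M] are covered by any law on [[0, dbar M]]. The resulting regret formula
    holds without the coverage condition and serves to show that the regret event is measurable. *)
Lemma exists_bellman_law (R : realType) (T : nat) (M : lost_sales R T) :
  exists S, bellman (law_expect M) S (enum 'I_T).
Proof.
have D0 : 0 < dbar M by exact: dbar_gt0.
have [||S [_ bS _]] := @exists_bellman R T M (law_expect M) (fun=> dbar M) _ _
  (enum 'I_T) (enum_uniq _); last by exists S.
- by move=> _; rewrite lexx ltW.
- move=> t y Dy; apply: ev_le; try exact: cost_lipschitz.
  move=> x /andP[x0 xD]; rewrite /cost.
  have -> : Num.max (x - dbar M) 0 = 0 by apply: max_r; rewrite subr_le0.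
  have -> : Num.max (x - y) 0 = 0 by apply: max_r; rewrite subr_le0 (le_trans xD).
  rewrite !mulr0 !addr0 ler_wpM2l ?(ltW (hold_gt0 M t))//.
  by rewrite le_max2// lerD2r.
Qed.

Section Guarantees.
Context (R : realType) (m : nat) (M : lost_sales R m.+1)
  (d : measure_display) (Omega : measurableType d) (Pr : probability Omega R)
  (L : sales_logs M Pr) (lam : 'I_m.+1 -> R) (hT : (0 < m.+1)%N)
  (delta eps x1 : R).
Let T := m.+1.
Let C : R := sample_const R.
Hypothesis lamD : forall t, 0 <= lam t <= dbar M.
Hypothesis delta01 : 0 < delta < 1.
Hypothesis eps0 : 0 < eps.
Hypothesis x1a : 0 <= x1 <= cap lam (period1 hT).
Hypothesis qualified_gt0 : forall t, (1 <= nqualified L lam t)%N.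

Let delta0 : 0 < delta. Proof. by case/andP: delta01. Qed.
Let TR : 0 < T%:R :> R. Proof. by rewrite ltr0n. Qed.
Let x10 : 0 <= x1. Proof. by case/andP: x1a. Qed.

Section Fitted.
Context (n : nat) (F : fitted L lam hT x1 n).

Lemma measurable_regret_gt :
  measurable [set w | (eps%:E < regret M (base_stock (levels F w)) x1)%E].
Proof.
have [S bS] := exists_bellman_law M.
pose V S' := bsval (law_expect M) S' (enum 'I_m.+1) x1.
rewrite (_ : [set w | _] = [set w | eps + V S < V (levels F w)]); last first.
  by apply/seteqP; split=> w /=; rewrite (regretE _ bS x10) lte_fin ltrBrDr.
apply: (@measurable_lipschitz_levels _ _ _ _ V
  ((size (enum 'I_m.+1))%:R * cost_coef M)).
- by rewrite mulr_ge0// cost_coef_ge0.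
- by move=> S1 S2 e Se e0; apply: bsval_near => //; rewrite subrr normr0.
- exact: measurable_levels.
Qed.

Lemma measurable_test_passes : measurable [set w | test_passes L lam delta w].
Proof.
rewrite (_ : [set w | _] = \bigcap_(t in [set: 'I_m.+1])
  [set w | crit_ratio M t < test_mean L lam t w
     - Num.sqrt (ln (4 * T%:R / delta) / (2 * (nqualified L lam t)%:R))]).
  apply: fin_bigcap_measurable => // t _.
  set c := Num.sqrt _.
  rewrite (_ : [set w | _] = setT `&` test_mean L lam t @^-1`
      `](crit_ratio M t + c), +oo[%classic).
    exact: measurable_test_mean.
  rewrite setTI; apply/seteqP; split=> w /=; rewrite in_itv/= andbT.
    by rewrite ltrBrDr.
  by rewrite -ltrBrDr.
by apply/seteqP; split=> w H t => [_|]; [exact: (H t)|exact: (H t Logic.I)].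
Qed.

Lemma tail_le_half_delta : admissible L lam C delta eps n ->
  2 * expR (60 - n%:R * (eps / 4) ^+ 2
    / (688 * 100 * (T%:R * (cost_coef M * dbar M)) ^+ 2)) <= delta / 2.
Proof.
move=> [_ nC _].
have C0 : 0 < cost_coef M by exact: cost_coef_gt0.
have D0 : 0 < dbar M by exact: dbar_gt0.
pose l := ln (2 / delta).
have l0 : 0 < l.
  by apply: ln_gt0; rewrite ltr_pdivlMr//; case/andP: delta01; lra.
(* Twice the exponential is to be at most delta / 2, so the exponential at most delta / 4. *)
have ldelta : delta / 4 = expR (- (l + ln 2)).
  have d2 : 0 < 2 / delta by rewrite divr_gt0.
  have d22 : 0 < 2 / delta * 2 by rewrite mulr_gt0.
  have -> : l + ln 2 = ln (2 / delta * 2) by rewrite lnM ?posrE.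
  by rewrite expRN lnK ?posrE//; field; rewrite gt_eqF.
set Z := 60 - _; suff Zl : Z <= - (l + ln 2).
  have : expR Z <= delta / 4 by rewrite ldelta ler_expR.
  by lra.
rewrite /Z.
pose B := cost_coef M ^+ 2 * dbar M ^+ 2 * T%:R ^+ 2.
have B0 : 0 < B by rewrite !mulr_gt0 ?exprn_gt0.
have k0 : 0 < 688 * 100 :> R by lra.
move: nC; rewrite /sample_scale -/B -/l /C /sample_const.
move: (688 * 100) k0 => k k0 nC.
have -> : n%:R * (eps / 4) ^+ 2 / (k * (T%:R * (cost_coef M * dbar M)) ^+ 2)
    = n%:R * eps ^+ 2 / (16 * k * B).
  by rewrite /B; field; rewrite !gt_eqF.
have e2 : 0 < eps ^+ 2 by rewrite exprn_gt0.
have : 62 * (1 + l) <= n%:R * eps ^+ 2 / (16 * k * B).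
  rewrite ler_pdivlMr ?mulr_gt0// -ler_pdivrMr//.
  apply: le_trans nC.
  by rewrite le_eqVlt; apply/orP; left; apply/eqP; field; rewrite gt_eqF.
have := ln2_le1 R; lra.
Qed.

Lemma regret_gt_le (A : set Omega) : admissible L lam C delta eps n ->
  (forall t, crit_ratio M t <= Fminus M t (cap lam t)) -> measurable A ->
  (forall w, A w -> (eps%:E < regret M (base_stock (levels F w)) x1)%E) ->
  (Pr A <= (delta / 2)%:E)%E.
Proof.
move=> adm cov mA Aeps; have [n0 _ _] := adm.
apply: le_trans (regret_tail lamD cov eps0 x1a n0 mA Aeps) _.
by rewrite lee_fin; exact: tail_le_half_delta.
Qed.

(** Coverage holds or fails for the laws, whatever the data; in either case a single tail bound
    controls the event. Test and fit may thus share observations, since no independence between them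
    is invoked. *)
Lemma returns_bad_le : admissible L lam C delta eps n ->
  (Pr (returns_bad L lam delta eps x1 (levels F)) <= delta%:E)%E.
Proof.
move=> adm.
have mB : measurable (returns_bad L lam delta eps x1 (levels F)).
  exact: measurableI measurable_test_passes measurable_regret_gt.
have [cov|/existsNP[t /negP]] :=
  pselect (forall t, crit_ratio M t <= Fminus M t (cap lam t)).
  apply: le_trans (regret_gt_le adm cov mB _) _; first by move=> w [].
  by rewrite lee_fin; move: delta0; lra.
rewrite -ltNge => /ltW Fq.
apply: le_trans (test_pass_tail delta01 (qualified_gt0 t) Fq mB _) _.
  by move=> w [].
rewrite lee_fin ler_pdivrMr ?mulr_gt0//.
have T1 : 1 <= T%:R :> R by rewrite ler1n.
rewrite -[leLHS]mulr1 ler_pM2l// -/T; move: T1; move: (T%:R : R) => u; lra.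
Qed.

(** A union bound: delta / 2 for the fit and T * delta / (4 T) for the tests, together 3 delta /
    4. *)
Lemma returns_good_ge (gamma : 'I_m.+1 -> R) : admissible L lam C delta eps n ->
  (forall t, 0 < gamma t) ->
  (forall t, crit_ratio M t + gamma t <= Fminus M t (cap lam t)) ->
  (forall t, 4 * (ln (4 * T%:R / delta) / gamma t ^+ 2) <= (nqualified L lam t)%:R) ->
  ((1 - delta)%:E <= Pr (returns_good L lam delta eps x1 (levels F)))%E.
Proof.
move=> adm g0 gF gm.
pose bad := [set w | (eps%:E < regret M (base_stock (levels F w)) x1)%E].
pose fail t := [set w | test_mean L lam t w
     - Num.sqrt (ln (4 * T%:R / delta) / (2 * (nqualified L lam t)%:R))
       <= crit_ratio M t].
have mfail t : measurable (fail t).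
  set c := Num.sqrt (ln (4 * T%:R / delta) / (2 * (nqualified L lam t)%:R)).
  rewrite (_ : fail t = setT `&` test_mean L lam t @^-1`
      `]-oo, (crit_ratio M t + c)]%classic).
    exact: measurable_test_mean.
  rewrite setTI; apply/seteqP; split=> w /=; rewrite in_itv/= /fail/= -/c.
    by rewrite lerBlDr.
  by rewrite lerBlDr.
have goodE : ~` returns_good L lam delta eps x1 (levels F) `<=`
    bad `|` \big[setU/set0]_(t < T) fail t.
  move=> w ng; have [?|nb] := pselect (bad w); [by left|right].
  apply: contrapT => nf; apply: ng; split=> [t|]; last first.
    by rewrite leNgt; apply/negP.
  rewrite ltNge; apply/negP => ft; apply: nf; rewrite (bigD1 t)//=; left.
  exact: ft.
have mgood : measurable (returns_good L lam delta eps x1 (levels F)).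
  rewrite (_ : returns_good _ _ _ _ _ _ =
    [set w | test_passes L lam delta w] `&` ~` bad).
    apply: measurableI; first exact: measurable_test_passes.
    by apply: measurableC; exact: measurable_regret_gt.
  apply/seteqP; split=> w [tw].
    by rewrite leNgt => /negP.
  by move=> /negP; rewrite -leNgt.
have mU : measurable (\big[setU/set0]_(t < T) fail t) by exact: bigsetU_measurable.
have cov t : crit_ratio M t <= Fminus M t (cap lam t).
  by apply: le_trans (gF t); rewrite lerDl ltW.
have Pbad : (Pr bad <= (delta / 2)%:E)%E.
  by apply: (regret_gt_le adm cov measurable_regret_gt).
have Pfail : (Pr (\big[setU/set0]_(t < T) fail t) <= (delta / 4)%:E)%E.
  apply: le_trans (probability_le_sum (V := 'I_T) (B := predT) (F := fail)
    mU measurable0 (measure0 Pr) mfail _) _.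
    move=> w; rewrite -bigcup_seq => -[t _ ft]; right; by exists t.
  apply: (@le_trans _ _ (\sum_(t < T) (delta / (4 * T%:R))%:E)%E).
    apply: lee_sum => t _.
    exact: (test_fail_tail delta01 (qualified_gt0 t) (g0 t) (gF t) (gm t)).
  rewrite sumEFin lee_fin sumr_const card_ord -[leLHS]mulr_natl.
  by rewrite le_eqVlt; apply/orP; left; apply/eqP; field; rewrite gt_eqF.
have Pc : (Pr (~` returns_good L lam delta eps x1 (levels F)) <= delta%:E)%E.
  apply: (@le_trans _ _ ((delta / 2)%:E + (delta / 4)%:E)%E); last first.
    by rewrite -EFinD lee_fin; move: delta0; lra.
  apply: le_trans (leeD Pbad Pfail).
  have mb : measurable bad by exact: measurable_regret_gt.
  apply: le_trans (measureU2 Pr mb mU).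
  apply: le_measure; rewrite ?inE//; first exact: measurableC.
  exact: measurableU.
move: Pc; rewrite probability_setC//.
rewrite -[Pr _]fineK ?fin_num_measure// -EFinB !lee_fin; lra.
Qed.

End Fitted.

Lemma guarantee (gamma : 'I_m.+1 -> R) :
  (forall t, 0 < gamma t) ->
  (forall t, crit_ratio M t + gamma t <= Fminus M t (cap lam t)) ->
  (forall t, C * Num.max (sample_scale M delta eps)
      (ln (4 * T%:R / delta) / gamma t ^+ 2) <= (nqualified L lam t)%:R) ->
  passes_and_eps_optimal L lam hT C delta eps x1.
Proof.
move=> g0 gF gm.
have C4 : 4 <= C by rewrite /C /sample_const; lra.
have C0 : 0 <= C by apply: le_trans C4.
split; last first.
  move=> n adm F; apply: (returns_good_ge F adm g0 gF) => t.
  apply: le_trans (gm t).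
  have lg0 : 0 <= ln (4 * T%:R / delta) / gamma t ^+ 2.
    by rewrite divr_ge0 ?sqr_ge0// ltW// log_test_gt0.
  apply: (@le_trans _ _ (C * (ln (4 * T%:R / delta) / gamma t ^+ 2))).
    by rewrite ler_wpM2r.
  by rewrite ler_wpM2l// le_max lexx orbT.
(* The smallest number of qualified logs over the periods is an admissible [n]. *)
have [t0 _ tmin] := @arg_minnP 'I_m.+1 ord0 predT (nqualified L lam) isT.
exists (nqualified L lam t0); split; first exact: qualified_gt0.
- apply: le_trans (gm t0); rewrite ler_wpM2l//.
  by rewrite le_max lexx.
- by move=> t; exact: tmin.
Qed.

End Guarantees.

Theorem corollary4 (R : realType) :
  exists C C' : R, [/\ 0 < C, 0 < C',
    forall (T : nat) (hT : (0 < T)%N) (M : lost_sales R T)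
      (d : measure_display) (Omega : measurableType d)
      (Pr : probability Omega R) (L : sales_logs M Pr)
      (lam : 'I_T -> R) (delta eps x1 : R),
      (forall t, 0 <= lam t <= dbar M) ->
      0 < delta < 1 -> 0 < eps -> 0 <= x1 <= cap lam (period1 hT) ->
      (forall t, (1 <= nqualified L lam t)%N) ->
      (forall n, admissible L lam C delta eps n ->
         forall F : fitted L lam hT x1 n,
           (Pr (returns_bad L lam delta eps x1 (levels F)) <= delta%:E)%E)
      /\
      (forall gamma : 'I_T -> R,
         (forall t, 0 < gamma t) ->
         (forall t, Fminus M t (cap lam t) >= crit_ratio M t + gamma t) ->
         (forall t, (nqualified L lam t)%:R >=
            C' * Num.max (sample_scale M delta eps)
                         (ln (4 * T%:R / delta) / gamma t ^+ 2)) ->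
         passes_and_eps_optimal L lam hT C delta eps x1)
  & forall delta : R, 0 < delta < 1 ->
    exists K : R, 0 < K /\
    forall (T : nat) (hT : (0 < T)%N) (eps r : R) (gamma : 'I_T -> R),
      (2 <= T)%N -> 0 < eps <= T%:R -> 0 < r <= 1 ->
      (forall t, 0 < gamma t) ->
      exists Nbar : 'I_T -> nat,
        (\sum_(t < T) Nbar t)%:R
          <= K * (r^-1 * \sum_(t < T) Num.max (T%:R ^+ 2 / eps ^+ 2)
                                             (ln T%:R / gamma t ^+ 2)) /\
        forall (M : lost_sales R T)
          (d : measure_display) (Omega : measurableType d)
          (Pr : probability Omega R) (L : sales_logs M Pr)
          (lam : 'I_T -> R) (x1 : R),
          cost_coef M = 1 -> dbar M = 1 ->
          (forall t, 0 <= lam t <= dbar M) ->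
          0 <= x1 <= cap lam (period1 hT) ->
          (forall t, Fminus M t (cap lam t) >= crit_ratio M t + gamma t) ->
          (forall t, (Nbar t <= nlogs L t)%N) ->
          (forall t, (nqualified L lam t)%:R >= r * (nlogs L t)%:R) ->
          passes_and_eps_optimal L lam hT C delta eps x1].
Proof.
have C0 : 0 < sample_const R by rewrite /sample_const; lra.
exists (sample_const R), (sample_const R); split=> //.
  move=> [//|m] hT M d Omega Pr L lam delta eps x1 lamD delta01 eps0 x1a q0.
  split; first by move=> n adm F; exact: returns_bad_le.
  by move=> gamma g0 gF gm; exact: (guarantee lamD delta01 eps0 x1a q0 g0 gF gm).
move=> delta delta01; have /andP[delta0 delta1] := delta01.
have l2 : 0 < ln 2 :> R by rewrite ln_gt0// ltr1n.
have l2d : 0 <= ln (2 / delta) by apply: ln_ge0; rewrite ler_pdivlMr//; lra.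
have l4d : 0 <= ln (4 / delta) by apply: ln_ge0; rewrite ler_pdivlMr//; lra.
(* Absorbs the confidence level: the first entry serves [sample_scale], the second gives ln(4 T /
   delta) <= (ln(4 / delta) / ln 2 + 1) ln T for T >= 2. *)
pose G := Num.max (1 + ln (2 / delta)) (ln (4 / delta) / ln 2 + 1).
have G1 : 1 <= G.
  by rewrite /G le_max lerDl l2d.
have CG0 : 0 < sample_const R * G by rewrite mulr_gt0// (lt_le_trans _ G1).
(* The additional 1 pays for rounding the counts up to integers. *)
exists (sample_const R * G + 1); split; first by rewrite addr_gt0.
move=> [//|m] hT eps r gamma T2 /andP[eps0 epsT] /andP[r0 r1] g0.
set T := m.+1.
have T0 : 0 < T%:R :> R by rewrite ltr0n.
have rV : 1 <= r^-1 by rewrite invf_ge1.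
pose mx t := Num.max (T%:R ^+ 2 / eps ^+ 2) (ln T%:R / gamma t ^+ 2).
(* This is where eps <= T enters: a count of one log is then at most [r^-1 * mx t]. *)
have mx1 t : 1 <= mx t.
  by rewrite le_max -expr_div_n exprn_ege1// ler_pdivlMr// mul1r.
pose need t := r^-1 * (sample_const R * G * mx t).
have need0 t : 0 <= need t.
  apply: mulr_ge0; first by rewrite invr_ge0 ltW.
  by apply: mulr_ge0 (ltW CG0) _; exact: le_trans (mx1 t).
exists (fun t => (Num.truncn (need t)).+1); split.
  rewrite natr_sum !mulr_sumr; apply: ler_sum => t _.
  have /andP[le _] := truncn_itv (need0 t).
  rewrite -natr1 mulrDl mul1r; apply: lerD.
    by apply: le_trans le _; rewrite /need mulrCA.
  by apply: le_trans (mx1 t) _; rewrite ler_peMl// (le_trans _ (mx1 t)).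
move=> M d Omega Pr L lam x1 Cc Db lamD x1a gF nN nr.
have q1 t : sample_const R * G * mx t < (nqualified L lam t)%:R.
  apply: lt_le_trans (nr t).
  have -> : sample_const R * G * mx t = r * need t by rewrite /need mulVKf// gt_eqF.
  rewrite ltr_pM2l//; have /andP[_ lt] := truncn_itv (need0 t).
  by apply: lt_le_trans lt _; rewrite ler_nat.
have lnT : ln 2 <= ln T%:R :> R by rewrite ler_ln ?posrE// ler_nat.
apply: (@guarantee _ _ _ _ _ _ _ _ _ _ _ _ lamD delta01 eps0 x1a _ gamma) => // t.
  rewrite -(ltr0n R); apply: le_lt_trans (q1 t).
  by apply: mulr_ge0 (ltW CG0) _; exact: le_trans (mx1 t).
apply: le_trans (ltW (q1 t)); rewrite -[leRHS]mulrA ler_pM2l// -/T ge_max; apply/andP; split.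
  rewrite /sample_scale Cc Db !expr1n !mul1r mulrC; apply: ler_pM.
  - exact: addr_ge0.
  - by rewrite divr_ge0// sqr_ge0.
  - by rewrite le_max lexx.
  - by rewrite le_max lexx.
apply: (@le_trans _ _ (G * (ln T%:R / gamma t ^+ 2))); last first.
  by rewrite ler_wpM2l ?(le_trans _ G1)// le_max lexx orbT.
rewrite mulrA ler_pM2r ?invr_gt0 ?exprn_gt0//.
have -> : ln (4 * T%:R / delta) = ln (4 / delta) + ln T%:R.
  by rewrite -lnM ?posrE ?divr_gt0//; congr ln; field; rewrite gt_eqF.
apply: (@le_trans _ _ ((ln (4 / delta) / ln 2 + 1) * ln T%:R)).
  rewrite [leRHS]mulrDl mul1r lerD2r mulrAC ler_pdivlMr// ler_wpM2l//.
rewrite ler_wpM2r ?(le_trans (ltW l2))//.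
by rewrite le_max lexx orbT.
Qed.
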